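(* Let $p\colon M_1\to M_0$ be a Riemannian covering of connected Riemannian manifolds, let $S_0=\Delta+V_0$ with $V_0\in C^\infty(M_0)$ be a Schrödinger operator on $M_0$, and let $S_1=\Delta+V_0\circ p$ be its lift to $M_1$. Assume that $S_0$ and $S_1$ are bounded from below on $C^\infty_c(M_0)\subseteq L^2(M_0)$ and $C^\infty_c(M_1)\subseteq L^2(M_1)$, respectively. Then $$\lambda_0(S_1,M_1)\ \ge\ \lambda_0(S_0,M_0).$$
   Context: Riemannian manifolds are without boundary and are not assumed to be complete; $p$ is a covering map that is a local isometry (not necessarily normal or finite-sheeted). $\Delta$ denotes the non-negative Laplacian. A Schrödinger operator on $M$ is an operator $S=\Delta+V$ with $V\in C^\infty(M)$ real valued; with domain $C^\infty_c(M)\subseteq L^2(M)$ it is symmetric. If $S$ is bounded from below on $C^\infty_c(M)$, then $\bar S$ denotes its Friedrichs extension, which is self-adjoint, and $\lambda_0(S,M)=\inf\sigma(\bar S)$ is the bottom of the spectrum of $\bar S$. It is given by $$\lambda_0(S,M)=\inf_f \frac{\int_M(|\operatorname{grad} f|^2+Vf^2)}{\int_M f^2},$$ where the infimum is over all non-zero $f\in C^\infty_c(M)$, or, equivalently, over all non-zero Lipschitz functions $f$ on $M$ with compact support. *)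

(* Defs.v *)
From HB Require Import structures.
From mathcomp Require Import all_boot all_order all_algebra.
From mathcomp Require Import all_classical all_reals all_analysis.
Import Order.TTheory GRing.Theory Num.Theory.
Import numFieldNormedType.Exports.

Set Implicit Arguments.
Unset Strict Implicit.
Unset Printing Implicit Defensive.

Local Open Scope classical_set_scope.
Local Open Scope ring_scope.

(** * Calculus on open subsets of R^n *)

Definition partial {R : realType} {n : nat} (a : 'I_n) (f : 'rV[R]_n -> R) :
    'rV[R]_n -> R :=
  fun x => 'D_(delta_mx 0 a) f x.

(* For open [A] this is C^oo on [A]: every iterated partial derivative is
   differentiable, hence continuous, on [A]. *)
Definition smooth_on {R : realType} {n : nat} (A : set 'rV[R]_n)
    (f : 'rV[R]_n -> R) : Prop :=
  forall (s : seq 'I_n) (x : 'rV[R]_n), A x ->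
    differentiable (foldr partial f s) x.

Definition smooth_map_on {R : realType} {n : nat} (A : set 'rV[R]_n)
    (f : 'rV[R]_n -> 'rV[R]_n) : Prop :=
  forall k : 'I_n, smooth_on A (fun x => f x 0 k).

(* [f] pulls the metric tensor [h] back to [g] on [A]. The library's Jacobian
   acts on row vectors from the right: df_x(v) = v *m 'J f x. *)
Definition isometric_on {R : realType} {n : nat} (A : set 'rV[R]_n)
    (g h : 'rV[R]_n -> 'M[R]_n) (f : 'rV[R]_n -> 'rV[R]_n) : Prop :=
  forall x, A x -> g x = 'J f x *m h (f x) *m ('J f x)^T.

(* Integral with respect to n-dimensional Lebesgue measure, as an iterated
   integral (Tonelli); only used for non-negative Borel functions. *)
Fixpoint integral_rV {R : realType} (n : nat) :
    ('rV[R]_n -> \bar R) -> \bar R :=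
  match n with
  | 0 => fun f => f 0
  | m.+1 => fun f =>
      (\int[@lebesgue_measure R]_t
         integral_rV (fun y : 'rV[R]_m => f (row_mx (t%:M : 'rV[R]_1) y)))%E
  end.

(** * Riemannian manifolds *)

(* A smooth n-manifold without boundary, given by a smooth atlas.
   [chart_inv i] is only meaningful on the image of [chart_dom i]. The
   preferred chart [chart_at x] around [x] says that the charts cover. *)
Record manifold (R : realType) (n : nat) := Manifold {
  carrier :> ptopologicalType ;
  manifold_hausdorff : hausdorff_space carrier ;
  manifold_second_countable : @second_countable carrier ;
  chart_index : Type ;
  chart_dom : chart_index -> set carrier ;
  chart : chart_index -> carrier -> 'rV[R]_n ;
  chart_inv : chart_index -> 'rV[R]_n -> carrier ;
  chart_at : carrier -> chart_index ;
  chart_at_dom : forall x, chart_dom (chart_at x) x ;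
  chart_dom_open : forall i, open (chart_dom i) ;
  chart_img_open : forall i, open (chart i @` chart_dom i) ;
  chartK : forall i x, chart_dom i x -> chart_inv i (chart i x) = x ;
  chart_continuous : forall i, {within chart_dom i, continuous (chart i)} ;
  chart_inv_continuous : forall i,
    {within chart i @` chart_dom i, continuous (chart_inv i)} ;
  transition_smooth : forall i j,
    smooth_map_on (chart i @` (chart_dom i `&` chart_dom j))
      (chart j \o chart_inv i)
}.

Definition chart_img {R : realType} {n : nat} (M : manifold R n)
    (i : chart_index M) : set 'rV[R]_n :=
  chart i @` chart_dom i.

Definition borel (T : ptopologicalType) := g_sigma_algebraType (@open T).

(* [metric i] is the matrix of the metric tensor in the chart [i]. The last two
   fields carry the Riemannian measure, which is uniquely determined by
   [volE]: in a chart its density is sqrt (det g). *)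
Record riemannianManifold (R : realType) (n : nat) := RiemannianManifold {
  rmanifold :> manifold R n ;
  metric : chart_index rmanifold -> 'rV[R]_n -> 'M[R]_n ;
  metric_smooth : forall i a b,
    smooth_on (chart_img i) (fun x => metric i x a b) ;
  metric_sym : forall i x, chart_img i x -> (metric i x)^T = metric i x ;
  metric_pos : forall i x (v : 'rV[R]_n), chart_img i x -> v != 0 ->
    0 < (v *m metric i x *m v^T) 0 0 ;
  metric_compat : forall i j,
    isometric_on (chart i @` (chart_dom i `&` chart_dom j))
      (metric i) (metric j) (chart j \o chart_inv i) ;
  vol : {measure set (borel rmanifold) -> \bar R} ;
  volE : forall i (A : set (borel rmanifold)),
    measurable A -> A `<=` chart_dom i ->
    vol A = integral_rV
      (fun x => (\1_(chart i @` A) x * Num.sqrt (\det (metric i x)))%:E)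
}.

Section functions_on_manifolds.
Context {R : realType} {n : nat}.

Definition smooth (M : manifold R n) (f : M -> R) : Prop :=
  forall i : chart_index M, smooth_on (chart_img i) (f \o chart_inv i).

Definition test_functions (M : manifold R n) : set (M -> R) :=
  [set f | smooth f /\ compact (closure [set x | f x != 0])].

(* The non-negative Laplacian - div grad, in local coordinates
   - (det g)^(-1/2) \sum_(a, b) d_a ((det g)^(1/2) g^(ab) d_b f). *)
Definition laplacian (M : riemannianManifold R n) (f : M -> R) : M -> R :=
  fun x =>
    let i := chart_at x in
    let dens y := Num.sqrt (\det (metric i y)) in
    - ((dens (chart i x))^-1 *
       \sum_(a < n) partial a
         (fun y => dens y *
            \sum_(b < n) invmx (metric i y) a b *
              partial b (f \o chart_inv i) y)
         (chart i x)).

Definition schrodinger (M : riemannianManifold R n) (V : M -> R) (f : M -> R) :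
    M -> R :=
  fun x => laplacian f x + V x * f x.

End functions_on_manifolds.

Arguments test_functions {R n} M _.

(** * Coverings *)

Definition covering_map (E B : topologicalType) (p : E -> B) : Prop :=
  [/\ continuous p,
      set_surj [set: E] [set: B] p &
      forall x : B, exists2 U : set B, open_nbhs x U &
        exists (I : Type) (W : I -> set E),
          [/\ forall k, open (W k),
              trivIset [set: I] W,
              p @^-1` U = \bigcup_k W k,
              forall k, set_bij (W k) U p &
              forall k (O : set E), open O -> O `<=` W k -> open (p @` O)]].

Definition riemannian_covering {R : realType} {n : nat}
    (M1 M0 : riemannianManifold R n) (p : M1 -> M0) : Prop :=
  covering_map p /\
  forall (i : chart_index M1) (j : chart_index M0),
    let A := chart i @` (chart_dom i `&` p @^-1` chart_dom j) in
    let f := chart j \o p \o chart_inv i in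
    smooth_map_on A f /\ isometric_on A (metric i) (metric j) f.

(** * Friedrichs extension and spectrum

   Vectors of the real Hilbert space L^2(mu) are represented by
   square-integrable functions; an unbounded operator is represented by its
   graph, a relation that is invariant under almost everywhere equality. *)

Section operators.
Context {d : measure_display} {T : measurableType d} {R : realType}.
Variable mu : {measure set T -> \bar R}.

Definition dotL2 (f g : T -> R) : R := \int[mu]_x (f x * g x).

Definition normL2 (f : T -> R) : R := Num.sqrt (dotL2 f f).

Definition bounded_below (D : set (T -> R)) (S : (T -> R) -> (T -> R)) : Prop :=
  exists c : R, forall f, D f -> c * dotL2 f f <= dotL2 (S f) f.

(* The closure of [D] for the form norm of [S]. For sequences converging in L^2
   and [S] bounded from below, being Cauchy for the form norm amounts to
   the condition on [dotL2 (S _) _] below. *)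
Definition form_domain (D : set (T -> R)) (S : (T -> R) -> (T -> R)) :
    set (T -> R) :=
  [set u | u \in Lfun mu 2%:E /\
    exists phi : nat -> T -> R,
      [/\ forall k, D (phi k),
          normL2 (phi k \- u) @[k --> \oo] --> (0 : R) &
          forall e : R, 0 < e -> exists N : nat, forall j k : nat,
            (N <= j)%N -> (N <= k)%N ->
            `|dotL2 (S (phi j \- phi k)) (phi j \- phi k)| < e]].

(* The graph of the Friedrichs extension of ([S], [D]): the restriction of the
   adjoint of [S] to the elements of its domain lying in the form domain. *)
Definition friedrichs (D : set (T -> R)) (S : (T -> R) -> (T -> R))
    (u w : T -> R) : Prop :=
  [/\ form_domain D S u,
      w \in Lfun mu 2%:E &
      forall f, D f -> dotL2 u (S f) = dotL2 w f].

(* [A - l] is a bijection from the domain of [A] onto L^2 with bounded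
   inverse; injectivity is contained in the estimate. *)
Definition resolvent_set (A : (T -> R) -> (T -> R) -> Prop) : set R :=
  [set l | (exists C : R, forall u w, A u w ->
              normL2 u <= C * normL2 (w \- (l \*o u))) /\
           (forall v, v \in Lfun mu 2%:E -> exists u, A u (v \+ (l \*o u)))].

(* The real spectrum, which is the whole spectrum when [A] is self-adjoint. *)
Definition spectrum (A : (T -> R) -> (T -> R) -> Prop) : set R :=
  ~` resolvent_set A.

End operators.

Definition bottom_spectrum {R : realType} {n : nat} (M : riemannianManifold R n)
    (S : (M -> R) -> (M -> R)) : \bar R :=
  ereal_inf (EFin @` spectrum (vol M) (friedrichs (vol M) (test_functions M) S)).

(* Main.v *)
(* Write [q_i] for the quadratic form of [S_i], and let [l < lam] where [q_0 >= lam |.|^2]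
   on test functions.  Given a test function [f] on [M1], the fibre sum
   [F y = \sum_(p x = y) (f x)^2] is smooth with compact support, and so is
   [g = sqrt (e^2 + F) - e], for [e > 0].  By the Cauchy-Schwarz inequality
   [|grad g|^2] is at most the fibre sum of [|grad f|^2], while [g^2 = F - 2 e g].
   Integrating a fibre sum over [M0] amounts to integrating over [M1], so that
   [q_0 g >= lam |g|^2] gives [q_1 f >= lam |f|^2] when [e] tends to [0].
   On the spectral side, minimising [q_1 f - l |f|^2 - 2 <v, f>] over the test
   functions solves [(S_1 - l) u = v] in the Friedrichs extension with a bound on
   [u], so [l] is in the resolvent set.  Conversely the largest [lam] with
   [q_0 >= lam |.|^2] is in the spectrum of [S_0], as a bounded inverse of
   [S_0 - lam] would allow a larger one. *)

Require Import Defs.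
From HB Require Import structures.
From mathcomp Require Import all_boot all_order all_algebra.
From mathcomp Require Import all_classical all_reals all_analysis.
From mathcomp Require Import perm measurable_realfun ring lra.
Import Order.TTheory GRing.Theory Num.Theory.
Import numFieldNormedType.Exports.

Set Implicit Arguments.
Unset Strict Implicit.
Unset Printing Implicit Defensive.

Local Open Scope classical_set_scope.
Local Open Scope ring_scope.

(** * Smooth functions on open sets of R^n *)

(** Integrating a fibre sum is related to integrating over [M1] only up to a factor. The Jacobian
    rule is obtained with an unknown constant near each point of [M1]; that constant is determined
    by any bump function, hence locally constant, hence one number as [M1] is connected. A single
    positive factor is harmless, since it multiplies both integrals of the form inequality.

    Fibres may be infinite. A compact support meets only finitely many sheets over a small
    neighbourhood, which makes the fibre sum locally a finite sum of compositions with sections of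
    [p].

    The form bound of [S_0] is known on test functions only, whereas the natural competitor [sqrt F]
    fails to be smooth where [F] vanishes. The regularisation costs an error linear in [e]; to let
    [e] tend to 0 it must be dominated by one integrable function for all [e].

    The transformation rule of the divergence (Piola identity) serves twice: for the chart
    independence of the Laplacian, and for the change of variables. *)

Section near_eq.
Context {R : numFieldType} {V W : normedModType R}.

(** The difference [g - f] vanishes near [x], so the zero map is its differential there. Chart
    expressions are meaningful on open sets only, hence the constant use of local equality. *)
Lemma near_eq_differentiable (f g : V -> W) (x : V) :
  (\near x, f x = g x) -> differentiable f x -> differentiable g x.
Proof.
move=> fg df.
have e0 : \forall h \near (0 : V), (g - f) (h + x) = 0.
  move: fg; rewrite (near_shift 0 x) /= => fg.
  by apply: filterS fg => h /=; rewrite !fctE subr0 => ->; rewrite subrr.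
have -> : g = f + (g - f) by rewrite addrC subrK.
apply: differentiableD => //.
have x0 : (g - f) x = 0 by have := nbhs_singleton e0; rewrite add0r.
have key : (g - f) \o shift x = cst ((g - f) x) + (0 : V -> W) +o_ 0 id.
  apply/eqaddoP => e /= egt0.
  near=> h.
  rewrite !fctE /= -[g x - f x]/((g - f) x) x0 addr0 subr0.
  have -> : g (h + x) - f (h + x) = 0 by near: h.
  by rewrite normr0 mulr_ge0// ltW.
have dz : 'd (g - f) x = \0 :> (V -> W).
  apply: diff_unique; [exact: cst_continuous | exact: key].
apply/diff_locallyP; rewrite dz; split; [exact: cst_continuous | exact: key].
Unshelve. all: by end_near. Qed.

End near_eq.

Section smoothness.
Context {R : realType} {n : nat}.
Implicit Types (A : set 'rV[R]_n) (f g : 'rV[R]_n -> R) (k : nat).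

(** The recursion peels off the innermost derivative, as the Leibniz and chain rules require,
    whereas [smooth_on] adds derivatives on the outside. At level 0 it asks for differentiability,
    so level [k] controls [k + 1] derivatives. *)
Fixpoint Ck k A f : Prop :=
  (forall x, A x -> differentiable f x) /\
  match k with 0 => True | k.+1 => forall a, Ck k A (partial a f) end.

Lemma smooth_onP A f : smooth_on A f <-> forall k, Ck k A f.
Proof.
split=> [fA k|fA s x Ax].
  elim: k f fA => [|k IH] f fA /=; split=> //; first 1 [exact: (fA [::])].
    by move=> x Ax; exact: (fA [::]).
  move=> a; apply: IH => s x Ax.
  by have := fA (rcons s a) x Ax; rewrite foldr_rcons.
elim/last_ind: s f fA => [|s a IH] f fA; first by have [+ _] := fA 0; exact.
by rewrite foldr_rcons; apply: IH => k; have [_] := fA k.+1; exact.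
Qed.

Lemma Ck_diff k A f : Ck k A f -> forall x, A x -> differentiable f x.
Proof. by case: k => [|k] []. Qed.

Lemma Ck_le k A f : Ck k.+1 A f -> Ck k A f.
Proof. by elim: k f => [|k IH] f [df fA]; split=> // a; exact: IH. Qed.

Lemma partial_eq_on A f g a : open A -> (forall x, A x -> f x = g x) ->
  forall x, A x -> partial a f x = partial a g x.
Proof.
move=> oA fg x Ax; apply: near_eq_derive.
by near=> y; apply: fg; near: y; exact: open_nbhs_nbhs.
Unshelve. all: by end_near. Qed.

Lemma Ck_eq k A f g : open A -> (forall x, A x -> f x = g x) ->
  Ck k A f -> Ck k A g.
Proof.
move=> oA; elim: k f g => [|k IH] f g fg [df fA]; split=> //.
- move=> x Ax; apply: near_eq_differentiable (df x Ax).
  by near=> y; apply: fg; near: y; exact: open_nbhs_nbhs.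
- move=> x Ax; apply: near_eq_differentiable (df x Ax).
  by near=> y; apply: fg; near: y; exact: open_nbhs_nbhs.
- by move=> a; apply: IH (fA a); exact: partial_eq_on.
Unshelve. all: by end_near. Qed.

Lemma smooth_on_diff A f : smooth_on A f -> forall x, A x -> differentiable f x.
Proof. by move=> fA; exact: (fA [::]). Qed.

Lemma smooth_on_partial A f a : smooth_on A f -> smooth_on A (partial a f).
Proof. by move=> fA s x Ax; have := fA (rcons s a) x Ax; rewrite foldr_rcons. Qed.

Lemma smooth_on_subset A B f : B `<=` A -> smooth_on A f -> smooth_on B f.
Proof. by move=> BA fA s x /BA; exact: fA. Qed.

Lemma smooth_on_eq A f g : open A -> (forall x, A x -> f x = g x) ->
  smooth_on A f -> smooth_on A g.
Proof. by move=> oA fg /smooth_onP fA; apply/smooth_onP => k; exact: Ck_eq (fA k). Qed.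

Lemma smooth_on_local A f : (forall x, A x -> exists2 B, B x & smooth_on B f) ->
  smooth_on A f.
Proof. by move=> fA s x /fA[B Bx]; exact. Qed.

Lemma smooth_on_continuous A f : smooth_on A f -> {in A, continuous f}.
Proof.
by move=> fA x; rewrite inE => Ax; exact/differentiable_continuous/(fA [::]).
Qed.

Lemma partial_cst a (c : R) : partial a (cst c : 'rV[R]_n -> R) = cst 0.
Proof. by apply/funext => x; rewrite /partial derive_cst. Qed.

Lemma Ck_cst k A (c : R) : Ck k A (cst c).
Proof.
elim: k c => [|k IH] c; split=> //.
  by move=> a; rewrite partial_cst; exact: IH.
Qed.

Lemma partialD a f g x : differentiable f x -> differentiable g x ->
  partial a (f \+ g) x = partial a f x + partial a g x.
Proof. by move=> df dg; rewrite /partial deriveD//; exact: diff_derivable. Qed.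

Lemma partialM a f g x : differentiable f x -> differentiable g x ->
  partial a (f \* g) x = f x * partial a g x + g x * partial a f x.
Proof. by move=> df dg; rewrite /partial deriveM//; exact: diff_derivable. Qed.

Lemma CkD k A f g : open A -> Ck k A f -> Ck k A g -> Ck k A (f \+ g).
Proof.
move=> oA; elim: k f g => [|k IH] f g [df fA] [dg gA]; split=> //.
- by move=> x Ax; apply: differentiableD; auto.
- by move=> x Ax; apply: differentiableD; auto.
- move=> a; apply: Ck_eq (IH _ _ (fA a) (gA a)) => // x Ax.
  by rewrite partialD; auto.
Qed.

Lemma CkM k A f g : open A -> Ck k A f -> Ck k A g -> Ck k A (f \* g).
Proof.
move=> oA; elim: k f g => [|k IH] f g fA0 gA0.
  by split=> // x Ax; apply: differentiableM; [exact: Ck_diff fA0 _ _|exact: Ck_diff gA0 _ _].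
have [df fA] := fA0; have [dg gA] := gA0.
split=> [x Ax|a]; first by apply: differentiableM; auto.
apply: (@Ck_eq _ _ ((f \* partial a g) \+ (g \* partial a f))) => //.
  by move=> x Ax; rewrite partialM; auto.
by apply: CkD => //; [exact: IH (Ck_le fA0) (gA a)|exact: IH (Ck_le gA0) (fA a)].
Qed.

Lemma smooth_on_cst A (c : R) : smooth_on A (cst c).
Proof. by apply/smooth_onP => k; exact: Ck_cst. Qed.

Lemma smooth_onD A f g : open A -> smooth_on A f -> smooth_on A g ->
  smooth_on A (f \+ g).
Proof. by move=> oA /smooth_onP fA /smooth_onP gA; apply/smooth_onP => k; exact: CkD. Qed.

Lemma smooth_onM A f g : open A -> smooth_on A f -> smooth_on A g ->
  smooth_on A (f \* g).
Proof. by move=> oA /smooth_onP fA /smooth_onP gA; apply/smooth_onP => k; exact: CkM. Qed.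

Lemma smooth_on_coord A j : smooth_on A (fun x => x 0 j).
Proof.
apply/smooth_onP => k.
have dc x : differentiable (fun x : 'rV[R]_n => x 0 j) x.
  exact: differentiable_coord.
case: k => [|k]; first by split.
split=> // a; rewrite (_ : partial a _ = cst ((a == j)%:R)); first exact: Ck_cst.
apply/funext => x; rewrite /partial deriveE//.
have lin : linear (fun x : 'rV[R]_n => x 0 j).
  by move=> c u v; rewrite !mxE.
pose L : {linear 'rV[R]_n -> R} :=
  HB.pack (fun x : 'rV[R]_n => x 0 j) (GRing.isLinear.Build _ _ _ _ _ lin).
have cL : continuous L by exact: coord_continuous.
have -> : 'd (fun x : 'rV[R]_n => x 0 j) x = L :> (_ -> _).
  exact: (@diff_lin _ _ _ L x cL).
by rewrite /= mxE eqxx /= eq_sym.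
Qed.

End smoothness.

Lemma scaleRE (R : pzRingType) (a : R) (b : R^o) : a *: b = a * b.
Proof. by []. Qed.

Lemma is_derive_inv (R : realType) (t : R) : t != 0 ->
  is_derive t 1 (fun t : R => t^-1) (- t^-1 ^+ 2).
Proof.
move=> t0; have := @is_deriveV R id t 1 1 t0 (is_derive_id t 1).
by rewrite /= scaleNr /GRing.scale /= mulr1 exprVn.
Qed.

Section smooth_more.
Context {R : realType} {n : nat}.
Implicit Types (A : set 'rV[R]_n) (f g : 'rV[R]_n -> R) (k : nat).

Lemma smooth_onZ A f (c : R) : open A -> smooth_on A f ->
  smooth_on A (fun x => c * f x).
Proof. by move=> oA fA; apply: (smooth_onM oA _ fA); exact: smooth_on_cst. Qed.

Lemma smooth_onN A f : open A -> smooth_on A f -> smooth_on A (fun x => - f x).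
Proof.
move=> oA fA; rewrite (_ : (fun x => _) = fun x => -1 * f x).
  exact: smooth_onZ.
by apply/funext => x; rewrite mulN1r.
Qed.

Lemma smooth_onB A f g : open A -> smooth_on A f -> smooth_on A g ->
  smooth_on A (f \- g).
Proof. by move=> oA fA gA; apply: smooth_onD => //; exact: smooth_onN. Qed.

Lemma smooth_on_sum A (I : Type) (r : seq I) (P : pred I)
    (F : I -> 'rV[R]_n -> R) : open A -> (forall i, P i -> smooth_on A (F i)) ->
  smooth_on A (fun x => \sum_(i <- r | P i) F i x).
Proof.
move=> oA FA; elim: r => [|i r IH].
  rewrite (_ : (fun x => _) = cst 0); first exact: smooth_on_cst.
  by apply/funext => x; rewrite big_nil.
have [Pi|Pi] := boolP (P i).
  rewrite (_ : (fun x => _) = F i \+ (fun x => \sum_(j <- r | P j) F j x)).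
    by apply: smooth_onD => //; exact: FA.
  by apply/funext => x; rewrite big_cons Pi.
rewrite (_ : (fun x => _) = (fun x => \sum_(j <- r | P j) F j x))//.
by apply/funext => x; rewrite big_cons (negbTE Pi).
Qed.

Lemma smooth_on_prod A (I : Type) (r : seq I) (P : pred I)
    (F : I -> 'rV[R]_n -> R) : open A -> (forall i, P i -> smooth_on A (F i)) ->
  smooth_on A (fun x => \prod_(i <- r | P i) F i x).
Proof.
move=> oA FA; elim: r => [|i r IH].
  rewrite (_ : (fun x => _) = cst 1); first exact: smooth_on_cst.
  by apply/funext => x; rewrite big_nil.
have [Pi|Pi] := boolP (P i).
  rewrite (_ : (fun x => _) = F i \* (fun x => \prod_(j <- r | P j) F j x)).
    by apply: smooth_onM => //; exact: FA.
  by apply/funext => x; rewrite big_cons Pi.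
rewrite (_ : (fun x => _) = (fun x => \prod_(j <- r | P j) F j x))//.
by apply/funext => x; rewrite big_cons (negbTE Pi).
Qed.

Lemma partial_comp1 a f (h : R -> R) (h' : R) x : differentiable f x ->
  is_derive (f x) 1 h h' ->
  differentiable (h \o f) x /\ partial a (h \o f) x = h' * partial a f x.
Proof.
move=> df dh.
have dh' : differentiable h (f x) by apply/derivable1_diffP; exact: ex_derive.
split; first exact: differentiable_comp.
rewrite /partial deriveE; last exact: differentiable_comp.
rewrite diff_comp//= diff1E// derive1E derive_val deriveE//.
by rewrite mulrC.
Qed.

(* [Fam] is closed under differentiation on [U], so its members are smooth. *)
Lemma smooth_on_comp1 (Fam : set (R -> R)) (U : set R) A f h : open A ->
  (forall h, Fam h -> exists2 h', Fam h' & forall t, U t -> is_derive t 1 h (h' t)) ->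
  smooth_on A f -> (forall x, A x -> U (f x)) -> Fam h -> smooth_on A (h \o f).
Proof.
move=> oA FamP fA AU Fh; apply/smooth_onP => k.
elim: k h Fh => [|k IH] h /[dup] Fh /FamP[h' Fh' dh'].
  split=> // x Ax; apply: differentiable_comp; first exact: smooth_on_diff fA _ Ax.
  by apply/derivable1_diffP; have dhx := dh' _ (AU _ Ax); exact: ex_derive.
split=> [|a].
  move=> x Ax; exact: Ck_diff (IH _ Fh) _ Ax.
apply: (@Ck_eq _ _ _ _ ((h' \o f) \* partial a f)) => //.
  move=> x Ax; apply/esym.
  by have [_ ->] := partial_comp1 a (smooth_on_diff fA Ax) (dh' _ (AU _ Ax)).
apply: CkM => //; first exact: IH.
by have /smooth_onP := @smooth_on_partial _ _ _ _ a fA; exact.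
Qed.

Lemma smooth_onV A f : open A -> smooth_on A f -> (forall x, A x -> f x != 0) ->
  smooth_on A (fun x => (f x)^-1).
Proof.
move=> oA fA f0.
pose Fam : set (R -> R) := [set h | exists (c : R) m, h = fun t => c * t^-1 ^+ m].
apply: (@smooth_on_comp1 Fam [set t | t != 0] _ f (fun t => t^-1)) => //; last first.
  by exists 1, 1%N; apply/funext => t; rewrite mul1r expr1.
move=> _ [c [m ->]].
exists (fun t => (- c * m%:R) * t^-1 ^+ m.+1); first by exists (- c * m%:R), m.+1.
move=> t /= t0.
have dV := is_derive_inv t0.
have := @is_deriveZ _ _ _ ((fun t : R => t^-1) ^+ m) c t 1 _ (is_deriveX m dV).
rewrite (_ : c \*: _ = (fun t0 : R => c * t0^-1 ^+ m)); last first.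
  apply/funext => s; rewrite /= fctE; congr (c * _).
congr (is_derive _ _ _ _).
rewrite /GRing.scale /= -mulr_natl.
case: m => [|m] /=; first by rewrite !mul0r !mulr0 ?mul0r.
by rewrite !exprS; ring.
Qed.

Lemma smooth_on_sqrt A f : open A -> smooth_on A f -> (forall x, A x -> 0 < f x) ->
  smooth_on A (fun x => Num.sqrt (f x)).
Proof.
move=> oA fA f0.
pose Fam : set (R -> R) :=
  [set h | exists (c : R) m, h = fun t => c * Num.sqrt t * t^-1 ^+ m].
apply: (@smooth_on_comp1 Fam [set t | 0 < t] _ f Num.sqrt) => //; last first.
  by exists 1, 0%N; apply/funext => t; rewrite mul1r expr0 mulr1.
move=> _ [c [m ->]].
exists (fun t => (c * (2^-1 - m%:R)) * Num.sqrt t * t^-1 ^+ m.+1).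
  by exists (c * (2^-1 - m%:R)), m.+1.
move=> t /= t0.
have tn0 : t != 0 by rewrite gt_eqF.
have dV := is_derive_inv tn0.
have dS := @is_derive1_sqrt _ _ t0.
have := is_deriveM (@is_deriveZ _ _ _ _ c t 1 _ dS) (is_deriveX m dV).
rewrite (_ : (c \*: _) * _ = (fun t0 : R => c * Num.sqrt t0 * t0^-1 ^+ m)); last first.
  apply/funext => s; rewrite /= !fctE; congr (c * _ * _).
congr (is_derive _ _ _ _).
have sE : Num.sqrt t * Num.sqrt t = t by rewrite -expr2 sqr_sqrtr// ltW.
have s0 : Num.sqrt t != 0 by rewrite gt_eqF// sqrtr_gt0.
rewrite exprfctE.
rewrite /GRing.scale /= -mulr_natl.
have -> : (2 * Num.sqrt t)^-1 = 2^-1 * Num.sqrt t * t^-1.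
  by rewrite -{3}sE; field.
rewrite [X in X * _ + _](_ : _ = c * Num.sqrt t)//.
by case: m => [|m] /=; rewrite ?expr0 !exprS; ring.
Qed.

End smooth_more.

(** * A smooth step function from [exp (-1/t)] *)

Section flat.
Context {R : realType}.

(* The derivatives of [exp (-1/t)] on [t > 0] are of this form. *)
Definition flat (p : {poly R}) (t : R) : R :=
  if 0 < t then p.[t^-1] * expR (- t^-1) else 0.

(** Induction over [q * 'X + c] for all exponents [j] at once: the factor ['X] raises [j] by one,
    and the constant term is beaten by a single term of the exponential series. *)
Lemma poly_expRN_bounded (p : {poly R}) (j : nat) :
  exists2 C : R, 0 <= C & forall s, 1 <= s -> s ^+ j * `|p.[s]| * expR (- s) <= C.
Proof.
elim/poly_ind: p j => [|p c IH] j.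
  by exists 0 => // s _; rewrite horner0 normr0 mulr0 mul0r.
have [C C0 CP] := IH j.+1.
exists (C + `|c| * j.+1`!%:R) => [|s s1]; first by rewrite addr_ge0// mulr_ge0.
have s0 : 0 <= s by rewrite (le_trans _ s1).
rewrite hornerMXaddC.
apply: (@le_trans _ _ (s ^+ j * (`|p.[s]| * s + `|c|) * expR (- s))).
  rewrite ler_wpM2r ?expR_ge0// ler_wpM2l ?exprn_ge0//.
  by rewrite (le_trans (ler_normD _ _))// normrM (ger0_norm s0).
rewrite mulrDr mulrDl lerD//.
  by rewrite (_ : s ^+ j * _ = s ^+ j.+1 * `|p.[s]|) ?CP// exprS; ring.
rewrite (_ : s ^+ j * _ * _ = `|c| * (s ^+ j * expR (- s))); last by ring.
rewrite ler_wpM2l//.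
rewrite expRN ler_pdivrMr ?expR_gt0// mulrC.
have := expR_ge1Dxn j s0.
rewrite -ler_pdivrMr ?ltr0n ?fact_gt0// => h.
have h2 : s ^+ j.+1 / j.+1`!%:R <= expR s by lra.
apply: le_trans h2; rewrite ler_pM2r ?invr_gt0 ?ltr0n ?fact_gt0//.
by rewrite ler_weXn2l.
Qed.

(** For [t > 0] this is the product rule, ['X^2] coming from the derivative of [t^-1]. At 0 the
    difference quotient is [h] times a quantity bounded by [poly_expRN_bounded] with exponent 2, so
    it tends to 0. *)
Lemma is_derive_flat (p : {poly R}) (t : R) :
  is_derive t 1 (flat p) (flat ('X^2 * (p - p^`())) t).
Proof.
have [t0|t0|->] := ltgtP t 0.
- have -> : flat ('X^2 * (p - p^`())) t = 0 by rewrite /flat ltNge ltW.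
  apply: (@near_eq_is_derive _ _ _ (cst 0)).
  near=> y; rewrite /flat; suff -> : (0 < y) = false by [].
  by apply/negbTE; rewrite -leNgt ltW//; near: y; exact: lt_nbhsl.
- rewrite {2}/flat t0.
  apply: (@near_eq_is_derive _ _ _ (fun t : R => p.[t^-1] * expR (- t^-1))).
    near=> y; rewrite /flat; suff -> : (0 < y) = true by [].
    by near: y; exact: lt_nbhsr.
  have tn0 : t != 0 by rewrite gt_eqF.
  have dV := is_derive_inv tn0.
  have dp : is_derive t 1 (fun t : R => p.[t^-1]) (- t^-1 ^+ 2 *: (p^`()).[t^-1]).
    by have := @is_derive1_comp _ (horner p) (fun t : R => t^-1) t _ _
      (is_derive_poly p t^-1) dV; rewrite /GRing.scale /= mulrC.
  have de : is_derive t 1 (fun t : R => expR (- t^-1)) (t^-1 ^+ 2 *: expR (- t^-1)).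
    have dN := is_deriveN dV; rewrite opprK in dN.
    by have := @is_derive1_comp _ expR (fun t : R => - t^-1) t _ _
      (is_derive_expR _) dN; rewrite /GRing.scale /= mulrC.
  have := is_deriveM dp de; congr (is_derive _ _ _ _).
  by rewrite !hornerE /= !scaleRE; ring.
have -> : flat ('X^2 * (p - p^`())) 0 = 0 by rewrite /flat ltxx.
have [C C0 CP] := poly_expRN_bounded p 2.
have key : h^-1 *: ((flat p \o shift 0) (h *: (1:R)) - flat p 0) @[h --> 0^'] --> (0 : R).
  apply/cvgrPdist_le => e e0; near=> h.
  rewrite /= addr0 [h *: 1]mulr1 sub0r normrN {2}/flat ltxx subr0 /flat.
  have [h0|h0] := ltP 0 h; last by rewrite scaler0 normr0 ltW.
  have hC : h * C <= e.
    have : h < e / (C + 1).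
      rewrite -(gtr0_norm h0); near: h; apply: dnbhs0_lt.
      by rewrite divr_gt0// ltr_wpDl.
    rewrite ltr_pdivlMr ?ltr_wpDl// => h1; nra.
  apply: le_trans hC.
  have h1 : 1 <= h^-1.
    rewrite invr_ge1 ?unitfE ?gt_eqF//.
    by rewrite -(gtr0_norm h0) ltW//; near: h; exact: dnbhs0_lt.
  have := CP _ h1; rewrite /GRing.scale /= !normrM (gtr0_norm (expR_gt0 _)).
  rewrite gtr0_norm ?invr_gt0// => h2.
  rewrite [leLHS](_ : _ = h * (h^-1 ^+ 2 * `|p.[h^-1]| * expR (- h^-1))).
    by rewrite ler_pM2l.
  by field; rewrite gt_eqF.
apply: DeriveDef; first by apply/cvg_ex; exists 0; exact: key.
exact: cvg_lim key.
Unshelve. all: by end_near. Qed.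

Definition smooth_step (t : R) : R := flat 1 t / (flat 1 t + flat 1 (1 - t)).

Lemma flat1_ge0 t : 0 <= flat 1 t.
Proof. by rewrite /flat; case: ifP => // _; rewrite hornerC mul1r expR_ge0. Qed.

Lemma flat1_gt0 t : 0 < t -> 0 < flat 1 t.
Proof. by move=> t0; rewrite /flat t0 hornerC mul1r expR_gt0. Qed.

Lemma flat1_eq0 t : t <= 0 -> flat 1 t = 0.
Proof. by rewrite /flat leNgt => /negbTE ->. Qed.

Lemma flat1D_gt0 t : 0 < flat 1 t + flat 1 (1 - t).
Proof.
have [t0|t0] := ltP 0 t; first by rewrite ltr_pwDl ?flat1_gt0 ?flat1_ge0.
by rewrite ltr_wpDl ?flat1_ge0 ?flat1_gt0//; lra.
Qed.

Lemma smooth_step0 t : t <= 0 -> smooth_step t = 0.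
Proof. by move=> t0; rewrite /smooth_step flat1_eq0// mul0r. Qed.

Lemma smooth_step1 t : 1 <= t -> smooth_step t = 1.
Proof.
move=> t1; rewrite /smooth_step (@flat1_eq0 (1 - t)) ?subr_le0// addr0 divff//.
by rewrite gt_eqF// flat1_gt0// (lt_le_trans _ t1).
Qed.

Lemma smooth_step_ge0 t : 0 <= smooth_step t.
Proof. by rewrite divr_ge0 ?flat1_ge0// ltW// flat1D_gt0. Qed.

Lemma smooth_on_step n (A : set 'rV[R]_n) (f : 'rV[R]_n -> R) : open A ->
  smooth_on A f -> smooth_on A (fun x => smooth_step (f x)).
Proof.
move=> oA fA.
have flatP g : smooth_on A g -> smooth_on A (fun x => flat 1 (g x)).
  move=> gA; apply: (@smooth_on_comp1 _ _ (range flat) setT _ g (flat 1)) => //.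
  move=> _ [p _ <-]; exists (flat ('X^2 * (p - p^`()))); first by exists ('X^2 * (p - p^`())).
  by move=> t _; exact: is_derive_flat.
have f1A : smooth_on A (fun x => 1 - f x).
  by apply: smooth_onB => //; exact: smooth_on_cst.
apply: smooth_onM => //; first exact: flatP.
apply: smooth_onV => //; first by apply: smooth_onD => //; exact: flatP.
by move=> x _; rewrite gt_eqF// flat1D_gt0.
Qed.

End flat.

(** * The chain rule and smoothness of compositions *)

Section chain_rule.
Context {R : realType} {n m : nat}.
Implicit Types (phi : 'rV[R]_n -> 'rV[R]_m) (f : 'rV[R]_m -> R).

Lemma differentiable_rV phi x :
  (forall k, differentiable (fun y => phi y 0 k) x) -> differentiable phi x.
Proof.
move=> dphi.
have -> : phi = \sum_(k < m) (fun y => phi y 0 k *: (delta_mx 0 k : 'rV[R]_m)).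
  by apply/funext => y; rewrite fct_sumE {1}(row_sum_delta (phi y)).
by apply: differentiable_sum => k; exact: differentiableZl.
Qed.

Lemma jacobianE phi x a k : differentiable phi x ->
  'J phi x a k = partial a (fun y => phi y 0 k) x.
Proof.
move=> dphi; rewrite /jacobian mxE /partial -deriveE//.
by rewrite derive_mx ?mxE//; exact: diff_derivable.
Qed.

Lemma partial_comp phi f x a :
  differentiable phi x -> differentiable f (phi x) ->
  partial a (f \o phi) x =
  \sum_(k < m) partial a (fun y => phi y 0 k) x * partial k f (phi x).
Proof.
move=> dphi df; rewrite {1}/partial deriveE; last exact: differentiable_comp.
rewrite diff_comp//=.
rewrite [in LHS](row_sum_delta ('d phi x (delta_mx 0 a))) linear_sum.
apply: eq_bigr => k _; rewrite linearZ /=; congr (_ * _).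
  by rewrite -jacobianE// mxE.
by rewrite /partial deriveE.
Qed.

Lemma Ck_sum k (A : set 'rV[R]_n) (I : Type) (r : seq I) (F : I -> 'rV[R]_n -> R) :
  open A -> (forall i, Ck k A (F i)) -> Ck k A (fun x => \sum_(i <- r) F i x).
Proof.
move=> oA FA; elim: r => [|i r IH].
  rewrite (_ : (fun x => _) = cst 0); first exact: Ck_cst.
  by apply/funext => x; rewrite big_nil.
rewrite (_ : (fun x => _) = F i \+ (fun x => \sum_(j <- r) F j x)).
  exact: CkD.
by apply/funext => x; rewrite big_cons.
Qed.

(** The inner map is assumed [Ck] only: in [smooth_inverse] this drives a bootstrap in which the
    inverse map is known just to order [k]. *)
Lemma Ck_comp k (A : set 'rV[R]_n) (B : set 'rV[R]_m) phi f : open A ->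
  (forall j, Ck k A (fun x => phi x 0 j)) -> smooth_on B f ->
  (forall x, A x -> B (phi x)) -> Ck k A (f \o phi).
Proof.
move=> oA; elim: k f => [|k IH] f phiA fB AB.
  split=> // x Ax; apply: differentiable_comp; last exact: smooth_on_diff fB _ (AB _ Ax).
  by apply: differentiable_rV => j; exact: Ck_diff (phiA j) _ Ax.
have dphi x : A x -> differentiable phi x.
  by move=> Ax; apply: differentiable_rV => j; exact: Ck_diff (phiA j) _ Ax.
have df x : A x -> differentiable f (phi x).
  by move=> Ax; exact: smooth_on_diff fB _ (AB _ Ax).
split=> [x Ax|a]; first by apply: differentiable_comp; auto.
apply: (@Ck_eq _ _ _ _ (fun x => \sum_(j < m)
    (partial a (fun y => phi y 0 j) \* (partial j f \o phi)) x)) => //.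
  by move=> x Ax; rewrite partial_comp; auto.
apply: Ck_sum => // j; apply: CkM => //.
  by have [_] := phiA j; exact.
apply: IH => //; last exact: smooth_on_partial.
by move=> i; exact: Ck_le.
Qed.

Lemma smooth_on_comp (A : set 'rV[R]_n) (B : set 'rV[R]_m) phi f : open A ->
  (forall j, smooth_on A (fun x => phi x 0 j)) -> smooth_on B f ->
  (forall x, A x -> B (phi x)) -> smooth_on A (f \o phi).
Proof.
move=> oA phiA fB AB; apply/smooth_onP => k; apply: Ck_comp fB AB => // j.
by have /smooth_onP := phiA j; exact.
Qed.

End chain_rule.

Lemma ler_dist_half (R : realDomainType) (p q t e : R) :
  `|p - t| < e -> `|q - t| < e -> `|p - q| <= e + e.
Proof.
by rewrite !ltr_norml ler_norml => /andP[? ?] /andP[? ?]; lra.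
Qed.

(** * Symmetry of second partial derivatives *)

Section schwarz.
Context {R : realType} {n : nat}.
Implicit Types (f : 'rV[R]_n -> R) (x v w : 'rV[R]_n).

Lemma is_derive_line f x v (s : R) : differentiable f (x + s *: v) ->
  is_derive s 1 (fun s => f (x + s *: v)) ('D_v f (x + s *: v)).
Proof.
move=> df.
have dl : is_diff s (fun s : R => x + s *: v) ( *:%R^~ v).
  have := is_diffD (is_diff_cst x s) (is_diff_scalel s v).
  by rewrite add0r.
have df' : differentiable (fun s : R => f (x + s *: v)) s.
  by apply: (@differentiable_comp _ _ _ _ (fun s : R => x + s *: v) f).
apply: DeriveDef; first exact/derivable1_diffP.
rewrite !deriveE//.
rewrite (@diff_comp _ _ _ _ (fun s : R => x + s *: v) f)//=.
by rewrite diff_val scale1r.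
Qed.

Lemma norm_delta_le1 a : `|delta_mx 0 a : 'rV[R]_n| <= 1.
Proof.
rewrite [leLHS]/Num.Def.normr/= mx_normrE bigmax_le// => -[i j] _ /=.
by rewrite mxE; case: (_ && _); rewrite ?normr1 ?normr0.
Qed.

Definition second_diff f x v w := f (x + v + w) - f (x + v) - f (x + w) + f x.

Lemma second_diffC f x v w : second_diff f x v w = second_diff f x w v.
Proof. by rewrite /second_diff [x + v + w]addrAC; ring. Qed.

(** The mean value theorem twice: for [s |-> f (x + h v + s u) - f (x + s u)], then for the [a]-th
    partial derivative along [v]. *)
Lemma second_difference f x a b (r h : R) : 0 < h -> h + h < r ->
  smooth_on (ball x r) f ->
  exists2 y, `|y - x| <= h + h &
    second_diff f x (h *: delta_mx 0 a) (h *: delta_mx 0 b) =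
    h * h * partial b (partial a f) y.
Proof.
move=> h0 hr fA; rewrite /second_diff; set u := delta_mx 0 a; set v := delta_mx 0 b.
have near_in (s t : R) : 0 <= s <= h -> 0 <= t <= h ->
    `|(x + s *: u + t *: v) - x| <= h + h.
  move=> /andP[s0 sh] /andP[t0 th].
  rewrite -[x + _ + _]addrA [x + _]addrC addrK (le_trans (ler_normD _ _))//.
  rewrite lerD// normrZ ger0_norm//.
    by rewrite (le_trans _ sh)// ler_piMr// norm_delta_le1.
  by rewrite (le_trans _ th)// ler_piMr// norm_delta_le1.
have inA (s t : R) : 0 <= s <= h -> 0 <= t <= h ->
    ball x r (x + s *: u + t *: v).
  move=> sh th; rewrite -ball_normE /ball_ /= distrC.
  exact: le_lt_trans (near_in _ _ sh th) hr.
have hh : 0 <= h <= h by rewrite lexx ltW.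
have h00 : 0 <= (0:R) <= h by rewrite lexx ltW.
pose g (s : R) := f (x + h *: v + s *: u) - f (x + s *: u).
have dg s : 0 <= s <= h -> is_derive s 1 g
    (partial a f (x + h *: v + s *: u) - partial a f (x + s *: u)).
  move=> sh; apply: is_deriveB.
    apply: is_derive_line; apply: smooth_on_diff fA _ _.
    by rewrite addrAC; exact: inA.
  apply: is_derive_line; apply: smooth_on_diff fA _ _.
  by have := inA s 0 sh h00; rewrite scale0r addr0.
have [||s sh gE] := @MVT R g (fun s => partial a f (x + h *: v + s *: u) -
    partial a f (x + s *: u)) 0 h h0.
- by move=> s sh; apply: dg; rewrite !(itvP sh).
- apply: derivable_within_continuous => s sh.
  by have := dg s; rewrite !(itvP sh) => /(_ isT) dgs; exact: ex_derive.
have sh' : 0 <= s <= h by rewrite !(itvP sh).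
pose k (t : R) := partial a f (x + s *: u + t *: v).
have dk t : 0 <= t <= h -> is_derive t 1 k (partial b (partial a f) (x + s *: u + t *: v)).
  move=> th; apply: is_derive_line.
  apply: (@smooth_on_diff _ _ (ball x r)); first exact: smooth_on_partial.
  exact: inA.
have [||t th kE] := @MVT R k (fun t => partial b (partial a f) (x + s *: u + t *: v)) 0 h h0.
- by move=> t th; apply: dk; rewrite !(itvP th).
- apply: derivable_within_continuous => t th.
  by have := dk t; rewrite !(itvP th) => /(_ isT) dks; exact: ex_derive.
exists (x + s *: u + t *: v); first by apply: near_in => //; rewrite !(itvP th).
move: gE kE; rewrite /g /k !subr0 !scale0r !addr0 => gE kE.
rewrite [x + h *: u + _]addrAC.
have -> : f (x + h *: v + h *: u) - f (x + h *: u) - f (x + h *: v) + f x =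
  (partial a f (x + h *: v + s *: u) - partial a f (x + s *: u)) * h.
  by rewrite -gE; ring.
by rewrite [x + h *: v + _]addrAC kE; ring.
Qed.

(** The second difference is symmetric in its two directions, so the two mixed derivatives agree at
    two points [y] and [z] within [h + h] of [x]; continuity at [x] does the rest. *)
Lemma partialC (A : set 'rV[R]_n) f a b x : open A -> smooth_on A f -> A x ->
  partial a (partial b f) x = partial b (partial a f) x.
Proof.
move=> oA fA Ax; apply/eqP; rewrite eq_sym -subr_eq0 -normr_le0.
apply/ler_addgt0Pl => e e0; rewrite addr0.
have cont c d : \forall y \near x,
    `|partial c (partial d f) x - partial c (partial d f) y| < e / 2.
  have : {for x, continuous (partial c (partial d f))}.
    apply: differentiable_continuous.
    by apply: smooth_on_diff _ Ax; do 2 apply: smooth_on_partial.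
  by move/cvgrPdist_lt; apply; rewrite divr_gt0.
have : \forall y \near x, A y /\
    (`|partial a (partial b f) x - partial a (partial b f) y| < e / 2 /\
     `|partial b (partial a f) x - partial b (partial a f) y| < e / 2).
  apply: filterI; first exact: open_nbhs_nbhs.
  exact: filterI (cont a b) (cont b a).
move=> /nbhs_ballP[r /= r0 rP].
pose h := r / 4.
have h0 : 0 < h by rewrite divr_gt0.
have hr : h + h < r by rewrite /h; lra.
have fr : smooth_on (ball x r) f.
  by apply: smooth_on_subset fA => y /rP[].
have [y yx yE] := second_difference a b h0 hr fr.
have [z zx zE] := second_difference b a h0 hr fr.
have yr : ball x r y by rewrite -ball_normE /ball_ /= distrC (le_lt_trans yx).
have zr : ball x r z by rewrite -ball_normE /ball_ /= distrC (le_lt_trans zx).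
have E : partial b (partial a f) y = partial a (partial b f) z.
  apply: (@mulfI _ (h * h)); first by rewrite mulf_neq0// gt_eqF.
  exact: etrans (etrans (esym yE) (second_diffC _ _ _ _)) zE.
have [_ [_ hy]] := rP _ yr; have [_ [hz _]] := rP _ zr.
rewrite E in hy; rewrite [leRHS]splitr; exact: ler_dist_half hy hz.
Qed.

End schwarz.

(** * Derivative of the determinant and the Piola identity *)

Section jacobi_piola.
Context {R : realType} {n : nat}.

Lemma differentiable_prod m (F : 'I_m -> 'rV[R]_n -> R) (s : seq 'I_m) x :
  (forall i, differentiable (F i) x) ->
  differentiable (fun y => \prod_(i <- s) F i y) x.
Proof.
move=> dF; elim: s => [|i s IH].
  rewrite (_ : (fun y => _) = cst 1); first exact: differentiable_cst.
  by apply/funext => y; rewrite big_nil.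
rewrite (_ : (fun y => _) = F i * (fun y => \prod_(j <- s) F j y)).
  exact: differentiableM.
by apply/funext => y; rewrite big_cons.
Qed.

Lemma partial_prod m (F : 'I_m -> 'rV[R]_n -> R) a x (s : seq 'I_m) :
  (forall i, differentiable (F i) x) -> uniq s ->
  partial a (fun y => \prod_(i <- s) F i y) x =
  \sum_(i <- s) partial a (F i) x * \prod_(j <- s | j != i) F j x.
Proof.
move=> dF; elim: s => [|i s IH] /=.
  rewrite (_ : (fun y => _) = cst 1) ?partial_cst ?big_nil//.
  by apply/funext => y; rewrite big_nil.
move=> /andP[si us].
rewrite (_ : (fun y => _) = F i \* (fun y => \prod_(j <- s) F j y)); last first.
  by apply/funext => y; rewrite big_cons.
rewrite partialM//; last exact: differentiable_prod.
rewrite IH// big_cons addrC mulrC big_cons eqxx /=; congr (_ * _ + _).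
  rewrite [RHS]big_seq_cond [LHS]big_seq; apply: eq_bigl => j.
  by have [->|] := eqVneq j i; rewrite ?(negbTE si) ?andbT.
rewrite mulr_sumr !big_seq; apply: eq_bigr => j js.
rewrite big_cons; have -> /= : i != j by apply: contraNneq si => ->.
by rewrite mulrCA.
Qed.

Lemma differentiable_bigsum (I : Type) (s : seq I) (F : I -> 'rV[R]_n -> R) x :
  (forall i, differentiable (F i) x) ->
  differentiable (fun y => \sum_(i <- s) F i y) x.
Proof.
move=> dF; elim: s => [|i s IH].
  rewrite (_ : (fun y => _) = cst 0); first exact: differentiable_cst.
  by apply/funext => y; rewrite big_nil.
rewrite (_ : (fun y => _) = F i + (fun y => \sum_(j <- s) F j y)).
  exact: differentiableD.
by apply/funext => y; rewrite big_cons.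
Qed.

Lemma partial_sum (I : Type) (s : seq I) (F : I -> 'rV[R]_n -> R) a x :
  (forall i, differentiable (F i) x) ->
  partial a (fun y => \sum_(i <- s) F i y) x = \sum_(i <- s) partial a (F i) x.
Proof.
move=> dF; elim: s => [|i s IH].
  rewrite (_ : (fun y => _) = cst 0) ?partial_cst ?big_nil//.
  by apply/funext => y; rewrite big_nil.
rewrite (_ : (fun y => _) = F i \+ (fun y => \sum_(j <- s) F j y)).
  by rewrite partialD ?big_cons ?IH//; exact: differentiable_bigsum.
by apply/funext => y; rewrite big_cons.
Qed.

Lemma partialZ a (c : R) (f : 'rV[R]_n -> R) x : differentiable f x ->
  partial a (fun y => c * f y) x = c * partial a f x.
Proof.
move=> df; rewrite (_ : (fun y => _) = cst c \* f)// partialM//.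
by rewrite partial_cst mulr0 addr0.
Qed.

(** Jacobi's formula: the product rule differentiates one row at a time, and each resulting
    determinant is expanded along that row. *)
Lemma partial_det m (M : 'rV[R]_n -> 'M[R]_m) a x :
  (forall i j, differentiable (fun y => M y i j) x) ->
  partial a (fun y => \det (M y)) x =
  \sum_(i < m) \sum_(j < m) partial a (fun y => M y i j) x * cofactor (M x) i j.
Proof.
move=> dM.
have dP (s : {perm 'I_m}) :
    differentiable (fun y => \prod_(i <- index_enum 'I_m) M y i (s i)) x.
  by apply: (@differentiable_prod _ (fun i y => M y i (s i))).
rewrite /determinant partial_sum; last first.
  by move=> s; apply: (@differentiableM _ _ (cst _)) => //; exact: differentiable_cst.
under eq_bigr => s _.
  rewrite partialZ// (@partial_prod _ (fun i y => M y i (s i)))//; last exact: index_enum_uniq.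
  rewrite mulr_sumr.
  over.
rewrite exchange_big /=; apply: eq_bigr => i _.
(* The matrix with its [i]-th row differentiated; the cofactors along this row are those of
   [M x]. *)
pose N := \matrix_(i', j) if i' == i then partial a (fun y => M y i' j) x else M x i' j.
transitivity (\det N).
  apply: eq_bigr => s _; congr (_ * _).
  rewrite [RHS](bigD1 i)//= mxE eqxx; congr (_ * _).
  by apply: eq_bigr => j /negbTE ji; rewrite mxE ji.
rewrite (expand_det_row N i); apply: eq_bigr => j _.
rewrite mxE eqxx; congr (_ * _); rewrite /cofactor; congr (_ * \det _).
by apply/matrixP => k l; rewrite !mxE eq_sym (negbTE (neq_lift _ _)).
Qed.

Implicit Types (phi : 'rV[R]_n -> 'rV[R]_n).

(** Equal to the Jacobian ['J] wherever [phi] is differentiable; written with partial derivatives so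
    that smoothness of the entries is immediate. *)
Definition jac phi x : 'M[R]_n := \matrix_(a, k) partial a (fun y => phi y 0 k) x.

Lemma jacobian_jac phi x : differentiable phi x -> 'J phi x = jac phi x.
Proof. by move=> dphi; apply/matrixP => a k; rewrite jacobianE// mxE. Qed.

Lemma smooth_map_diff (A : set 'rV[R]_n) phi x : smooth_map_on A phi -> A x ->
  differentiable phi x.
Proof. by move=> phiA Ax; apply: differentiable_rV => k; exact: smooth_on_diff (phiA k) _ Ax. Qed.

Lemma smooth_jac A phi a k : open A -> smooth_map_on A phi ->
  smooth_on A (fun x => jac phi x a k).
Proof.
move=> oA phiA; rewrite (_ : (fun x => _) = partial a (fun y => phi y 0 k)).
  exact: smooth_on_partial.
by apply/funext => x; rewrite mxE.
Qed.

Lemma smooth_on_det m (A : set 'rV[R]_n) (M : 'rV[R]_n -> 'M[R]_m) : open A ->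
  (forall i j, smooth_on A (fun x => M x i j)) -> smooth_on A (fun x => \det (M x)).
Proof.
move=> oA MA; apply: smooth_on_sum => // s _; apply: smooth_onZ => //.
by apply: smooth_on_prod.
Qed.

Lemma smooth_on_adj m (A : set 'rV[R]_n) (M : 'rV[R]_n -> 'M[R]_m) i j : open A ->
  (forall i j, smooth_on A (fun x => M x i j)) ->
  smooth_on A (fun x => (\adj (M x)) i j).
Proof.
move=> oA MA; rewrite (_ : (fun x => _) = (fun x => cofactor (M x) j i)).
  apply: smooth_onZ => //; apply: smooth_on_det => // k l.
  rewrite (_ : (fun x => _) = (fun x => M x (lift j k) (lift i l)))//.
  by apply/funext => x; rewrite !mxE.
by apply/funext => x; rewrite mxE.
Qed.

Lemma smooth_on_invmx m (A : set 'rV[R]_n) (M : 'rV[R]_n -> 'M[R]_m) i j : open A ->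
  (forall i j, smooth_on A (fun x => M x i j)) ->
  (forall x, A x -> \det (M x) != 0) ->
  smooth_on A (fun x => invmx (M x) i j).
Proof.
move=> oA MA M0.
apply: (@smooth_on_eq _ _ _ (fun x => (\det (M x))^-1 * (\adj (M x)) i j)) => //.
  by move=> x Ax; rewrite /invmx unitmxE unitfE M0// [RHS]mxE.
apply: smooth_onM => //; last exact: smooth_on_adj.
by apply: smooth_onV => //; exact: smooth_on_det.
Qed.

(** Take the divergence of [J *m \adj J = \det J]. The right side gives [partial m] of the
    determinant; so do, by Jacobi's formula and symmetry of second derivatives, the terms on the
    left where [J] is differentiated. What remains is [J] times the vector of divergences, and [J]
    is invertible. *)
Lemma piola (A : set 'rV[R]_n) phi x k : open A -> smooth_map_on A phi -> A x ->
  \det (jac phi x) != 0 ->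
  \sum_a partial a (fun y => (\adj (jac phi y)) k a) x = 0.
Proof.
move=> oA phiA Ax det0.
pose J := jac phi; pose C y := \adj (J y).
have dJ i j : differentiable (fun y => J y i j) x.
  by apply: smooth_on_diff Ax; exact: smooth_jac.
have dC i j : differentiable (fun y => C y i j) x.
  apply: smooth_on_diff Ax; apply: smooth_on_adj => // *; exact: smooth_jac.
have ddet : differentiable (fun y => \det (J y)) x.
  by apply: smooth_on_diff Ax; apply: smooth_on_det => // *; exact: smooth_jac.
pose D := \col_k \sum_a partial a (fun y => C y k a) x.
suff JD : J x *m D = 0.
  have : D = 0 by rewrite -(mul1mx D) -(@mulVmx _ _ (J x)) ?unitmxE ?unitfE// -mulmxA JD mulmx0.
  by move=> /colP/(_ k); rewrite !mxE.
apply/colP => m; rewrite !mxE.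
have key a : \sum_l (partial a (fun y => J y m l) x * C x l a +
     J x m l * partial a (fun y => C y l a) x) =
    (m == a)%:R * partial a (fun y => \det (J y)) x.
  have -> : (m == a)%:R * partial a (fun y => \det (J y)) x =
      partial a (fun y => (m == a)%:R * \det (J y)) x by rewrite partialZ.
  have -> : (fun y => (m == a)%:R * \det (J y)) =
      (fun y => \sum_l (J y m l * C y l a)).
    apply/funext => y; have := mul_mx_adj (J y) => /matrixP/(_ m a).
    by rewrite !mxE mulrb => ->; case: eqP => _; rewrite ?mul1r ?mul0r.
  rewrite partial_sum; last by move=> l; exact: differentiableM.
  by apply: eq_bigr => l _; rewrite [RHS]partialM// addrC [_ * C x l a]mulrC.
have : \sum_a \sum_l (partial a (fun y => J y m l) x * C x l a +
     J x m l * partial a (fun y => C y l a) x) = partial m (fun y => \det (J y)) x.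
  under eq_bigr do rewrite key.
  rewrite (bigD1 m)//= eqxx mul1r big1 ?addr0//.
  by move=> a; rewrite eq_sym => /negbTE ->; rewrite mul0r.
rewrite partial_det//.
under eq_bigr do rewrite big_split.
rewrite big_split /=.
have -> : \sum_i \sum_l partial i (fun y => J y m l) x * C x l i =
    \sum_i \sum_j partial m (fun y => J y i j) x * cofactor (J x) i j.
  apply: eq_bigr => i _; apply: eq_bigr => j _; rewrite mxE; congr (_ * _).
  rewrite (_ : (fun y => J y m j) = partial m (fun y => phi y 0 j)); last first.
    by apply/funext => y; rewrite mxE.
  rewrite (_ : (fun y => J y i j) = partial i (fun y => phi y 0 j)); last first.
    by apply/funext => y; rewrite mxE.
  exact: partialC oA (phiA j) Ax.
move=> /(canRL (addKr _)); rewrite addNr.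
rewrite exchange_big /= => H; rewrite -[RHS]H.
by apply: eq_bigr => l _; rewrite [D l 0]mxE mulr_sumr.
Qed.

(** By the Piola identity only the derivatives of [Y] survive, and [\adj J *m J] is the scalar
    matrix of the determinant. *)
Lemma divergence_comp (A B : set 'rV[R]_n) phi (Y : 'rV[R]_n -> R) x k : open A ->
  smooth_map_on A phi -> smooth_on B Y -> (forall y, A y -> B (phi y)) -> A x ->
  \det (jac phi x) != 0 ->
  \sum_a partial a (fun y => (\adj (jac phi y)) k a * Y (phi y)) x =
  \det (jac phi x) * partial k Y (phi x).
Proof.
move=> oA phiA YB AB Ax det0.
have dphi := smooth_map_diff phiA Ax.
have dY : differentiable Y (phi x) by apply: smooth_on_diff YB _ (AB _ Ax).
have dYp : differentiable (Y \o phi) x by apply: differentiable_comp.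
have dC i j : differentiable (fun y => (\adj (jac phi y)) i j) x.
  apply: smooth_on_diff Ax; apply: smooth_on_adj => // *; exact: smooth_jac.
under eq_bigr => a _ do rewrite [partial _ _ _](@partialM _ _ _ _ (Y \o phi))// partial_comp//.
rewrite big_split /= addrC -mulr_sumr (piola k oA phiA)// mulr0 add0r.
under eq_bigr => a _ do rewrite mulr_sumr.
rewrite exchange_big /=.
have E l : \sum_a (\adj (jac phi x)) k a * (jac phi x a l * partial l Y (phi x)) =
    (k == l)%:R * \det (jac phi x) * partial l Y (phi x).
  under eq_bigr do rewrite mulrA.
  rewrite -mulr_suml; congr (_ * _).
  have := mul_adj_mx (jac phi x) => /matrixP/(_ k l); rewrite !mxE mulrb => ->.
  by case: eqP => _; rewrite ?mul1r ?mul0r.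
rewrite (bigD1 k)//= [X in _ + X]big1 ?addr0 => [|l /negbTE lk].
  have := E k; rewrite eqxx mul1r => <-.
  by apply: eq_bigr => a _; rewrite [jac _ _ _ _]mxE.
have := E l; rewrite eq_sym lk !mul0r => El.
rewrite -[RHS]El.
by apply: eq_bigr => a _; rewrite [jac _ _ _ _]mxE.
Qed.

End jacobi_piola.

Lemma linear_approx_diff (R : realType) (V W : normedModType R) (f : V -> W) (x : V)
    (L : {linear V -> W}) : continuous L ->
  (forall e : R, 0 < e ->
    \forall h \near (0 : V), `|f (h + x) - (f x + L h)| <= e * `|h|) ->
  differentiable f x /\ 'd f x = L :> (V -> W).
Proof.
move=> cL fL.
have key : f \o shift x = cst (f x) + L +o_ 0 id by apply/eqaddoP => e /fL.
have dL : 'd f x = L :> (V -> W) by exact: diff_unique.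
by split=> //; apply/diff_locallyP; rewrite dL; split.
Qed.

(** * Smoothness of continuous inverses *)

Section inverse.
Context {R : realType} {n : nat}.
Implicit Types (A B : set 'rV[R]_n) (phi psi : 'rV[R]_n -> 'rV[R]_n).

Lemma diff_jac phi x v : differentiable phi x -> 'd phi x v = v *m jac phi x.
Proof. by move=> dphi; rewrite -jacobian_jac// -deriveEjacobian// deriveE. Qed.

(** Put [k = psi (h + y) - psi y]. Then [h] is [k *m J] up to [e' |k|], provided [k] is small, which
    continuity of [psi] ensures. Multiplying by the inverse of [J] gives first [|k| <= 2 C |h|],
    then the linear approximation of [psi]. *)
Lemma jac_inverse A B phi psi y : open B -> smooth_map_on A phi ->
  (forall y, B y -> A (psi y)) -> (forall y, B y -> phi (psi y) = y) ->
  B y -> {for y, continuous psi} -> \det (jac phi (psi y)) != 0 ->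
  differentiable psi y /\ jac psi y = invmx (jac phi (psi y)).
Proof.
move=> oB phiA BA psiK By cpsi det0.
set x := psi y; set J := jac phi x; set K := invmx J.
have dphi : differentiable phi x := smooth_map_diff phiA (BA _ By).
have JK : J *m K = 1%:M by rewrite mulmxV// unitmxE unitfE.
pose L (v : 'rV[R]_n) := v *m K.
have linL : linear L by move=> c u v; rewrite /L mulmxDl scalemxAl.
pose LL : {linear 'rV[R]_n -> 'rV[R]_n} :=
  HB.pack L (GRing.isLinear.Build _ _ _ _ _ linL).
have cL : continuous L.
  suff dL z : differentiable L z by move=> z; exact: differentiable_continuous.
  apply: differentiable_rV => k; rewrite (_ : (fun y => _) = (fun v : 'rV[R]_n => \sum_(i <- index_enum 'I_n) v 0 i * K i k)).
    apply: differentiable_bigsum => i; apply: differentiableM => //.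
    exact: differentiable_coord.
  by apply/funext => v; rewrite /L mxE.
have [C C0 LC] : exists2 C : R, 0 < C & forall v, `|L v| <= C * `|v|.
  have /(linear_lipschitz (f := LL)) [C C0 CP] := cL.
  by exists C.
have [|dpsi dL] := @linear_approx_diff R _ _ psi y LL cL; last first.
  split=> //; apply/row_matrixP => i; rewrite !rowE -diff_jac// dL.
  by [].
move=> e e0.
  (* The first entry allows [C e' |k|] to be absorbed as half of [|k|]; the second turns the final
     error [C e' (2 C |h|)] into [e |h|]. *)
  have e'0 : 0 < Num.min (C^-1 / 2) (e / (2 * C * C)).
    by rewrite lt_min !divr_gt0// ?mulr_gt0// invr_gt0.
  set e' := Num.min _ _ in e'0.
  have := diff_locallyx dphi.
  have dlim : \forall h \near (0 : 'rV[R]_n), `|phi (h + x) - phi x - h *m J| <= e' * `|h|.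
    have /diff_locally/eqaddoP/(_ _ e'0) := dphi.
    apply: filterS => h; rewrite !fctE /= opprD addrA diff_jac//.
  move=> _; move: dlim => /nbhs_ballP[r /= r0 rP].
  have : \forall h \near (0 : 'rV[R]_n), B (h + y) /\ `|psi (h + y) - x| < r.
    have : \forall z \near y, B z /\ `|psi z - x| < r.
      apply: filterI; first exact: open_nbhs_nbhs.
      by move/cvgrPdist_lt : cpsi => /(_ _ r0); apply: filterS => z; rewrite distrC.
    by rewrite (near_shift 0 y) /= subr0.
  apply: filterS => h [Bh hr].
  set k := psi (h + y) - x.
  have := rP k; rewrite -ball_normE /ball_ /= sub0r normrN => /(_ hr).
  rewrite /k subrK psiK// [phi x]psiK// -/k addrK => rk.
  have kE : k - L h = - L (h - k *m J).
    by rewrite /L mulmxBl opprB -mulmxA JK mulmx1.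
  have k1 : `|k - L h| <= C * (e' * `|k|).
    by rewrite kE normrN (le_trans (LC _))// ler_pM2l.
  have k2 : `|k| <= 2 * C * `|h|.
    have : `|k| <= C * `|h| + C * (e' * `|k|).
      rewrite -[leLHS](normr_id) -{1}(subrK (L h) k) normr_id addrC.
      by rewrite (le_trans (ler_normD _ _))// lerD.
    have : C * e' <= 1 / 2.
      have : e' <= C^-1 / 2 by rewrite /e' ge_min lexx.
      rewrite -(ler_pM2l C0) mulrA mulfV ?gt_eqF//.
    have := normr_ge0 k; have := normr_ge0 h.
    generalize `|k| `|h| => p q q0 p0 h1 h2; nra.
  rewrite opprD addrA -/x -/k (le_trans k1)//.
  have e'e : e' * (2 * C * C) <= e.
    by rewrite -ler_pdivlMr ?mulr_gt0// /e' ge_min lexx orbT.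
  apply: (@le_trans _ _ (C * (e' * (2 * C * `|h|)))).
    by rewrite ler_pM2l// ler_pM2l.
  rewrite (_ : C * _ = e' * (2 * C * C) * `|h|); last by ring.
  by rewrite ler_wpM2r.
Qed.

(** Bootstrap: the derivative of [psi] is a smooth matrix function composed with [psi] itself, so
    each order of differentiability yields the next. *)
Lemma smooth_inverse A B phi psi : open A -> open B -> smooth_map_on A phi ->
  (forall y, B y -> A (psi y)) -> (forall y, B y -> phi (psi y) = y) ->
  {in B, continuous psi} -> (forall x, A x -> \det (jac phi x) != 0) ->
  smooth_map_on B psi.
Proof.
move=> oA oB phiA BA psiK cpsi det0.
have H y : B y -> differentiable psi y /\ jac psi y = invmx (jac phi (psi y)).
  move=> By; apply: (jac_inverse oB phiA BA psiK By); last exact/det0/BA.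
  by apply: cpsi; rewrite inE.
suff Ckpsi k j : Ck k B (fun y => psi y 0 j) by move=> j; apply/smooth_onP.
have dpsi i y : B y -> differentiable (fun z => psi z 0 i) y.
  move=> /H[dp _]; apply: (@differentiable_comp _ _ _ _ psi (fun v : 'rV[R]_n => v 0 i)) => //.
  exact: differentiable_coord.
elim: k j => [|k IH] j; first by split=> // y; exact: dpsi.
split=> [y|a]; first exact: dpsi.
apply: (@Ck_eq _ _ _ _ ((fun x => invmx (jac phi x) a j) \o psi)) => //.
  move=> y By; have [_ /matrixP/(_ a j)] := H y By.
  by rewrite mxE => ->.
apply: Ck_comp BA => //; apply: smooth_on_invmx => // *; exact: smooth_jac.
Qed.

End inverse.

(** * Lebesgue measure on R^n *)

Section borel.
Context {T : ptopologicalType}.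

Lemma borel_open (A : set T) : open A -> measurable (A : set (borel T)).
Proof. by move=> oA; apply: sub_sigma_algebra. Qed.

Lemma borel_closed (A : set T) : closed A -> measurable (A : set (borel T)).
Proof. by move=> /closed_openC/borel_open/measurableC; rewrite setCK. Qed.

Lemma measurable_to_borel d (X : measurableType d) (D : set X) (f : X -> T) :
  (forall A, open A -> measurable (D `&` f @^-1` A)) ->
  measurable_fun D (f : X -> borel T).
Proof.
move=> fo; apply: (@measurability _ _ X (borel T) D f (@open T)) => //.
by move=> _ [A oA <-]; exact: fo.
Qed.

Lemma borel_continuous_on (R : realType) (A : set T) (f : T -> R) :
  open A -> {in A, continuous f} ->
  measurable_fun (A : set (borel T)) (f : borel T -> R).
Proof.
move=> oA cf; apply: (measurability _ (RGenOpens.measurableE R)).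
move=> _ [_ [a [b ->] <-]]; apply: borel_open.
rewrite openE => x [Ax fx].
have oI : open `]a, b[%classic by exact: interval_open.
have : nbhs (f x) `]a, b[%classic by exact: open_nbhs_nbhs.
move=> /(cf x (mem_set Ax)) fI.
by apply: filterI => //; exact: open_nbhs_nbhs.
Qed.

Lemma borel_continuous (R : realType) (f : T -> R) : continuous f ->
  measurable_fun [set: borel T] (f : borel T -> R).
Proof. by move=> cf; apply: borel_continuous_on; [exact: openT|move=> x _; exact: cf]. Qed.

End borel.

Section rational_balls.
Context {R : realType} {n : nat}.

Let rball (p : 'rV[rat]_n * nat) : set 'rV[R]_n :=
  ball (map_mx ratr p.1 : 'rV[R]_n) (p.2.+1%:R^-1).

(** Countably many balls generate the topology, so Borel measurability can be tested on balls; for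
    the maximum norm these are cubes, hence products of intervals. *)
Lemma open_bigcup_ball (A : set 'rV[R]_n) : open A ->
  exists P : set (('rV[rat]_n * nat)%type),
    A = \bigcup_(p in P) ball (map_mx ratr p.1 : 'rV[R]_n) (p.2.+1%:R^-1).
Proof.
move=> oA; exists [set p | rball p `<=` A].
apply/seteqP; split => [x Ax|x [p /= pA]]; last exact: pA.
have /nbhs_ballP[e /= e0 eA] : nbhs x A by exact: open_nbhs_nbhs.
have [N Ne] : exists N : nat, N.+1%:R^-1 < e / 2 :> R.
  have [N] := ltr_add_invr (divr_gt0 e0 (ltr0n _ 2)).
  by rewrite add0r => ?; exists N.
have N0 : 0 < N.+1%:R^-1 :> R by rewrite invr_gt0.
have qx (k : 'I_n) : exists q : rat, `|x 0 k - ratr q| < N.+1%:R^-1.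
  have [|q] := @rat_in_itvoo R (x 0 k - N.+1%:R^-1) (x 0 k + N.+1%:R^-1).
    by move: N0; generalize (N.+1%:R^-1 : R) => e'; lra.
  by rewrite in_itv /= => qx; exists q; rewrite ltr_distlC.
pose q : 'rV[rat]_n := \row_k xchoose (qx k).
have qP k : `|x 0 k - ratr (q 0 k)| < N.+1%:R^-1.
  by rewrite mxE; exact: xchooseP (qx k).
exists (q, N) => /=; last first.
  by split=> // i k; rewrite mxE ord1 -ball_normE /ball_ /= distrC.
move=> y [_ qy]; apply: eA; split=> // i k.
rewrite ord1 -ball_normE /ball_ /=.
have := qy 0 k; rewrite -ball_normE /ball_ /= mxE => h.
rewrite -(subrKA (ratr (q 0 k))) (le_lt_trans (ler_normD _ _))//.
by rewrite (splitr e) ltrD// (lt_trans _ Ne)//.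
Qed.

Lemma measurable_to_borel_rV d (X : measurableType d) (f : X -> 'rV[R]_n) :
  (forall x e, 0 < e -> measurable (f @^-1` ball x e)) ->
  measurable_fun [set: X] (f : X -> borel 'rV[R]_n).
Proof.
move=> fb; apply: measurable_to_borel => A /open_bigcup_ball[P ->].
rewrite setTI preimage_bigcup.
rewrite bigcup_mkcond; apply: countable_bigcupT_measurable => [|p]; first exact: countableP.
by case: ifP => // _; apply: fb; rewrite invr_gt0.
Qed.

End rational_balls.

Section lebesgue_rV.
Context {R : realType}.
Local Open Scope ereal_scope.

(** The same splitting off of the first coordinate as in [integral_rV], so that [integral_rVE] is an
    induction on the dimension. *)
Definition consv {m : nat} (p : measurableTypeR R * borel 'rV[R]_m) :
    borel 'rV[R]_m.+1 :=
  row_mx (p.1%:M : 'rV[R]_1) (p.2 : 'rV[R]_m).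

Lemma consv0 m (p : measurableTypeR R * borel 'rV[R]_m) :
  (consv p : 'rV[R]_(1 + m)) 0%R (lshift m ord0) = p.1.
Proof. by rewrite /consv row_mxEl mxE eqxx. Qed.

Lemma consvS m (p : measurableTypeR R * borel 'rV[R]_m) k :
  (consv p : 'rV[R]_(1 + m)) 0%R (rshift 1 k) = (p.2 : 'rV[R]_m) 0%R k.
Proof. by rewrite /consv row_mxEr. Qed.

Lemma consv_ball m (x : 'rV[R]_m.+1) (e : R) : (0 < e)%R ->
  consv @^-1` (ball x e) = (ball ((x : 'rV[R]_(1 + m)) 0%R (lshift m ord0)) e) `*`
    (ball (rsubmx (x : 'rV[R]_(1 + m))) e).
Proof.
move=> e0; apply/seteqP; split => [[t y] [_ /= h]|[t y] /= [h1 [_ h2]]].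
  split; first by have /= <- := consv0 (t, y); exact: h.
  split=> // i k; rewrite ord1 mxE; have /= <- := consvS (t, y) k.
  exact: h.
split=> // i k; rewrite ord1.
have [j ->|j ->] := @split_ordP 1 m k.
  by rewrite ord1 [consv _ _ _](consv0 (t, y)).
by rewrite [consv _ _ _](consvS (t, y)); have := h2 0%R j; rewrite mxE.
Qed.

Lemma measurable_consv m : measurable_fun [set: _] (@consv m).
Proof.
apply: measurable_to_borel_rV => x e e0; rewrite consv_ball//.
apply: measurableX.
  by apply: open_measurable; exact: ball_open.
by apply: borel_open; exact: ball_open.
Qed.

Section succ.
Variables (m : nat) (mu : {sigma_finite_measure set (borel 'rV[R]_m) -> \bar R}).

Definition lebesgue_succ : set (borel 'rV[R]_m.+1) -> \bar R :=
  pushforward (@lebesgue_measure R \x mu) (@consv m).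

Let mpre A : measurable A -> measurable ((@consv m) @^-1` A).
Proof. by move=> mA; rewrite -[X in measurable X]setTI; exact: measurable_consv. Qed.

Let lebesgue_succ0 : lebesgue_succ set0 = 0.
Proof. by rewrite /lebesgue_succ /pushforward preimage_set0 measure0. Qed.

Let lebesgue_succ_ge0 A : 0 <= lebesgue_succ A.
Proof. rewrite /lebesgue_succ /pushforward; exact: measure_ge0. Qed.

Let lebesgue_succ_sigma_additive : semi_sigma_additive lebesgue_succ.
Proof.
move=> F mF tF mUF; rewrite /lebesgue_succ /pushforward preimage_bigcup.
apply: measure_semi_sigma_additive.
- by move=> i; exact: mpre.
- apply/trivIsetP => /= i j _ _ ij; rewrite -preimage_setI.
  by move/trivIsetP : tF => /(_ _ _ _ _ ij) ->//; rewrite preimage_set0.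
- by rewrite -preimage_bigcup; exact: mpre.
Qed.

HB.instance Definition _ := isMeasure.Build _ _ _ lebesgue_succ
  lebesgue_succ0 lebesgue_succ_ge0 lebesgue_succ_sigma_additive.

Let lebesgue_succ_sigma_finite : sigma_finite setT lebesgue_succ.
Proof.
have /sigma_finiteP[F [F_T F_nd F_oo]] := sigma_finiteT mu.
pose G (i : nat) : set (borel 'rV[R]_m.+1) :=
  [set v | (`|(v : 'rV[R]_(1 + m)) 0%R (lshift m ord0)| < i%:R)%R /\
    F i (rsubmx (v : 'rV[R]_(1 + m)))].
exists G.
  apply/seteqP; split=> // v _.
  have [i _ Fi] : (\bigcup_i F i) (rsubmx (v : 'rV[R]_(1 + m))) by rewrite -F_T.
  pose c := (v : 'rV[R]_(1 + m)) 0%R (lshift m ord0).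
  have [k ck] : exists k : nat, (`|c| < k%:R)%R.
    by exists (Num.bound `|c|)%R; rewrite archi_boundP.
  exists (maxn i k) => //; split.
    by rewrite (lt_le_trans ck)// ler_nat leq_maxr.
  by have /subsetPset := F_nd _ _ (leq_maxl i k); exact.
move=> i; have [mFi Fi_oo] := F_oo i.
have GE : (@consv m) @^-1` (G i) = [set t : measurableTypeR R | (`|t| < i%:R)%R] `*` F i.
  apply/seteqP; split=> -[t y] /=; rewrite /G /consv /= row_mxEl mxE eqxx mulr1n row_mxKr.
    by [].
  by [].
have mI : measurable [set t : measurableTypeR R | (`|t| < i%:R)%R].
  rewrite (_ : [set _ | _] = `](- i%:R)%R, i%:R[%classic)//.
  by apply/seteqP; split=> t /=; rewrite in_itv /= ltr_norml.
split.
  rewrite (_ : G i = (fun v : 'rV[R]_(1 + m) => v 0%R (lshift m ord0)) @^-1`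
      [set t : measurableTypeR R | (`|t| < i%:R)%R] `&`
      (fun v : borel 'rV[R]_(1 + m) => rsubmx v : borel 'rV[R]_m) @^-1` F i)//.
  apply: measurableI.
    rewrite -[X in measurable X]setTI.
    apply: (@borel_continuous _ R (fun v : 'rV[R]_(1 + m) => v 0%R (lshift m ord0))) => //.
    exact: coord_continuous.
  rewrite -[X in measurable X]setTI.
  have : measurable_fun setT (fun v : borel 'rV[R]_(1 + m) => rsubmx v : borel 'rV[R]_m).
    apply: measurable_to_borel => A oA; rewrite setTI; apply: borel_open.
    by apply: open_comp oA => v _; exact: continuous_rsubmx.
  exact.
rewrite [X in X < _](_ : _ = lebesgue_measure [set t : measurableTypeR R | (`|t| < i%:R)%R] * mu (F i)).
  rewrite (_ : [set t : measurableTypeR R | _] = `](- i%:R)%R, i%:R[%classic); last first.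
    by apply/seteqP; split=> t /=; rewrite in_itv /= ltr_norml.
  rewrite lebesgue_measure_itv /=; case: ifP => _; last by rewrite mul0e.
  by rewrite lte_mul_pinfty// -EFinD lee_fin opprK addr_ge0.
by rewrite /lebesgue_succ /pushforward GE product_measure1E.
Qed.

HB.instance Definition _ := Measure_isSigmaFinite.Build _ _ _ lebesgue_succ
  lebesgue_succ_sigma_finite.

End succ.

(** Turns the iterated integral [integral_rV] into integration against a measure, to which Fubini
    and the convergence theorems apply. In dimension 0 it is a point mass, in accordance with
    [integral_rV]. *)
Fixpoint lebn (n : nat) : {sigma_finite_measure set (borel 'rV[R]_n) -> \bar R} :=
  match n with
  | 0 => \d_(0%R : borel 'rV[R]_0)
  | m.+1 => lebesgue_succ (lebn m)
  end.

End lebesgue_rV.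

Lemma integrable_bounded_support d (T : measurableType d) (R : realType)
    (mu : {measure set T -> \bar R}) (f : T -> R) (A : set T) (M : R) :
  measurable A -> (mu A < +oo)%E -> measurable_fun setT f ->
  (forall x, `|f x| <= M) -> (forall x, ~ A x -> f x = 0) ->
  mu.-integrable setT (EFin \o f).
Proof.
move=> mA Aoo mf fM fA.
have M0 : 0 <= M by rewrite (le_trans _ (fM point)).
apply/integrableP; split; first exact/measurable_EFinP.
apply: (@le_lt_trans _ _ (\int[mu]_x (M%:E * (\1_A x)%:E))%E).
  apply: ge0_le_integral => //.
  - by apply: measurableT_comp => //; exact/measurable_EFinP.
  - by apply: measurable_funeM; apply/measurable_EFinP; exact: measurable_indic.
  move=> x _; rewrite /= lee_fin indicE; have [xA|xA] := boolP (x \in A).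
    by rewrite mulr1.
  by rewrite mulr0 fA ?normr0// => /mem_set; apply/negP.
rewrite ge0_integralZl//; last exact/measurable_EFinP/measurable_indic.
by rewrite integral_indic// setIT lte_mul_pinfty.
Qed.

Lemma bounded_compact_support (T : topologicalType) (R : realType) (f : T -> R) (K : set T) :
  compact K -> continuous f -> (forall x, ~ K x -> f x = 0) ->
  exists M, forall x, `|f x| <= M.
Proof.
move=> cK cf fK.
have : compact (f @` K) by apply: continuous_compact => //; exact: continuous_subspaceT.
move=> /compact_bounded[M [_ MP]]; exists `|M + 1| => x.
have [Kx|/fK ->] := pselect (K x); last by rewrite normr0.
apply: (le_trans (MP (M + 1) _ _ _)) => //; last exact: ler_norm.
by rewrite ltrDl.
Qed.

(** * Iterated integrals and the divergence theorem on R^n *)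

Section integral_rV.
Context {R : realType}.
Implicit Types n m : nat.

Definition bounded_support {n} (f : 'rV[R]_n -> R) : Prop :=
  exists K : R, forall x, K < `|x| -> f x = 0.

Lemma lebn_ball n (x : 'rV[R]_n) (e : R) : 0 < e ->
  lebn n (ball x e) = ((e *+ 2) ^+ n)%:E.
Proof.
move=> e0; elim: n x => [|m IH] x.
  rewrite /= diracE (_ : _ \in _)// inE; split=> // i k; by have := ltn_ord k; rewrite ltn0.
rewrite /= /lebesgue_succ /pushforward consv_ball// product_measure1E//=.
- by rewrite lebesgue_measure_ball ?ltW// IH -EFinM exprS.
- by apply: open_measurable; exact: ball_open.
- by apply: borel_open; exact: ball_open.
Qed.

Lemma lebn_ball_lty n (x : 'rV[R]_n) (e : R) : (lebn n (ball x e) < +oo)%E.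
Proof.
have [e0|e0] := ltP 0 e; first by rewrite lebn_ball// ltry.
rewrite (_ : ball x e = set0) ?measure0//.
by apply/seteqP; split=> // y [h _]; move: h; rewrite ltNge e0.
Qed.

Lemma ge0_integral_lebnS m (f : 'rV[R]_m.+1 -> \bar R) :
  measurable_fun [set: borel 'rV[R]_m.+1] (f : borel 'rV[R]_m.+1 -> \bar R) ->
  (forall x, 0 <= f x)%E ->
  (\int[lebn m.+1]_x f x =
   \int[@lebesgue_measure R]_t \int[lebn m]_y f (consv (t, y)))%E.
Proof.
move=> mf f0.
rewrite [LHS](@ge0_integral_pushforward _ _ _ _ _ _ (@measurable_consv R m)
  (product_measure1 (@lebesgue_measure R) (lebn m)) setT f)//.
rewrite preimage_setT (@fubini_tonelli1 _ _ _ _ _ _ _ (f \o consv))//; last by move=> x; exact: f0.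
by apply: measurableT_comp => //; exact: measurable_consv.
Qed.

Lemma integrable_lebnS m (f : 'rV[R]_m.+1 -> \bar R) :
  (lebn m.+1).-integrable setT f ->
  (product_measure1 (@lebesgue_measure R) (lebn m)).-integrable setT (f \o consv).
Proof.
move=> /integrableP[mf foo]; apply/integrableP; split.
  by apply: measurableT_comp => //; exact: measurable_consv.
apply: le_lt_trans foo.
rewrite [leRHS](@ge0_integral_pushforward _ _ _ _ _ _ (@measurable_consv R m)
  (product_measure1 (@lebesgue_measure R) (lebn m)) setT (abse \o f))//.
  exact: measurableT_comp.
by move=> y _ /=.
Qed.

Lemma integral_lebnS m (f : 'rV[R]_m.+1 -> \bar R) :
  (lebn m.+1).-integrable setT f ->
  ((\int[lebn m.+1]_x f x =
   \int[@lebesgue_measure R]_t \int[lebn m]_y f (consv (t, y)))%E *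
  (\int[lebn m.+1]_x f x =
   \int[lebn m]_y \int[@lebesgue_measure R]_t f (consv (t, y)))%E)%type.
Proof.
move=> fi; have fi' := integrable_lebnS fi; have /integrableP[mf _] := fi.
have E : (\int[lebn m.+1]_x f x =
    \int[product_measure1 (@lebesgue_measure R) (lebn m)]_z (f \o consv) z)%E.
  by rewrite [LHS](@integral_pushforward _ _ _ _ _ _ (@measurable_consv R m)
    (product_measure1 (@lebesgue_measure R) (lebn m)) setT f).
by rewrite {1}E -integral12_prod_meas1// E -integral21_prod_meas1.
Qed.

Lemma integral_rVE n (f : 'rV[R]_n -> \bar R) :
  measurable_fun [set: borel 'rV[R]_n] (f : borel 'rV[R]_n -> \bar R) ->
  (forall x, 0 <= f x)%E -> integral_rV f = (\int[lebn n]_x f x)%E.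
Proof.
elim: n f => [|m IH] f mf f0.
  by rewrite /= integral_dirac// diracT mul1e.
rewrite ge0_integral_lebnS//=; apply: eq_integral => t _; rewrite IH//.
have mc : measurable_fun [set: borel 'rV[R]_m]
    (fun y : borel 'rV[R]_m => consv (t : measurableTypeR R, y)).
  apply: (@measurableT_comp _ _ _ _ _ _ (@consv R m)); first exact: measurable_consv.
  exact: measurable_fun_pair.
exact: measurableT_comp mf mc.
Qed.

Lemma integrable_bounded_support_rV n (f : 'rV[R]_n -> R) :
  continuous f -> bounded_support f -> (lebn n).-integrable setT (EFin \o f).
Proof.
move=> cf [K fK].
pose B := closed_ball (0 : 'rV[R]_n) (`|K| + 1).
have K1 : 0 < `|K| + 1 by rewrite ltr_wpDl.
have cB : compact B.
  apply: bounded_closed_compact; last exact: closed_ball_closed.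
  exists (`|K| + 1); split => // M KM x; rewrite /B closed_ballE// /closed_ball_ /= sub0r normrN.
  by move=> /le_trans -> //; exact: ltW.
have fB x : ~ B x -> f x = 0.
  move=> Bx; apply: fK; rewrite ltNge; apply/negP => xK; apply: Bx.
  by rewrite /B closed_ballE// /closed_ball_ /= sub0r normrN (le_trans xK)// ler_wpDr// ler_norm.
have [M fM] := bounded_compact_support cB cf fB.
apply: (@integrable_bounded_support _ (borel 'rV[R]_n) R (lebn n) f B M) => //.
- by apply: borel_closed; exact: closed_ball_closed.
- apply: (@le_lt_trans _ _ (lebn n (ball (0 : 'rV[R]_n) (`|K| + 2)))); last exact: lebn_ball_lty.
  apply: le_measure; rewrite ?inE.
  + by apply: borel_closed; exact: closed_ball_closed.
  + by apply: borel_open; exact: ball_open.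
  + move=> x; rewrite /B closed_ballE// /closed_ball_ -ball_normE /ball_ /=.
    by move=> /le_lt_trans; apply; rewrite ltrD2l ltr1n.
- exact: borel_continuous.
Qed.

Lemma integral_derive0 (g : R -> R) : (forall t, derivable g t 1) ->
  continuous (g^`()%classic) -> (exists K, forall t, K < `|t| -> g t = 0) ->
  (\int[@lebesgue_measure R]_t (g^`()%classic t)%:E = 0)%E.
Proof.
move=> dg cg [K0 gK0].
pose K := `|K0|; have gK t : K < `|t| -> g t = 0.
  by move=> Kt; apply: gK0; rewrite (le_lt_trans (ler_norm _) Kt).
have cgg : continuous g.
  by move=> t; apply: differentiable_continuous; exact/derivable1_diffP.
have g'K t : K < `|t| -> g^`()%classic t = 0.
  move=> Kt; rewrite derive1E (@near_eq_derive _ _ _ g (cst 0)) ?derive_cst//.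
  have oK : open [set t : R | K < `|t|].
    apply: (@open_comp _ _ (fun t : R => `|t|) [set s | K < s]); last exact: open_gt.
    by move=> s _; exact: norm_continuous.
  by apply: filterS (open_nbhs_nbhs (conj oK Kt)) => s /= /gK ->.
pose L := K + 1.
have L0 : - L < L by rewrite /L /K; have := normr_ge0 K0; lra.
have LK : K < `|L| by rewrite ger0_norm /L /K; have := normr_ge0 K0; lra.
have gL : g L = 0 by rewrite gK.
have gNL : g (- L) = 0 by rewrite gK// normrN.
pose a : R := - L.
transitivity (\int[@lebesgue_measure R]_(t in `[a, L]) (g^`()%classic t)%:E)%E.
  rewrite [RHS]integral_mkcond; apply: eq_integral => t _; rewrite patchE.
  case: ifPn => // /negP tL; rewrite g'K// ltNge; apply/negP => tK; apply: tL.
  rewrite inE /= in_itv /= -ler_norml (le_trans tK)// /L lerDl//.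
have cg' : {within `[a, L], continuous g^`()%classic} by exact: continuous_subspaceT.
have dg' : derivable_oo_LRcontinuous g a L.
  split; first by move=> t _; exact: dg.
    by apply: cvg_at_right_filter; exact: cgg.
  by apply: cvg_at_left_filter; exact: cgg.
have gg' : {in `]a, L[, g^`()%classic =1 g^`()%classic} by move=> t _.
by rewrite (continuous_FTC2 L0 cg' dg' gg') gL gNL subee.
Qed.

Lemma bounded_support_partial n (F : 'rV[R]_n -> R) a :
  bounded_support F -> bounded_support (partial a F).
Proof.
move=> [K FK]; exists K => x Kx.
rewrite /partial (@near_eq_derive _ _ _ F (cst 0)) ?derive_cst//.
have oK : open [set y : 'rV[R]_n | K < `|y|].
  apply: (@open_comp _ _ (fun y : 'rV[R]_n => `|y|) [set s | K < s]); last exact: open_gt.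
  by move=> s _; exact: norm_continuous.
by apply: filterS (open_nbhs_nbhs (conj oK Kx)) => s /= /FK ->.
Qed.

Lemma smooth_continuous n (F : 'rV[R]_n -> R) : smooth_on setT F -> continuous F.
Proof. by move=> sF x; apply: (smooth_on_continuous sF); rewrite inE. Qed.

Lemma norm_coord n (x : 'rV[R]_n) k : `|x 0 k| <= `|x|.
Proof.
rewrite [leRHS]/Num.Def.normr/= mx_normrE.
exact: (le_bigmax _ (fun i : 'I_1 * 'I_n => `|x i.1 i.2|) (ord0, k)).
Qed.

Lemma norm_consv m (t : R) (y : 'rV[R]_m) :
  `|t| <= `|consv (t, y) : 'rV[R]_m.+1| /\ `|y| <= `|consv (t, y) : 'rV[R]_m.+1|.
Proof.
split.
  have /= {1}<- := consv0 (t : measurableTypeR R, y : borel 'rV[R]_m).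
  exact: norm_coord.
rewrite [leLHS]/Num.Def.normr/= mx_normrE; apply: bigmax_le => // -[i k] _ /=.
rewrite ord1; have /= {1}<- := consvS (t : measurableTypeR R, y : borel 'rV[R]_m) k.
exact: norm_coord.
Qed.

Lemma consv_lineS m (t : R) (y : 'rV[R]_m) (k : 'I_m) (h : R) :
  consv (t, h *: delta_mx 0 k + y) =
  h *: delta_mx 0 (@rshift 1 m k) + (consv (t, y) : 'rV[R]_(1 + m)).
Proof.
have -> : h *: delta_mx 0 (@rshift 1 m k) = row_mx (0 : 'rV[R]_1) (h *: delta_mx 0 k).
  apply/rowP => j; have [i ->|i ->] := @split_ordP 1 m j.
    by rewrite row_mxEl !mxE eq_lrshift andbF mulr0.
  by rewrite row_mxEr !mxE (inj_eq (@rshift_inj 1 m)).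
by rewrite /consv add_row_mx add0r.
Qed.

Lemma consv_line0 m (t : R) (y : 'rV[R]_m) (h : R) :
  consv (h + t, y) =
  h *: delta_mx 0 (@lshift 1 m ord0) + (consv (t, y) : 'rV[R]_(1 + m)).
Proof.
have -> : h *: delta_mx 0 (@lshift 1 m ord0) = row_mx (h%:M : 'rV[R]_1) 0.
  apply/rowP => j; have [i ->|i ->] := @split_ordP 1 m j.
    by rewrite row_mxEl !mxE (inj_eq (@lshift_inj 1 m)) ord1 eqxx mulr1.
  by rewrite row_mxEr !mxE eq_rlshift andbF mulr0.
by rewrite /consv add_row_mx add0r -raddfD.
Qed.

Lemma partial_consvS m (F : 'rV[R]_m.+1 -> R) (t : R) (y : 'rV[R]_m) (k : 'I_m) :
  partial (@rshift 1 m k) F (consv (t, y)) =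
  partial k (fun y => F (consv (t, y))) y.
Proof.
rewrite /partial /derive.
set f1 := (X in lim (X @ _)); set f2 := (X in _ = lim (X @ _)).
suff -> : f1 = f2 by [].
by rewrite /f1 /f2; apply/funext => h /=; rewrite consv_lineS.
Qed.

Lemma partial_consv0 m (F : 'rV[R]_m.+1 -> R) (t : R) (y : 'rV[R]_m) :
  partial (@lshift 1 m ord0) F (consv (t, y)) =
  (fun t => F (consv (t, y)))^`()%classic t.
Proof.
rewrite /derive1 /partial /derive.
set f1 := (X in lim (X @ _)); set f2 := (X in _ = lim (X @ _)).
suff -> : f1 = f2 by [].
by rewrite /f1 /f2; apply/funext => h /=; rewrite consv_line0.
Qed.

Lemma smooth_consvS m (F : 'rV[R]_m.+1 -> R) (t : R) : smooth_on setT F ->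
  smooth_on setT (fun y : 'rV[R]_m => F (consv (t, y))).
Proof.
move=> sF; apply: (@smooth_on_comp _ _ _ _ setT (fun y => consv (t, y)) F) => //.
  exact: openT.
move=> j; have [i ->|i ->] := @split_ordP 1 m j.
  rewrite ord1 (_ : (fun y => _) = cst t); first exact: smooth_on_cst.
  by apply/funext => y; rewrite [LHS](consv0 (t : measurableTypeR R, _)).
rewrite (_ : (fun y => _) = (fun y : 'rV[R]_m => y 0 i)); first exact: smooth_on_coord.
by apply/funext => y; rewrite [LHS](consvS (t : measurableTypeR R, _)).
Qed.

(** Fubini, in the order that suits [a]: a derivative in the first coordinate is integrated
    innermost by the fundamental theorem of calculus; any other derivative is handled by induction
    in the slices where the first coordinate is fixed. *)
Lemma integral_partial0 n (F : 'rV[R]_n -> R) a : smooth_on setT F ->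
  bounded_support F -> (\int[lebn n]_x (partial a F x)%:E = 0)%E.
Proof.
elim: n F a => [|m IH] F a sF bF; first by case: a.
have spF : smooth_on setT (partial a F) by exact: smooth_on_partial.
have ipF : (lebn m.+1).-integrable setT (EFin \o partial a F).
  by apply: integrable_bounded_support_rV;
    [exact: smooth_continuous|exact: bounded_support_partial].
have [K FK] := bF.
have [i ai|k ak] := @split_ordP 1 m a; last first.
  rewrite (integral_lebnS ipF).1 /= integral0_eq// => t _.
  rewrite ak; under eq_integral do rewrite partial_consvS.
  apply: IH; first exact: smooth_consvS.
  by exists K => y Ky; apply: FK; rewrite (lt_le_trans Ky)//; have [] := norm_consv t y.
rewrite (integral_lebnS ipF).2 /= integral0_eq// => y _.
rewrite ai ord1; under eq_integral do rewrite partial_consv0.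
have cline : continuous (fun t : R => consv (t, y) : 'rV[R]_m.+1).
  rewrite (_ : (fun t => _) = (fun t : R => t *: delta_mx 0 (@lshift 1 m ord0) +
      (consv (0 : R, y) : 'rV[R]_(1 + m)))).
    move=> t; apply: cvgD; last exact: cvg_cst.
    exact: scalel_continuous.
  by apply/funext => t; rewrite -{1}[t]addr0 consv_line0.
apply: integral_derive0.
- move=> t; have : derivable F (consv (t, y)) (delta_mx 0 (@lshift 1 m ord0)).
    by apply: diff_derivable; exact: smooth_on_diff sF _ _.
  rewrite /derivable.
  set f1 := (X in cvg (X @ _)); set f2 := (X in _ -> cvg (X @ _)).
  suff -> : f1 = f2 by [].
  by rewrite /f1 /f2; apply/funext => h /=; rewrite [h *: 1]mulr1 consv_line0.
- rewrite (_ : _^`()%classic = (partial (@lshift 1 m ord0) F) \o (fun t => consv (t, y))).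
    move=> t; apply: continuous_comp; first exact: cline.
    by apply: smooth_continuous; exact: smooth_on_partial.
  by apply/funext => t; rewrite /= partial_consv0.
- by exists K => t Kt; apply: FK; rewrite (lt_le_trans Kt)//; have [] := norm_consv t y.
Qed.

End integral_rV.

Lemma integrableZR d (T : measurableType d) (R : realType)
    (mu : {measure set T -> \bar R}) (f : T -> R) (c : R) :
  mu.-integrable setT (EFin \o f) -> mu.-integrable setT (EFin \o (fun x => c * f x)).
Proof. by move=> fi; apply: eq_integrable (integrableZl measurableT c fi). Qed.

(** * Test functions of one variable *)

Section smooth1.
Context {R : realType}.
Implicit Types g h : R -> R.

(** Phrased on row vectors of length 1 so that the closure properties of [smooth_on] carry over. *)
Definition smooth1 g := smooth_on setT (fun x : 'rV[R]_1 => g (x 0 0)).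

Lemma smooth1_derive g (t : R) : smooth1 g -> is_derive t 1 g (g^`()%classic t).
Proof.
move=> sg; have dg : differentiable (fun x : 'rV[R]_1 => g (x 0 0)) (0 + t *: delta_mx 0 0).
  exact: smooth_on_diff sg _ _.
have := is_derive_line dg.
rewrite (_ : (fun s : R => g ((0 + s *: delta_mx 0 0 : 'rV[R]_1) 0 0)) = g); last first.
  by apply/funext => s; rewrite !mxE eqxx mulr1 add0r.
by move=> dgt; rewrite derive1E derive_val.
Qed.

Lemma smooth1_partial g : smooth1 g ->
  partial 0 (fun x : 'rV[R]_1 => g (x 0 0)) = (fun x => g^`()%classic (x 0 0)).
Proof.
move=> sg; apply/funext => x.
have xE : x = 0 + x 0 0 *: delta_mx 0 0.
  by apply/rowP => i; rewrite !mxE ord1 eqxx mulr1 add0r.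
have dg : differentiable (fun x : 'rV[R]_1 => g (x 0 0)) (0 + x 0 0 *: delta_mx 0 0).
  exact: smooth_on_diff sg _ _.
rewrite /partial {1}xE; have h := is_derive_line dg.
have := smooth1_derive (x 0 0) sg => h2.
rewrite -[LHS](@derive_val _ _ _ _ _ _ _ h).
rewrite (_ : (fun s : R => g ((0 + s *: delta_mx 0 0 : 'rV[R]_1) 0 0)) = g); last first.
  by apply/funext => s; rewrite !mxE eqxx mulr1 add0r.
by rewrite derive_val.
Qed.

Lemma smooth1_derive1 g : smooth1 g -> smooth1 g^`()%classic.
Proof. by move=> sg; rewrite /smooth1 -smooth1_partial//; exact: smooth_on_partial. Qed.

Lemma smooth1_comp n (A : set 'rV[R]_n) f g : open A -> smooth1 g ->
  smooth_on A f -> smooth_on A (fun x => g (f x)).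
Proof.
move=> oA sg fA; apply: (@smooth_on_comp1 _ _ smooth1 setT A f g) => //.
move=> h sh; exists h^`()%classic; first exact: smooth1_derive1.
by move=> t _; exact: smooth1_derive.
Qed.

Lemma smooth1_antiderivative g G : smooth1 g ->
  (forall t : R, derivable G t 1 /\ G^`()%classic t = g t) -> smooth1 G.
Proof.
move=> sg GP; have oT : open [set: 'rV[R]_1] by exact: openT.
have dG x : differentiable (fun x : 'rV[R]_1 => G (x 0 0)) x.
  apply: (@differentiable_comp _ _ _ _ (fun x : 'rV[R]_1 => x 0 0) G).
    exact: differentiable_coord.
  by apply/derivable1_diffP; have [] := GP (x 0 0).
apply/smooth_onP => -[|k]; split=> //.
move=> a; rewrite ord1 (_ : partial _ _ = (fun x => g (x 0 0))).
  by have /smooth_onP := sg; exact.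
apply/funext => x.
have xE : x = 0 + x 0 0 *: delta_mx 0 0.
  by apply/rowP => i; rewrite !mxE ord1 eqxx mulr1 add0r.
rewrite /partial {1}xE; have h := is_derive_line (dG (0 + x 0 0 *: delta_mx 0 0)).
rewrite -[LHS](@derive_val _ _ _ _ _ _ _ h).
rewrite (_ : (fun s : R => G ((0 + s *: delta_mx 0 0 : 'rV[R]_1) 0 0)) = G); last first.
  by apply/funext => s; rewrite !mxE eqxx mulr1 add0r.
by rewrite -derive1E; have [_ ->] := GP (x 0 0).
Qed.

Lemma smooth1_continuous g : smooth1 g -> continuous g.
Proof.
move=> sg t; apply: differentiable_continuous; apply/derivable1_diffP.
by have := smooth1_derive t sg => ?; exact: ex_derive.
Qed.

Definition test1 (b r : R) g : Prop :=
  smooth1 g /\ forall t, r < `|t - b| -> g t = 0.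

Lemma test1_integrable b r g : test1 b r g ->
  (@lebesgue_measure R).-integrable setT (EFin \o g).
Proof.
move=> [sg gr].
pose r0 := `|r|.
have gr0 t : ~ `[b - r0, b + r0]%classic t -> g t = 0.
  move=> H; apply: gr; rewrite ltNge; apply/negP => tr; apply: H.
  by rewrite /= in_itv /= -ler_distlC distrC (le_trans tr)// ler_norm.
have [M gM] := bounded_compact_support (@segment_compact R (b - r0) (b + r0))
  (smooth1_continuous sg) gr0.
apply: (@integrable_bounded_support _ (measurableTypeR R) R (@lebesgue_measure R) g
  `[b - r0, b + r0]%classic M) => //.
  rewrite [X in (X < _)%E](@lebesgue_measure_itv R `[b - r0, b + r0]) /=.
  by case: ifP => // _; rewrite -EFinD ltry.
exact: continuous_measurable_fun (smooth1_continuous sg).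
Qed.

(** The primitive starting at minus infinity vanishes to the left of the support; to the right of
    it, it equals the total integral, which is 0. *)
Lemma test1_antiderivative b r g : test1 b r g ->
  \int[@lebesgue_measure R]_t g t = 0 ->
  exists2 G, test1 b r G & G^`()%classic = g.
Proof.
move=> gT g0; have [sg gr'] := gT; have ig := test1_integrable gT.
pose G t := \int[@lebesgue_measure R]_(s in [set` `]-oo, t]]) g s.
have iI (I : interval R) : (@lebesgue_measure R).-integrable [set` I] (EFin \o g).
  by apply: integrableS ig => //; exact: measurable_itv.
have GP t : derivable G t 1 /\ G^`()%classic t = g t.
  apply: (@continuous_FTC1 R g -oo%O t (t + 1)) => //.
  - by rewrite ltrDl.
  - by rewrite ltNyr.
  - exact: smooth1_continuous.
exists G; last by apply/funext => t; have [] := GP t.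
split; first exact: smooth1_antiderivative sg GP.
move=> t tr; rewrite /G.
have [tb|tb] := leP t b.
  rewrite /Rintegral integral0_eq// => s /=; rewrite in_itv /= => st.
  rewrite gr'// (lt_le_trans tr)// ler0_norm ?subr_le0// ler0_norm ?subr_le0//.
    by rewrite lerN2 lerD2r.
  exact: le_trans tb.
rewrite Rintegral_mkcond -[RHS]g0; apply: eq_Rintegral => s _.
rewrite patchE; case: ifPn => // /negP sI; rewrite gr'//.
have ts : t < s by rewrite ltNge; apply/negP => st; apply: sI; rewrite inE /= in_itv.
rewrite (lt_le_trans tr)// ger0_norm ?subr_ge0 ?ltW// ger0_norm ?subr_ge0 ?(ltW (lt_trans tb ts))//.
by rewrite ltrD2r.
Qed.

Lemma smooth_step_le1 t : smooth_step t <= 1 :> R.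
Proof.
by rewrite /smooth_step ler_pdivrMr ?flat1D_gt0// mul1r lerDl flat1_ge0.
Qed.

(* A smooth approximation of the indicator of ]u, v[, exact where [1 <= j (t - u)]
   and [1 <= j (v - t)]. *)
Definition plateau (j u v t : R) : R :=
  smooth_step (j * (t - u)) * smooth_step (j * (v - t)).

Lemma smooth1_plateau j u v : smooth1 (plateau j u v).
Proof.
have oT : open [set: 'rV[R]_1] by exact: openT.
have lin (c d : R) : smooth_on setT (fun x : 'rV[R]_1 => smooth_step (c * x 0 0 + d)).
  apply: smooth_on_step => //; apply: smooth_onD => //; last exact: smooth_on_cst.
  by apply: smooth_onZ => //; exact: smooth_on_coord.
rewrite /smooth1 (_ : (fun x => _) = (fun x : 'rV[R]_1 => smooth_step (j * x 0 0 + - (j * u)))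
   \* (fun x => smooth_step (- j * x 0 0 + j * v))).
  exact: smooth_onM.
by apply/funext => x; rewrite /plateau /=; congr (smooth_step _ * smooth_step _); ring.
Qed.

Lemma plateau_ge0 j u v t : 0 <= plateau j u v t.
Proof. by rewrite mulr_ge0 ?smooth_step_ge0. Qed.

Lemma plateau_le1 j u v t : plateau j u v t <= 1.
Proof. by rewrite mulr_ile1 ?smooth_step_ge0 ?smooth_step_le1. Qed.

Lemma plateau0 j u v t : 0 <= j -> ~~ (u < t < v) -> plateau j u v t = 0.
Proof.
move=> j0; rewrite negb_and -!leNgt /plateau => /orP[tu|vt].
  by rewrite smooth_step0 ?mul0r// mulr_ge0_le0// subr_le0.
by rewrite [X in _ * X]smooth_step0 ?mulr0// mulr_ge0_le0// subr_le0.
Qed.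

Lemma plateau1 j u v t : 1 <= j * (t - u) -> 1 <= j * (v - t) -> plateau j u v t = 1.
Proof. by move=> h1 h2; rewrite /plateau !smooth_step1 ?mulr1. Qed.

Lemma test1_plateau b r j u v : 0 <= j -> b - r <= u -> v <= b + r ->
  test1 b r (plateau j u v).
Proof.
move=> j0 bu vb; split; first exact: smooth1_plateau.
move=> t tr; apply: plateau0 => //; apply/negP => /andP[ut tv].
by move: tr; rewrite ltNge ler_norml => /negP; apply; apply/andP; split; lra.
Qed.

(** The plateau is 1 on [[u + j^-1, v - j^-1]], an interval of positive length by the assumption on
    [j * (v - u)]. *)
Lemma integral_plateau_gt0 b r j u v : test1 b r (plateau j u v) ->
  0 < j -> 2 < j * (v - u) -> 0 < \int[@lebesgue_measure R]_t plateau j u v t.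
Proof.
move=> gT j0 juv; have ig := test1_integrable gT.
pose a := u + j^-1; pose c := v - j^-1.
have ac : a < c.
  rewrite /a /c ltrBrDr -addrA -mulr2n -ltrBrDl -(ltr_pM2l j0) -mulr_natl mulrCA.
  by rewrite mulfV ?gt_eqF// mulr1.
rewrite -lte_fin /Rintegral fineK; last exact: integrable_fin_num.
apply: (@lt_le_trans _ _ (\int[@lebesgue_measure R]_t (\1_(`[a, c]%classic) t)%:E)%E).
  have -> : (\int[@lebesgue_measure R]_t (\1_(`[a, c]%classic) t)%:E)%E =
      lebesgue_measure `[a, c]%classic by rewrite integral_indic// setIT.
  rewrite lebesgue_measure_itv /= lte_fin ac.
  by rewrite -EFinD lte_fin subr_gt0.
apply: ge0_le_integral => //.
- exact/measurable_EFinP/measurable_indic.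
- apply/measurable_EFinP; apply: continuous_measurable_fun.
  by apply: smooth1_continuous; exact: smooth1_plateau.
move=> t _; rewrite lee_fin indicE; case: (boolP (t \in _)) => /=.
  rewrite inE /= in_itv /= => /andP[at_ tc]; rewrite plateau1//.
    by rewrite -ler_pdivrMl// mulr1 lerBrDl.
  by rewrite -ler_pdivrMl// mulr1 lerBrDl -lerBrDr.
by rewrite plateau_ge0.
Qed.

End smooth1.

(** * Measures annihilating the partial derivatives of test functions *)

Section uniqueness.
Context {R : realType} {n : nat}.
Implicit Types (b : 'rV[R]_n) (r : R) (F : 'rV[R]_n -> R) (h : 'I_n -> R -> R).

Definition test_on b r F : Prop :=
  smooth_on setT F /\ forall x, r < `|x - b| -> F x = 0.

Definition prodf h (x : 'rV[R]_n) : R := \prod_(k < n) h k (x 0 k).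

Lemma norm_le_coord (x : 'rV[R]_n) c : 0 <= c -> (forall k, `|x 0 k| <= c) -> `|x| <= c.
Proof.
move=> c0 xc; rewrite [leLHS]/Num.Def.normr/= mx_normrE; apply: bigmax_le => // -[i k] _ /=.
by rewrite ord1.
Qed.

Lemma test_bounded_support b r F : test_on b r F -> bounded_support F.
Proof.
move=> [_ Fr]; exists (r + `|b|) => x rx; apply: Fr.
by rewrite -ltrBrDr in rx; rewrite (lt_le_trans rx)// lerB_dist.
Qed.

Lemma test_prodf b r h : 0 <= r -> (forall k, test1 (b 0 k) r (h k)) -> test_on b r (prodf h).
Proof.
move=> r0 hT; split.
  apply: smooth_on_prod; first exact: openT.
  move=> k _; apply: smooth1_comp; [exact: openT|by have [] := hT k|exact: smooth_on_coord].
move=> x rx; have [/existsP[k kx]|/existsPn H] := boolP [exists k, r < `|(x - b) 0 k|].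
  rewrite /prodf (bigD1 k)//=; have [_ ->] := hT k; first by rewrite mul0r.
  by move: kx; rewrite !mxE.
by move: rx; rewrite ltNge norm_le_coord// => k; rewrite leNgt H.
Qed.

Definition upd h k (g : R -> R) : 'I_n -> R -> R := fun i => if i == k then g else h i.

Lemma prodf_upd h k g x : prodf (upd h k g) x = g (x 0 k) * \prod_(i < n | i != k) h i (x 0 i).
Proof.
rewrite /prodf (bigD1 k)//= /upd eqxx; congr (_ * _).
by apply: eq_bigr => i /negbTE ->.
Qed.

Lemma partial_prodf_upd h k (G : R -> R) x : (forall i, smooth1 (h i)) -> smooth1 G ->
  partial k (prodf (upd h k G)) x = prodf (upd h k G^`()%classic) x.
Proof.
move=> sh sG.
have su i : smooth1 (upd h k G i) by rewrite /upd; case: ifP.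
rewrite prodf_upd /prodf (@partial_prod _ _ _ (fun i (y : 'rV[R]_n) => upd h k G i (y 0 i)))//; last 2 first.
  - move=> i; apply: (@smooth_on_diff _ _ setT) => //.
    by apply: smooth1_comp => //; [exact: openT|exact: smooth_on_coord].
  - exact: index_enum_uniq.
have dc i : partial k (fun y : 'rV[R]_n => upd h k G i (y 0 i)) x =
    (i == k)%:R * (upd h k G i)^`()%classic (x 0 i).
  have dx : differentiable (fun y : 'rV[R]_n => y 0 i) x by exact: differentiable_coord.
  have [_ ->] := partial_comp1 k dx (smooth1_derive (x 0 i) (su i)).
  rewrite mulrC; congr (_ * _).
  rewrite -(@jacobianE _ _ _ id)//.
  rewrite /jacobian mxE (@diff_val _ _ _ _ _ _ _ (is_diff_id x)).
  by rewrite mxE eqxx.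
rewrite (bigD1 k)//= dc eqxx mul1r [X in _ + X]big1 ?addr0; last first.
  by move=> i /negbTE ik; rewrite dc ik !mul0r.
rewrite {1}/upd eqxx; congr (_ * _).
by apply: eq_bigr => i /negbTE ik; rewrite /upd ik.
Qed.

(** A test function may be non-zero anywhere in the closed ball of radius [r], so finiteness is
    required on the larger open ball of radius [r *+ 2]. *)
Lemma test_integrable (nu : {measure set (borel 'rV[R]_n) -> \bar R}) b r F :
  (nu (ball b (r *+ 2)) < +oo)%E -> 0 < r -> test_on b r F ->
  nu.-integrable setT (EFin \o F).
Proof.
move=> nuoo r0 FT; have cF := smooth_continuous FT.1.
have cB : compact (closed_ball b r).
  apply: bounded_closed_compact; last exact: closed_ball_closed.
  exists (`|b| + r); split; first exact: num_real.
  move=> M KM x; rewrite closed_ballE// /closed_ball_ /=.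
  move=> bx; apply: ltW; apply: le_lt_trans KM.
  by rewrite addrC -lerBlDr (le_trans _ bx)// distrC lerB_dist.
have F0 x : ~ closed_ball b r x -> F x = 0.
  move=> bx; apply: FT.2; rewrite ltNge; apply/negP => xb; apply: bx.
  by rewrite closed_ballE// /closed_ball_ /= distrC.
have [M FM] := bounded_compact_support cB cF F0.
apply: (@integrable_bounded_support _ (borel 'rV[R]_n) R nu F (ball b (r *+ 2)) M) => //.
- by apply: borel_open; exact: ball_open.
- exact: borel_continuous.
- move=> x bx; apply: F0 => h; apply: bx; move: h.
  rewrite closed_ballE// -ball_normE /closed_ball_ /ball_ /=.
  by move=> /le_lt_trans; apply; rewrite mulr2n ltrDl.
Qed.

(** With [c] and [d] the integrals of [rho] and [h k], the function [c h_k - d rho] has integral 0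
    and so is the derivative of a test function. Hence the product in which it replaces [h k] is a
    [k]-th partial derivative, which [nu] annihilates. *)
Lemma integral_prodf_upd (nu : {measure set (borel 'rV[R]_n) -> \bar R}) b r h k rho :
  (nu (ball b (r *+ 2)) < +oo)%E -> 0 < r ->
  (forall F k, test_on b r F -> \int[nu]_x partial k F x = 0) ->
  (forall k, test1 (b 0 k) r (h k)) -> test1 (b 0 k) r rho ->
  (\int[@lebesgue_measure R]_t rho t) * \int[nu]_x prodf h x =
  (\int[@lebesgue_measure R]_t h k t) * \int[nu]_x prodf (upd h k rho) x.
Proof.
move=> nuoo r0 nu0 hT rT; set c := \int[@lebesgue_measure R]_t rho t.
set d := \int[@lebesgue_measure R]_t h k t.
pose g (t : R) := c * h k t - d * rho t.
have oT : open [set: 'rV[R]_1] by exact: openT.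
have gT : test1 (b 0 k) r g.
  split; last by move=> t bt; rewrite /g (hT k).2// rT.2// !mulr0 subrr.
  by apply: smooth_onB => //; apply: smooth_onZ => //; [exact: (hT k).1|exact: rT.1].
have g0 : \int[@lebesgue_measure R]_t g t = 0.
  have i1 := test1_integrable (hT k); have i2 := test1_integrable rT.
  have i1' : (@lebesgue_measure R).-integrable setT (EFin \o (fun t => c * h k t)).
    exact: integrableZR.
  have i2' : (@lebesgue_measure R).-integrable setT (EFin \o (fun t => d * rho t)).
    exact: integrableZR.
  by rewrite /g RintegralB// !RintegralZl// -/c -/d mulrC subrr.
have [G GT Gg] := test1_antiderivative gT g0.
have uT f : test1 (b 0 k) r f -> test_on b r (prodf (upd h k f)).
  move=> fT; apply: test_prodf; first exact: ltW.
  by move=> i; rewrite /upd; case: eqP => [->|].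
have E x : partial k (prodf (upd h k G)) x = prodf (upd h k g) x.
  by rewrite partial_prodf_upd ?Gg//; [move=> i; have [] := hT i|case: GT].
have := nu0 _ k (uT G GT); under eq_Rintegral do rewrite E.
have -> : (fun x => prodf (upd h k g) x) = (fun x => c * prodf h x - d * prodf (upd h k rho) x).
  apply/funext => x; rewrite !prodf_upd /g mulrBl -!mulrA; congr (_ * _ - _).
  by rewrite /prodf [RHS](bigD1 k).
have hTT : test_on b r (prodf h) by apply: test_prodf => //; exact: ltW.
have i1 := test_integrable nuoo r0 hTT; have i2 := test_integrable nuoo r0 (uT _ rT).
rewrite RintegralB//; last 2 first.
- exact: integrableZR.
- exact: integrableZR.
by rewrite !RintegralZl// => /eqP; rewrite subr_eq0 => /eqP.
Qed.

Lemma integral_prodf (nu : {measure set (borel 'rV[R]_n) -> \bar R}) b r h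
    (rho : 'I_n -> R -> R) :
  (nu (ball b (r *+ 2)) < +oo)%E -> 0 < r ->
  (forall F k, test_on b r F -> \int[nu]_x partial k F x = 0) ->
  (forall k, test1 (b 0 k) r (h k)) -> (forall k, test1 (b 0 k) r (rho k)) ->
  (\prod_k \int[@lebesgue_measure R]_t rho k t) * \int[nu]_x prodf h x =
  (\prod_k \int[@lebesgue_measure R]_t h k t) * \int[nu]_x prodf rho x.
Proof.
move=> nuoo r0 nu0 hT rT.
(* The factors are exchanged for those of [rho] one coordinate at a time, [s] listing the
   coordinates to exchange. *)
suff key (s : seq 'I_n) h' : uniq s -> (forall k, test1 (b 0 k) r (h' k)) ->
    (\prod_(k <- s) \int[@lebesgue_measure R]_t rho k t) * \int[nu]_x prodf h' x =
    (\prod_(k <- s) \int[@lebesgue_measure R]_t h' k t) *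
      \int[nu]_x prodf (fun k => if k \in s then rho k else h' k) x.
  have := key (index_enum 'I_n) h (index_enum_uniq _) hT.
  rewrite (_ : (fun k => if k \in _ then _ else _) = rho)//.
  by apply/funext => k; rewrite mem_index_enum.
elim: s h' => [|k s IH] h' /=.
  by move=> _ hT'; rewrite !big_nil !mul1r; congr (Rintegral _ _ _); apply/funext.
move=> /andP[ks us] hT'; rewrite !big_cons.
rewrite -mulrA [_ * (_ * Rintegral _ _ _)]mulrCA.
rewrite (integral_prodf_upd nuoo r0 nu0 hT' (rT k)) mulrCA.
have uT i : test1 (b 0 i) r (upd h' k (rho k) i) by rewrite /upd; case: eqP => [->|].
rewrite (IH _ us uT) -mulrA; congr (_ * (_ * _)).
  rewrite !big_seq; apply: eq_bigr => i si; rewrite /upd ifF//.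
  by apply/negbTE; apply: contraNneq ks => <-.
congr (Rintegral _ _ _); apply/funext => x; congr (prodf _ x); apply/funext => i.
by rewrite in_cons /upd; case: eqVneq => [->|]//=; case: ifP.
Qed.

Definition obox (u v : 'rV[R]_n) : set 'rV[R]_n :=
  [set x | forall k, u 0 k < x 0 k < v 0 k].

Lemma obox_ball b r : 0 < r -> ball b r = obox (b - const_mx r) (b + const_mx r).
Proof.
move=> r0; apply/seteqP; split=> [x [_ bx] k|x bx].
  by have := bx 0 k; rewrite -ball_normE /ball_ /= ltr_distlC !mxE.
split=> // i k; rewrite ord1 -ball_normE /ball_ /= ltr_distlC.
by have := bx k; rewrite !mxE.
Qed.

Lemma oboxI (u v u' v' : 'rV[R]_n) : obox u v `&` obox u' v' =
  obox (\row_k Num.max (u 0 k) (u' 0 k)) (\row_k Num.min (v 0 k) (v' 0 k)).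
Proof.
apply/seteqP; split => [x [/= h1 h2] k|x /= h].
  rewrite !mxE gt_max lt_min; have /andP[-> ->] := h1 k.
  by have /andP[-> ->] := h2 k.
split=> k; have := h k; rewrite !mxE gt_max lt_min.
  by move=> /andP[/andP[-> _] /andP[-> _]].
by move=> /andP[/andP[_ ->] /andP[_ ->]].
Qed.

Lemma open_obox (u v : 'rV[R]_n) : open (obox u v).
Proof.
have -> : obox u v = \bigcap_(k in [set: 'I_n]) [set x | u 0 k < x 0 k < v 0 k].
  by apply/seteqP; split => [x xb k _|x xb k]; [exact: xb|exact: (xb k)].
rewrite bigcap_fset_set//; [|exact: finite_finset].
rewrite big_seq; elim/big_ind: _ => [|A B oA oB|k _].
- exact: openT.
- exact: openI.
have : open ((fun x : 'rV[R]_n => x 0 k) @^-1` `]u 0 k, v 0 k[%classic).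
  apply: open_comp; last exact: interval_open.
  by move=> x _; exact: coord_continuous.
by congr open; apply/seteqP; split => x /=; rewrite in_itv.
Qed.

Lemma lebn_obox_measurable (u v : 'rV[R]_n) : measurable (obox u v : set (borel 'rV[R]_n)).
Proof. by apply: borel_open; exact: open_obox. Qed.

Lemma cvg_plateau_obox (nu : {measure set (borel 'rV[R]_n) -> \bar R}) b r
    (u v : 'rV[R]_n) :
  (nu (ball b (r *+ 2)) < +oo)%E -> 0 < r ->
  (forall k, b 0 k - r <= u 0 k) -> (forall k, v 0 k <= b 0 k + r) ->
  (\int[nu]_x (prodf (fun k => plateau j%:R (u 0 k) (v 0 k)) x)) @[j --> \oo] -->
  fine (nu (obox u v)).
Proof.
move=> nuoo r0 bu vb.
pose H j := prodf (fun k => plateau j%:R (u 0 k) (v 0 k)).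
have HT j : test_on b r (H j).
  by apply: test_prodf; [exact: ltW|move=> k; exact: test1_plateau].
have nuB : nu (obox u v) \is a fin_num.
  rewrite ge0_fin_numE//; apply: le_lt_trans nuoo; apply: le_measure; rewrite ?inE.
  - exact: lebn_obox_measurable.
  - by apply: borel_open; exact: ball_open.
  - move=> x xuv; split; first by rewrite pmulrn_lgt0.
    move=> i k; rewrite ord1 -ball_normE /ball_ /= ltr_distlC.
    have /andP[h1 h2] := xuv k; have := bu k; have := vb k.
    by rewrite mulr2n => ? ?; apply/andP; split; lra.
have mB : measurable (ball b (r *+ 2) : set (borel 'rV[R]_n)).
  by apply: borel_open; exact: ball_open.
have mf_ j : measurable_fun setT (fun x : borel 'rV[R]_n => (H j x)%:E).
  by apply/measurable_EFinP; apply: borel_continuous; apply: smooth_continuous; have [] := HT j.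
have mf : measurable_fun setT (fun x : borel 'rV[R]_n => (\1_(obox u v) x)%:E : \bar R).
  by apply/measurable_EFinP/measurable_indic; exact: lebn_obox_measurable.
have H0 j x : 0 <= H j x by apply: prodr_ge0 => k _; exact: plateau_ge0.
have H1 j x : H j x <= 1.
  by apply: prodr_ile1 => k _; rewrite plateau_ge0 plateau_le1.
have Hcv (x : borel 'rV[R]_n) : (H j x)%:E @[j --> \oo] --> (\1_(obox u v) x)%:E.
  apply: cvg_EFin; first by apply: nearW.
  rewrite indicE; have [|/negP xuv] := boolP (x \in obox u v).
    rewrite inE => xuv.
    have [N NP] : exists N : nat, forall k, (1 <= N%:R * (x 0 k - u 0 k)) && (1 <= N%:R * (v 0 k - x 0 k)).
      pose m k := Num.min (x 0 k - u 0 k) (v 0 k - x 0 k).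
      have m0 k : 0 < m k.
        by have /andP[h1 h2] := xuv k; rewrite lt_min !subr_gt0 h1 h2.
      (* The sum bounds all [(m k)^-1] at once, [m k] being the distance to the faces in direction
         [k]; from then on every factor of the product is 1 at [x]. *)
      pose M := \sum_k (m k)^-1.
      exists (Num.bound `|M|) => k.
      have MN : M <= (Num.bound `|M|)%:R.
        by rewrite (le_trans (ler_norm _))// ltW// archi_boundP.
      have mM : (m k)^-1 <= (Num.bound `|M|)%:R.
        apply: le_trans MN; rewrite /M (bigD1 k)//= lerDl sumr_ge0// => i _.
        by rewrite invr_ge0 ltW.
      rewrite -(ler_pM2r (m0 k)) mulVf ?gt_eqF// in mM.
      by rewrite !(le_trans mM)// ler_wpM2l// /m ge_min lexx ?orbT.
    apply: cvg_near_cst; near=> j.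
    rewrite /= /H /prodf big1// => k _.
    have /andP[h1 h2] := NP k; have /andP[x1 x2] := xuv k.
    have Nj : N%:R <= j%:R :> R by rewrite ler_nat; near: j; exact: nbhs_infty_ge.
    apply: plateau1.
      by rewrite (le_trans h1)// ler_wpM2r// subr_ge0 ltW.
    by rewrite (le_trans h2)// ler_wpM2r// subr_ge0 ltW.
  have [k xk] : exists k, ~~ (u 0 k < x 0 k < v 0 k).
    apply/existsP; apply: contra_notT xuv => /existsPn h; rewrite inE => k.
    by have := h k; rewrite negbK.
  rewrite (_ : (fun j => _) = cst 0); first exact: cvg_cst.
  by apply/funext => j; rewrite /= /H /prodf (bigD1 k)//= plateau0// mul0r.
have ig : nu.-integrable setT (fun x => (\1_(ball b (r *+ 2)) x)%:E).
  apply: (@integrable_bounded_support _ (borel 'rV[R]_n) R nu (\1_(ball b (r *+ 2))) (ball b (r *+ 2)) 1) => //.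
    by move=> x; rewrite indicE; case: (_ \in _); rewrite ?normr1 ?normr0.
  by move=> x bx; rewrite indicE memNset.
have fg (x : borel 'rV[R]_n) j : (`|(H j x)%:E| <= (\1_(ball b (r *+ 2)) x)%:E)%E.
  rewrite /= lee_fin ger0_norm// indicE; case: (boolP (x \in _)) => //= /negP xB.
  rewrite (HT j).2// ltNge; apply/negP => xr; apply: xB; rewrite inE -ball_normE /ball_ /= distrC.
  by rewrite (le_lt_trans xr)// mulr2n ltrDl.
have [_ _] := @dominated_convergence _ (borel 'rV[R]_n) R nu setT measurableT
  (fun j x => (H j x)%:E) (fun x => (\1_(obox u v) x)%:E)
  (fun x => (\1_(ball b (r *+ 2)) x)%:E) mf_ mf
  (aeW nu (fun x (_ : setT x) => Hcv x)) ig (aeW nu (fun x j (_ : setT x) => fg x j)).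
rewrite integral_indic//= ?setIT; last exact: lebn_obox_measurable.
by rewrite -{1}(fineK nuB) => /fine_cvg.
Unshelve. all: by end_near. Qed.

Lemma borel_rV_obox : @measurable _ (borel 'rV[R]_n) = <<s range (fun uv => obox uv.1 uv.2) >>.
Proof.
apply/seteqP; split.
  apply: smallest_sub; first exact: smallest_sigma_algebra.
  move=> A /open_bigcup_ball[P ->].
  rewrite bigcup_mkcond.
  apply: (@countable_bigcupT_measurable _ (g_sigma_algebraType (range (fun uv : 'rV[R]_n * 'rV[R]_n => obox uv.1 uv.2)))).
    exact: countableP.
  move=> p; case: ifP => _; last exact: measurable0.
  apply: sub_sigma_algebra; rewrite obox_ball ?invr_gt0//.
  by eexists (_, _).
apply: smallest_sub; first exact: sigma_algebra_measurable.
by move=> _ [[u v] _ <-]; exact: lebn_obox_measurable.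
Qed.

Lemma lebn_test_divergence b r F k : test_on b r F -> \int[lebn n]_x partial k F x = 0.
Proof.
move=> FT; rewrite /Rintegral integral_partial0//; first by case: FT.
exact: test_bounded_support FT.
Qed.

(* A measure annihilating all [partial k F] is translation invariant, hence a
   multiple of Lebesgue measure; products of functions of one variable suffice
   to see this. *)
Lemma divergence_free_lebesgue (nu : {measure set (borel 'rV[R]_n) -> \bar R}) b r :
  (nu (ball b (r *+ 2)) < +oo)%E -> 0 < r ->
  (forall F k, test_on b r F -> \int[nu]_x partial k F x = 0) ->
  exists2 c : R, 0 <= c & forall A : set (borel 'rV[R]_n),
    measurable A -> A `<=` (ball b r : set 'rV[R]_n) ->
    nu A = (c%:E * lebn n A)%E.
Proof.
move=> nuoo r0 nu0; have leboo := lebn_ball_lty b (r *+ 2).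
(* A reference function for comparing [nu] with [lebn]. Its slope makes it 1 up to distance
   [2 r / 3] from the centre, so its integral is seen to be positive on the ball of radius
   [r / 2]. *)
pose rho k := plateau (3 / r) (b 0 k - r) (b 0 k + r).
have rT k : test1 (b 0 k) r (rho k) by apply: test1_plateau => //; rewrite divr_ge0// ltW.
have P0 : 0 < \prod_k \int[@lebesgue_measure R]_t rho k t.
  apply: prodr_gt0 => k _; apply: integral_plateau_gt0 (rT k) _ _; first by rewrite divr_gt0.
  by rewrite (_ : 3 / r * _ = 6) ?ltr_nat//; field; rewrite gt_eqF.
set P := \prod_k _ in P0.
pose cnu := \int[nu]_x prodf rho x; pose cleb := \int[lebn n]_x prodf rho x.
(* Eliminates [z], the product of the one-variable integrals, from the two instances of
   [integral_prodf]. *)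
have aux (q x y z cn cl : R) : q * x = z * cn -> q * y = z * cl -> q * (cl * x) = q * (cn * y).
  by move=> e1 e2; rewrite mulrCA e1 [RHS]mulrCA e2; ring.
have box (u v : 'rV[R]_n) : (forall k, b 0 k - r <= u 0 k) -> (forall k, v 0 k <= b 0 k + r) ->
    cleb * fine (nu (obox u v)) = cnu * fine (lebn n (obox u v)).
  move=> bu vb.
  have c1 := cvg_plateau_obox nuoo r0 bu vb; have c2 := cvg_plateau_obox leboo r0 bu vb.
  have h j := integral_prodf nuoo r0 nu0
    (fun k => test1_plateau (ler0n R j) (bu k) (vb k)) rT.
  have h' j := integral_prodf leboo r0 (@lebn_test_divergence b r)
    (fun k => test1_plateau (ler0n R j) (bu k) (vb k)) rT.
  have d1 : cleb * \int[nu]_x (prodf (fun k => plateau j%:R (u 0 k) (v 0 k)) x) @[j --> \oo] -->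
      cleb * fine (nu (obox u v)) by exact: cvgMl_tmp.
  have d2 : cnu * \int[lebn n]_x (prodf (fun k => plateau j%:R (u 0 k) (v 0 k)) x) @[j --> \oo] -->
      cnu * fine (lebn n (obox u v)) by exact: cvgMl_tmp.
  apply: (cvg_unique _ d1); first exact: norm_hausdorff.
  apply: cvg_trans d2; rewrite (_ : (fun j => cleb * _) = (fun j => cnu * \int[lebn n]_x (prodf (fun k => plateau j%:R (u 0 k) (v 0 k)) x)))//.
  apply/funext => j; apply: (@mulfI _ P); first by rewrite gt_eqF.
  exact: aux (h j) (h' j).
have cleb0 : 0 < cleb.
  have iH := test_integrable leboo r0 (test_prodf (ltW r0) rT).
  rewrite -lte_fin /cleb /Rintegral fineK; last exact: integrable_fin_num.
  apply: (@lt_le_trans _ _ (\int[lebn n]_x (\1_(ball b (r / 2)) x)%:E)%E).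
    rewrite integral_indic ?setIT//; last by apply: borel_open; exact: ball_open.
    rewrite [X in (_ < X)%E](lebn_ball b (divr_gt0 r0 (ltr0Sn R 1))).
    by rewrite lte_fin exprn_gt0// pmulrn_lgt0// divr_gt0.
  have H0 x : 0 <= prodf rho x by apply: prodr_ge0 => k _; exact: plateau_ge0.
  apply: ge0_le_integral => //.
  - apply/measurable_EFinP/measurable_indic.
    by apply: borel_open; exact: ball_open.
  - by apply: measurable_int iH.
  move=> x _; rewrite lee_fin indicE; case: (boolP (x \in _)) => //= xB.
  rewrite /prodf big1// => k _; move: xB; rewrite inE => -[_ /(_ 0 k)].
  rewrite -ball_normE /ball_ /= ltr_distlC => /andP[x1 x2].
  have r3 : 0 <= 3 / r by rewrite divr_ge0// ltW.
  have e1 : 1 = 3 / r * (r / 3) by field; rewrite gt_eqF.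
  by apply: plateau1; rewrite {1}e1 ler_wpM2l//; lra.
have H0 x : 0 <= prodf rho x by apply: prodr_ge0 => k _; exact: plateau_ge0.
have c0 : 0 <= cnu / cleb.
  by rewrite divr_ge0// ?(ltW cleb0)//; apply: Rintegral_ge0 => x _.
exists (cnu / cleb) => // A mA AB.
have mB : measurable (ball b r : set (borel 'rV[R]_n)) by apply: borel_open; exact: ball_open.
have nuB : (nu (ball b r) < +oo)%E.
  apply: le_lt_trans nuoo; apply: le_measure; rewrite ?inE//.
    by apply: borel_open; exact: ball_open.
  by apply: le_ball; rewrite mulr2n lerDl ltW.
have lebB : (lebn n (ball b r) < +oo)%E by exact: lebn_ball_lty.
(* Both measures are restricted to the ball; a box meets the ball, itself a box, in a smaller box to
   which [box] applies, and boxes form a generating family stable under intersection. *)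
pose m1 := mrestr nu mB; pose m2 := mscale (NngNum c0) (mrestr (lebn n) mB).
have AE : A = A `&` ball b r by apply/esym/setIidPl.
rewrite AE -[LHS]/(m1 A) -[RHS]/(m2 A).
apply: (@measure_unique _ R (borel 'rV[R]_n) _ (fun k => ball (0 : 'rV[R]_n) k.+1%:R) borel_rV_obox) => //.
- move=> _ _ [[u v] _ <-] [[u' v'] _ <-] /=; rewrite oboxI.
  by eexists (_, _).
- by move=> k; rewrite obox_ball//; eexists (_, _).
- apply/seteqP; split=> // x _; exists (Num.bound `|x|) => //.
  rewrite /= -ball_normE /ball_ /= sub0r normrN.
  by rewrite (lt_trans (archi_boundP _))// ltr_nat.
- move=> _ [[u v] _ <-] /=.
  set u' : 'rV[R]_n := \row_k Num.max (u 0 k) ((b - const_mx r) 0 k).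
  set v' : 'rV[R]_n := \row_k Num.min (v 0 k) ((b + const_mx r) 0 k).
  have E : obox u v `&` ball b r = obox u' v' by rewrite obox_ball// oboxI.
  change (nu (obox u v `&` ball b r) = ((cnu / cleb)%:E * lebn n (obox u v `&` ball b r))%E).
  rewrite !E.
  have bu k : b 0 k - r <= u' 0 k by rewrite !mxE le_max lexx orbT.
  have vb k : v' 0 k <= b 0 k + r by rewrite !mxE ge_min lexx orbT.
  have sub : obox u' v' `<=` ball b r.
    rewrite obox_ball// => x xuv k; have /andP[h1 h2] := xuv k; rewrite !mxE.
    by rewrite (le_lt_trans (bu k) h1) (lt_le_trans h2 (vb k)).
  have f1 : nu (obox u' v') \is a fin_num.
    rewrite ge0_fin_numE//; apply: le_lt_trans nuB.
    by apply: le_measure; rewrite ?inE//; exact: lebn_obox_measurable.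
  have f2 : lebn n (obox u' v') \is a fin_num.
    rewrite ge0_fin_numE//; apply: le_lt_trans lebB.
    by apply: le_measure; rewrite ?inE//; exact: lebn_obox_measurable.
  rewrite -(fineK f1) -(fineK f2) -EFinM; congr (_%:E).
  apply: (@mulfI _ cleb); first by rewrite gt_eqF.
  by rewrite box//; field; rewrite gt_eqF.
- move=> k; apply: le_lt_trans nuB; apply: le_measure; rewrite ?inE//.
  by apply: measurableI => //; apply: borel_open; exact: ball_open.
Qed.

End uniqueness.

(** Non-negativity for all [t] excludes [c < 0] and forces [b = 0] when [c = 0]; otherwise evaluate
    at the minimum [- b / c]. *)
Lemma discriminant_le (R : realFieldType) (a b c : R) :
  (forall t, 0 <= a + 2 * t * b + t ^+ 2 * c) -> b ^+ 2 <= a * c.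
Proof.
move=> H; have a0 : 0 <= a by have := H 0; lra.
have [c0|c0|c0] := ltrgtP c 0.
- exfalso; have [b0|b0] := leP 0 b.
    have := H (- (a + 1 + b) / - c - 1); rewrite leNgt => /negP; apply.
    set s := (a + 1 + b) / - c.
    have s0 : 0 <= s by rewrite divr_ge0 ?oppr_ge0 ?(ltW c0)//; lra.
    have sc : s * c = - (a + 1 + b) by rewrite /s; field; rewrite lt_eqF.
    have -> : - (a + 1 + b) / - c - 1 = - (s + 1) by rewrite /s; field; rewrite lt_eqF.
    nra.
  set s := (a + 1 - b) / - c.
  have s0 : 0 <= s by rewrite divr_ge0 ?oppr_ge0 ?(ltW c0)//; lra.
  have sc : s * c = - (a + 1 - b) by rewrite /s; field; rewrite lt_eqF.
  have := H (s + 1); nra.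
- have := H (- b / c) => h; rewrite -subr_ge0.
  have -> : a * c - b ^+ 2 = c * (a + 2 * (- b / c) * b + (- b / c) ^+ 2 * c).
    by field; rewrite gt_eqF.
  by rewrite mulr_ge0// ltW.
- have [-> |b0] := eqVneq b 0; first by rewrite c0 expr0n mulr0.
  have := H (- (a + 1) / (2 * b)); rewrite c0 mulr0 addr0.
  have -> : 2 * (- (a + 1) / (2 * b)) * b = - (a + 1) by field.
  lra.
Qed.

(** * Square-integrable functions and the Friedrichs extension *)

Section L2.
Context {d : measure_display} {T : measurableType d} {R : realType}.
Variable mu : {measure set T -> \bar R}.
Implicit Types (f g h u v w : T -> R) (c : R).

Local Notation dot := (dotL2 mu).
Local Notation L2 f := (f \in Lfun mu 2%:E).

Lemma L2_measurable f : L2 f -> measurable_fun setT f.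
Proof. by move=> /sub_Lfun_mfun; rewrite inE. Qed.

Lemma L2P f : L2 f <->
  measurable_fun setT f /\ mu.-integrable setT (EFin \o (fun x => f x ^+ 2)).
Proof.
split=> [fL|[mf fi]]; first by split; [exact: L2_measurable|exact: Lfun2_integrable_sqr].
rewrite inE; apply/andP; split; rewrite inE//= /finite_norm unlock /=.
apply: poweR_lty; have /integrableP[_] := fi; apply: le_lt_trans.
rewrite le_eqVlt; apply/orP; left; apply/eqP; apply: eq_integral => x _ /=.
by rewrite powR_mulrn// normrX.
Qed.

Lemma L2D f g : L2 f -> L2 g -> L2 (f \+ g).
Proof. by move=> fL gL; have [_] := Lfun_addr_closed mu (lee1n 2); exact. Qed.

Lemma L2Z c f : L2 f -> L2 (fun x => c * f x).
Proof.
move=> fL; rewrite (_ : (fun x => _) = c \o* f); last by apply/funext => x /=; rewrite mulrC.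
by apply: Lfun_scale => //; rewrite ler1n.
Qed.

Lemma L2B f g : L2 f -> L2 g -> L2 (f \- g).
Proof.
move=> fL gL; rewrite (_ : f \- g = f \+ (fun x => -1 * g x)).
  exact: L2D fL (L2Z (-1) gL).
by apply/funext => x /=; rewrite mulN1r.
Qed.

Lemma L2_mul_integrable f g : L2 f -> L2 g ->
  mu.-integrable setT (EFin \o (fun x => f x * g x)).
Proof. by move=> fL gL; apply/Lfun1_integrable; exact: Lfun2_mul_Lfun1. Qed.

Lemma dotC f g : dot f g = dot g f.
Proof. by apply: eq_Rintegral => x _; rewrite mulrC. Qed.

Lemma dotDl f g h : L2 f -> L2 g -> L2 h -> dot (f \+ g) h = dot f h + dot g h.
Proof.
move=> fL gL hL; rewrite /dotL2 -RintegralD//; try exact: L2_mul_integrable.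
by apply: eq_Rintegral => x _ /=; rewrite mulrDl.
Qed.

Lemma dotZl c f h : L2 f -> L2 h -> dot (fun x => c * f x) h = c * dot f h.
Proof.
move=> fL hL; rewrite /dotL2 -RintegralZl//; try exact: L2_mul_integrable.
by apply: eq_Rintegral => x _ /=; rewrite mulrA.
Qed.

Lemma dotBl f g h : L2 f -> L2 g -> L2 h -> dot (f \- g) h = dot f h - dot g h.
Proof.
move=> fL gL hL; rewrite /dotL2 -RintegralB//; try exact: L2_mul_integrable.
by apply: eq_Rintegral => x _ /=; rewrite mulrBl.
Qed.

Lemma dotDr f g h : L2 f -> L2 g -> L2 h -> dot h (f \+ g) = dot h f + dot h g.
Proof. by move=> *; rewrite dotC dotDl// !(dotC h). Qed.

Lemma dotZr c f h : L2 f -> L2 h -> dot h (fun x => c * f x) = c * dot h f.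
Proof. by move=> *; rewrite dotC dotZl// !(dotC h). Qed.

Lemma dotBr f g h : L2 f -> L2 g -> L2 h -> dot h (f \- g) = dot h f - dot h g.
Proof. by move=> *; rewrite dotC dotBl// !(dotC h). Qed.

Lemma dot_ge0 f : 0 <= dot f f.
Proof. by apply: Rintegral_ge0 => x _; rewrite -expr2 sqr_ge0. Qed.

Lemma normL2_ge0 f : 0 <= normL2 mu f. Proof. exact: sqrtr_ge0. Qed.

Lemma normL2_sqr f : normL2 mu f ^+ 2 = dot f f.
Proof. by rewrite sqr_sqrtr// dot_ge0. Qed.

Lemma cauchy_schwarz f g : L2 f -> L2 g -> `|dot f g| <= normL2 mu f * normL2 mu g.
Proof.
move=> fL gL; rewrite -(ler_pXn2r (_ : 0 < 2)%N) ?nnegrE ?mulr_ge0 ?normL2_ge0//.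
rewrite exprMn !normL2_sqr real_normK ?num_real//; apply: discriminant_le => t.
have := dot_ge0 (f \+ (fun x => t * g x)).
have tL := L2Z t gL.
by rewrite dotDl ?L2D// !dotDr// !dotZr// !dotZl// (dotC g f); congr (_ <= _); ring.
Qed.

Lemma normL2Z c f : L2 f -> normL2 mu (fun x => c * f x) = `|c| * normL2 mu f.
Proof.
move=> fL; rewrite /normL2 dotZl ?L2Z// dotZr// mulrA -expr2.
by rewrite sqrtrM ?sqr_ge0// sqrtr_sqr.
Qed.

Lemma normL2D f g : L2 f -> L2 g -> normL2 mu (f \+ g) <= normL2 mu f + normL2 mu g.
Proof.
move=> fL gL; rewrite -(ler_pXn2r (_ : 0 < 2)%N) ?nnegrE ?addr_ge0 ?normL2_ge0//.
rewrite sqrrD !normL2_sqr dotDl ?L2D// !dotDr// (dotC g f).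
have := le_trans (ler_norm _) (cauchy_schwarz fL gL); lra.
Qed.

Lemma normL2BC f g : normL2 mu (f \- g) = normL2 mu (g \- f).
Proof.
by rewrite /normL2; congr Num.sqrt; apply: eq_Rintegral => x _ /=; ring.
Qed.

Lemma normL2B f g : L2 f -> L2 g -> normL2 mu (f \- g) <= normL2 mu f + normL2 mu g.
Proof.
move=> fL gL; have := normL2D fL (L2Z (-1) gL).
rewrite normL2Z// normrN1 mul1r; congr (_ <= _); congr normL2.
by apply/funext => x /=; rewrite mulN1r.
Qed.

Lemma cvg_dot (phi : nat -> T -> R) u v : (forall k, L2 (phi k)) -> L2 u -> L2 v ->
  normL2 mu (phi k \- u) @[k --> \oo] --> (0 : R) ->
  dot v (phi k) @[k --> \oo] --> dot v u.
Proof.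
move=> pL uL vL pu; apply/cvgrPdist_le => e e0.
have v0 := normL2_ge0 v.
have e1 : 0 < e / (normL2 mu v + 1) by rewrite divr_gt0// ltr_wpDl.
have /cvgrPdist_le/(_ _ e1) := pu; apply: filterS => k.
rewrite sub0r normrN ger0_norm ?normL2_ge0// ler_pdivlMr ?ltr_wpDl// => h.
rewrite distrC -dotBr//; apply: le_trans (cauchy_schwarz vL _) _; first exact: L2B.
apply: le_trans h; rewrite mulrC ler_wpM2l ?normL2_ge0//; lra.
Qed.

Lemma cvg_normL2 (phi : nat -> T -> R) u : (forall k, L2 (phi k)) -> L2 u ->
  normL2 mu (phi k \- u) @[k --> \oo] --> (0 : R) ->
  normL2 mu (phi k) @[k --> \oo] --> normL2 mu u.
Proof.
move=> pL uL pu; apply/cvgrPdist_le => e e0.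
have /cvgrPdist_le/(_ _ e0) := pu; apply: filterS => k.
rewrite sub0r normrN ger0_norm ?normL2_ge0//; apply: le_trans.
have h1 := normL2D (L2B (pL k) uL) uL; have h2 := normL2D (L2B uL (pL k)) (pL k).
rewrite (_ : (phi k \- u) \+ u = phi k) in h1; last by apply/funext => x /=; ring.
rewrite (_ : (u \- phi k) \+ phi k = u) in h2; last by apply/funext => x /=; ring.
rewrite (normL2BC u) in h2.
by rewrite ler_norml; apply/andP; split; lra.
Qed.

Lemma cvg_dot_self (phi : nat -> T -> R) u : (forall k, L2 (phi k)) -> L2 u ->
  normL2 mu (phi k \- u) @[k --> \oo] --> (0 : R) ->
  dot (phi k) (phi k) @[k --> \oo] --> dot u u.
Proof.
move=> pL uL pu; rewrite -normL2_sqr.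
rewrite (_ : (fun k => _) = (fun k => normL2 mu (phi k) * normL2 mu (phi k))).
  by rewrite expr2; apply: cvgM; exact: cvg_normL2.
by apply/funext => k; rewrite -expr2 normL2_sqr.
Qed.

Lemma limn_einf_ge0 (a : nat -> \bar R) : (forall i, (0 <= a i)%E) -> (0 <= limn_einf a)%E.
Proof.
move=> a0; rewrite limn_einf_lim; apply: lime_ge; first exact: is_cvg_einfs.
by apply: nearW => i; apply: le_ereal_inf_tmp => _ [j _ <-].
Qed.

Lemma limn_einf_le (a : nat -> \bar R) (b : \bar R) : (forall i, (a i <= b)%E) ->
  (limn_einf a <= b)%E.
Proof.
move=> ab; apply: le_trans (limn_einf_sup _) _.
rewrite limn_esup_lim; apply: lime_le; first exact: is_cvg_esups.
by apply: nearW => i; apply: ge_ereal_sup => _ [j _ <-].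
Qed.

Lemma measurable_limn_einf (a : nat -> T -> \bar R) : (forall i, measurable_fun setT (a i)) ->
  measurable_fun setT (fun x => limn_einf (a ^~ x)).
Proof.
move=> ma; rewrite /limn_einf; apply: measurableT_comp => //.
by apply: measurable_fun_limn_esup => i; apply: measurableT_comp.
Qed.

Lemma L2_sqr_integral f : L2 f -> (\int[mu]_x ((f x) ^+ 2)%:E = (dot f f)%:E)%E.
Proof.
move=> fL; rewrite /dotL2 /Rintegral fineK.
  by apply: eq_integral => x _; rewrite expr2.
exact/integrable_fin_num/L2_mul_integrable.
Qed.

(* Riesz-Fischer for sequences with a rate; along the indices [16 ^ i] the
   increments are a.e. dominated by a geometric series. *)
Lemma L2_complete (phi : nat -> T -> R) (c : R) : (forall k, L2 (phi k)) ->
  (forall j k, dot (phi j \- phi k) (phi j \- phi k) <= c * (j.+1%:R^-1 + k.+1%:R^-1)) ->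
  exists2 u, L2 u & normL2 mu (phi k \- u) @[k --> \oo] --> (0 : R).
Proof.
move=> pL pc.
have c0 : 0 <= c.
  have := le_trans (dot_ge0 _) (pc 0 0); rewrite invr1; lra.
pose psi i := phi (16 ^ i)%N.
pose dd i := psi i.+1 \- psi i.
have dL i : L2 (dd i) by apply: L2B; exact: pL.
(* The weight [4 ^+ i] will give pointwise [|dd i x| <= C 2^-i]; after weighting, the right side
   still has the form whose sum [epsilon_trick0] bounds by [4 * c]. *)
have ddot i : 4 ^+ i * dot (dd i) (dd i) <= 4 * c / (2 ^ i.+1)%:R.
  apply: (@le_trans _ _ (4 ^+ i * (c * (2 * 16 ^- i)))).
    rewrite ler_wpM2l ?exprn_ge0//; apply: le_trans (pc _ _) _; rewrite ler_wpM2l//.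
    have h1 : (16 ^ i.+1).+1%:R^-1 <= 16 ^- i :> R.
      rewrite lef_pV2 ?posrE ?exprn_gt0// -natrX ler_nat.
      by rewrite (leq_trans _ (leqnSn _))// leq_exp2l.
    have h2 : (16 ^ i).+1%:R^-1 <= 16 ^- i :> R.
      by rewrite lef_pV2 ?posrE ?exprn_gt0// -natrX ler_nat.
    by rewrite mulr_natl mulr2n lerD.
  rewrite natrX exprS invfM.
  have -> : (16 : R) = 4 * 4 by rewrite -natrM.
  have -> : (4 : R) = 2 * 2 by rewrite -natrM.
  rewrite !exprMn !invfM.
  have e0 : (2 : R) ^+ i != 0 by rewrite expf_neq0.
  set t := (2 : R) ^- i; have t0 : 0 < t by rewrite invr_gt0 exprn_gt0.
  have t1 : t <= 1 by rewrite invf_le1 ?exprn_gt0// exprn_ege1// ler1n.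
  have e1 : 2 ^+ i * t = 1 by rewrite mulfV.
  have -> : 2 ^+ i * 2 ^+ i * (c * (2 * (t * t * (t * t)))) =
      (2 ^+ i * t) * (2 ^+ i * t) * (2 * c * (t * t)) by ring.
  rewrite e1 !mul1r; have -> : 2 * 2 * c * (2^-1 * t) = 2 * c * t by field.
  by rewrite ler_wpM2l ?mulr_ge0// -[leRHS]mul1r ler_wpM2r// ltW.
have mpsi i : measurable_fun setT (psi i) by exact: L2_measurable (pL _).
pose F x : \bar R := (\sum_(i <oo) (4 ^+ i * (dd i x) ^+ 2)%:E)%E.
have F0 i x : (0 <= (4 ^+ i * (dd i x) ^+ 2)%:E)%E.
  by rewrite lee_fin mulr_ge0 ?sqr_ge0// exprn_ge0.
have mF i : measurable_fun setT (fun x => (4 ^+ i * (dd i x) ^+ 2)%:E).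
  apply/measurable_EFinP; apply: measurable_funM => //.
  by apply: measurable_funX; exact: L2_measurable (dL _).
have iF : (\int[mu]_x F x <= (4 * c)%:E)%E.
  rewrite /F integral_nneseries//.
  apply: le_trans (epsilon_trick0 xpredT (_ : 0 <= 4 * c)); last by rewrite mulr_ge0.
  apply: lee_nneseries => i _; first by move=> _; exact: integral_ge0.
  under eq_integral do rewrite EFinM.
  rewrite ge0_integralZl_EFin ?exprn_ge0//; last 2 first.
  - by move=> x _; rewrite lee_fin sqr_ge0.
  - apply/measurable_EFinP; apply: measurable_funX; exact: L2_measurable (dL _).
  by rewrite L2_sqr_integral// -EFinM lee_fin.
have F00 x : (0 <= F x)%E by apply: nneseries_ge0.
have mFF : measurable_fun setT F by apply: ge0_emeasurable_sum.
have aeF : {ae mu, forall x, F x \is a fin_num}.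
  have : mu.-integrable setT F.
    apply/integrableP; split=> //.
    under eq_integral do rewrite gee0_abs//.
    by apply: le_lt_trans iF _; rewrite ltry.
  by move=> /(integrable_ae measurableT); apply: filterS => x; exact.
(* The upper limit is measurable everywhere and agrees with the limit almost everywhere. *)
pose u x := fine (limn_esup (fun i => (psi i x)%:E)).
have mu_ : measurable_fun setT u.
  apply: measurableT_comp; first exact: fine_measurable.
  by apply: measurable_fun_limn_esup => i; exact/measurable_EFinP.
have aeu : {ae mu, forall x, psi i x @[i --> \oo] --> u x}.
  apply: filterS aeF => x Fx.
  have [l hl] : exists l : R, psi i x @[i --> \oo] --> l.
    pose C := Num.sqrt (fine (F x)).
    have bd i : `|dd i x| <= geometric C 2^-1 i.
      have : ((4 ^+ i * (dd i x) ^+ 2)%:E <= F x)%E.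
        have := @nneseries_lim_ge _ (fun i => (4 ^+ i * (dd i x) ^+ 2)%:E) xpredT 0 i.+1 (fun i _ _ => F0 i x).
        apply: le_trans; rewrite big_nat_recr//= leeDr// sume_ge0//.
      rewrite -{1}(fineK Fx) lee_fin => h.
      rewrite -(ler_pXn2r (_ : 0 < 2)%N) ?nnegrE ?mulr_ge0 ?sqrtr_ge0 ?exprn_ge0 ?invr_ge0//.
      rewrite /= exprMn real_normK ?num_real// sqr_sqrtr ?fine_ge0//.
      have -> : (2^-1 ^+ i) ^+ 2 = 4 ^- i :> R.
        by rewrite exprVn -exprVn -exprM mulnC exprM exprVn -natrX exprVn.
      by rewrite ler_pdivlMr ?exprn_gt0// mulrC.
    have cs : cvgn (series (fun i => dd i x)).
      apply: normed_cvg; apply: (series_le_cvg _ _ bd) => [i|i|].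
      - exact: normr_ge0.
      - by rewrite /= mulr_ge0 ?sqrtr_ge0 ?exprn_ge0 ?invr_ge0.
      - by apply: is_cvg_geometric_series; rewrite ger0_norm ?invr_ge0// invf_lt1// ltr1n.
    exists (psi 0 x + limn (series (fun i => dd i x))).
    rewrite (_ : (fun i => psi i x) = (fun i => psi 0%N x + series (fun i => dd i x) i)).
      by apply: cvgD => //; exact: cvg_cst.
    have := telescopeK (fun i => psi i x); rewrite /telescope => H.
    apply/funext => i; have := congr1 (@^~ i) H => /= ->.
    by rewrite addrCA subrr addr0.
  have El : (psi i x)%:E @[i --> \oo] --> l%:E by apply: cvg_EFin => //; exact: nearW.
  have -> : u x = l.
    by rewrite /u is_cvg_limn_esupE ?(cvg_lim _ El)//; apply/cvg_ex; exists l%:E.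
  exact: hl.
(* Fatou's lemma along the subsequence. The shift to [psi (i + k)] keeps the index [16 ^ (i + k)]
   above [k], so that both reciprocals in the rate are at most [k.+1%:R^-1]. *)
have key k : (\int[mu]_x ((phi k x - u x) ^+ 2)%:E <= (2 * c * k.+1%:R^-1)%:E)%E.
  pose f i x := ((phi k x - psi (i + k)%N x) ^+ 2)%:E : \bar R.
  have mf i : measurable_fun setT (f i).
    apply/measurable_EFinP; apply: measurable_funX; apply: measurable_funB => //.
    exact: L2_measurable.
  have f0 i x : (0 <= f i x)%E by rewrite lee_fin sqr_ge0.
  have mphi : measurable_fun setT (phi k) by exact: L2_measurable (pL k).
  have h1 := @fatou _ _ R mu setT measurableT f mf (fun i x _ => f0 i x).
  apply: (@le_trans _ _ (\int[mu]_x limn_einf (f^~ x))%E).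
    apply: ae_ge0_le_integral => //.
    - by move=> x _; rewrite lee_fin sqr_ge0.
    - by apply/measurable_EFinP; apply: measurable_funX; exact: measurable_funB.
    - by move=> x _; exact: limn_einf_ge0.
    - exact: measurable_limn_einf.
    apply: filterS aeu => x hx _.
    have hf : f i x @[i --> \oo] --> ((phi k x - u x) ^+ 2)%:E.
      apply: cvg_EFin; first exact: nearW.
      rewrite expr2 (_ : fine \o _ = (fun i => (phi k x - psi (i + k)%N x) * (phi k x - psi (i + k)%N x))).
        have hh : psi (i + k)%N x @[i --> \oo] --> u x.
          by have := cvg_comp _ _ (cvg_addnr k) hx.
        by apply: cvgM; apply: cvgB => //; exact: cvg_cst.
      by apply/funext => i; rewrite /= expr2.
    by rewrite is_cvg_limn_einfE ?(cvg_lim _ hf)//; apply/cvg_ex; eexists; exact: hf.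
  apply: le_trans h1 _; apply: limn_einf_le => i.
  rewrite /f L2_sqr_integral; last by apply: L2B; exact: pL.
  rewrite lee_fin; apply: le_trans (pc _ _) _.
  rewrite -mulrA mulrCA ler_wpM2l// mulr_natl mulr2n lerD2l.
  rewrite lef_pV2 ?posrE// ler_nat ltnS ltnW//.
  by rewrite (leq_ltn_trans (leq_addl i k))// ltn_expl.
have L2u k : L2 (phi k \- u).
  have mphi : measurable_fun setT (phi k) by exact: L2_measurable (pL k).
  apply/L2P; split; first exact: measurable_funB.
  apply/integrableP; split.
    by apply/measurable_EFinP; apply: measurable_funX; exact: measurable_funB.
  under eq_integral do rewrite gee0_abs ?lee_fin ?sqr_ge0//.
  by apply: le_lt_trans (key k) _; rewrite ltry.
exists u.
  rewrite (_ : u = phi 0%N \- (phi 0%N \- u)); first exact: L2B.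
  by apply/funext => x /=; ring.
apply/cvgrPdist_le => e e0.
exists (Num.bound (2 * c / e ^+ 2)) => // k /= Nk.
rewrite sub0r normrN ger0_norm ?normL2_ge0//.
rewrite -(ler_pXn2r (_ : 0 < 2)%N) ?nnegrE ?normL2_ge0 ?(ltW e0)//.
rewrite normL2_sqr -lee_fin -L2_sqr_integral//; apply: le_trans (key k) _.
rewrite lee_fin ler_pdivrMr// -ler_pdivrMl ?exprn_gt0// [leLHS]mulrC.
have h : 2 * c / e ^+ 2 < (Num.bound (2 * c / e ^+ 2))%:R.
  by apply: archi_boundP; rewrite divr_ge0 ?exprn_ge0 ?mulr_ge0// ltW.
by rewrite (le_trans (ltW h))// ler_nat ltnW.
Qed.

End L2.

(** * Resolvent and bottom of the spectrum of a Friedrichs extension *)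

Section friedrichs.
Context {d : measure_display} {T : measurableType d} {R : realType}.
Variable mu : {measure set T -> \bar R}.
Variables (D : set (T -> R)) (S : (T -> R) -> (T -> R)).
Implicit Types (f g h u v w : T -> R) (c : R).

Local Notation dot := (dotL2 mu).
Local Notation L2 f := (f \in Lfun mu 2%:E).

Hypothesis D0 : D (cst 0).
Hypothesis DD : forall f g, D f -> D g -> D (f \+ g).
Hypothesis DZ : forall c f, D f -> D (fun x => c * f x).
Hypothesis DL : forall f, D f -> L2 f.
Hypothesis SL : forall f, D f -> L2 (S f).
Hypothesis SD : forall f g, D f -> D g -> S (f \+ g) = S f \+ S g.
Hypothesis SZ : forall c f, D f -> S (fun x => c * f x) = (fun x => c * S f x).
Hypothesis Ssym : forall f g, D f -> D g -> dot (S f) g = dot f (S g).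

Definition form_ge c : Prop := forall f, D f -> c * dot f f <= dot (S f) f.

Definition qform l f g : R := dot (S f) g - l * dot f g.

Local Notation q := qform.

Lemma qformC l f g : D f -> D g -> q l f g = q l g f.
Proof. by move=> Df Dg; rewrite /q Ssym// (dotC _ f g) (dotC _ f (S g)). Qed.

Lemma qformDl l f g h : D f -> D g -> D h -> q l (f \+ g) h = q l f h + q l g h.
Proof.
move=> Df Dg Dh; have [fL gL hL] := And3 (DL Df) (DL Dg) (DL Dh).
have [sf sg] := conj (SL Df) (SL Dg).
by rewrite /q SD// !dotDl//; ring.
Qed.

Lemma qformZl l c f h : D f -> D h -> q l (fun x => c * f x) h = c * q l f h.
Proof.
move=> Df Dh; have [fL hL] := conj (DL Df) (DL Dh); have sf := SL Df.
by rewrite /q SZ// !dotZl//; ring.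
Qed.

Lemma qformDr l f g h : D f -> D g -> D h -> q l h (f \+ g) = q l h f + q l h g.
Proof.
move=> Df Dg Dh; rewrite qformC// ?qformDl//; last exact: DD.
by rewrite !(@qformC _ h).
Qed.

Lemma qformZr l c f h : D f -> D h -> q l h (fun x => c * f x) = c * q l h f.
Proof.
move=> Df Dh; rewrite qformC// ?qformZl//; last exact: DZ.
by rewrite (@qformC _ h).
Qed.

Lemma DB f g : D f -> D g -> D (f \- g).
Proof.
move=> Df Dg; rewrite (_ : f \- g = f \+ (fun x => -1 * g x)).
  by apply: DD => //; exact: DZ.
by apply/funext => x /=; rewrite mulN1r.
Qed.

Lemma qform_addZ l f g t : D f -> D g ->
  q l (f \+ (fun x => t * g x)) (f \+ (fun x => t * g x)) =
  q l f f + 2 * t * q l f g + t ^+ 2 * q l g g.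
Proof.
move=> Df Dg; have Dt := DZ t Dg; have Ds := DD Df Dt.
by rewrite qformDl// !qformDr// !qformZl// !qformZr// (@qformC l g f)//; ring.
Qed.

Lemma qform_sub l f g : D f -> D g ->
  q l (f \- g) (f \- g) = q l f f - 2 * q l f g + q l g g.
Proof.
move=> Df Dg; rewrite (_ : f \- g = f \+ (fun x => -1 * g x)).
  by rewrite qform_addZ//; ring.
by apply/funext => x /=; rewrite mulN1r.
Qed.

Lemma cvg_qform l (phi : nat -> T -> R) u f : (forall k, D (phi k)) -> L2 u -> D f ->
  normL2 mu (phi k \- u) @[k --> \oo] --> (0 : R) ->
  q l (phi k) f @[k --> \oo] --> dot u (S f) - l * dot u f.
Proof.
move=> pD uL Df pu.
have pL k := DL (pD k).
have h1 := cvg_dot pL uL (SL Df) pu; have h2 := cvg_dot pL uL (DL Df) pu.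
rewrite (_ : (fun k => _) = (fun k => dot (S f) (phi k) - l * dot f (phi k))); last first.
  by apply/funext => k; rewrite /q Ssym// dotC (dotC _ f).
rewrite (dotC _ u) (dotC _ u f); apply: cvgB => //.
exact: cvgMl_tmp.
Qed.

(* The polarised estimate [<u, (S - l) phi_k>] tends to at least [delta |u|^2]. *)
Lemma friedrichs_bound lam l u w : form_ge lam -> l < lam ->
  friedrichs mu D S u w -> normL2 mu u <= (lam - l)^-1 * normL2 mu (w \- (l \*o u)).
Proof.
move=> qlam llam [[uL [phi [pD pu pC]]] wL uw].
have dl : 0 < lam - l by rewrite subr_gt0.
have luL : L2 (l \*o u) by exact: L2Z.
have vL := L2B wL luL; set v := w \- _ in vL *.
have luf f : L2 f -> dot (l \*o u) f = l * dot u f by move=> fL; exact: dotZl.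
have uv f : D f -> dot u (S f) - l * dot u f = dot v f.
  by move=> Df; have fL := DL Df; rewrite uw// /v dotBl// luf.
have pL k := DL (pD k).
have pp := cvg_dot_self pL uL pu.
have key : (lam - l) * dot u u <= dot v u.
  apply/ler_addgt0Pr => e e0.
  have e2 : 0 < e / 2 by rewrite divr_gt0.
  (* Half of [e] is spent on the form of [S], the other half on [l] times the squared distance,
     hence the division by [|l| + 1]; its square root appears below because [pu] controls the
     norm. *)
  have e4 : 0 < e / 2 / (`|l| + 1) by rewrite divr_gt0// ltr_wpDl.
  have [N NP] := pC _ e2.
  have pu1 : exists N1, forall j, (N1 <= j)%N -> normL2 mu (phi j \- u) <= Num.sqrt (e / 2 / (`|l| + 1)) / 2.
    have h : 0 < Num.sqrt (e / 2 / (`|l| + 1)) / 2 by rewrite divr_gt0// sqrtr_gt0.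
    have /cvgrPdist_le/(_ _ h)[N1 _ N1P] := pu; exists N1 => j /N1P.
    by rewrite sub0r normrN ger0_norm ?normL2_ge0.
  have [N1 N1P] := pu1.
  have qjk j k : (maxn N N1 <= j)%N -> (maxn N N1 <= k)%N ->
      q l (phi j \- phi k) (phi j \- phi k) <= e.
    rewrite !geq_max => /andP[Nj N1j] /andP[Nk N1k].
    have h1 := le_trans (ler_norm _) (ltW (NP _ _ Nj Nk)).
    have h2 : normL2 mu (phi j \- phi k) <= Num.sqrt (e / 2 / (`|l| + 1)).
      have := normL2B (L2B (pL j) uL) (L2B (pL k) uL).
      rewrite (_ : _ \- _ = phi j \- phi k); last by apply/funext => x /=; ring.
      have := N1P _ N1j; have := N1P _ N1k; lra.
    have h3 : dot (phi j \- phi k) (phi j \- phi k) <= e / 2 / (`|l| + 1).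
      rewrite -normL2_sqr -[leRHS]sqr_sqrtr ?(ltW e4)//.
      by rewrite ler_pXn2r// nnegrE ?normL2_ge0 ?sqrtr_ge0.
    rewrite ler_pdivlMr ?ltr_wpDl// in h3.
    have h4 := dot_ge0 mu (phi j \- phi k).
    have h5 : - l <= `|l| by rewrite -normrN ler_norm.
    by rewrite /q; nra.
  (* Expand [q l (phi j \- phi k) (phi j \- phi k) <= e] and bound the two diagonal terms below by
     [lam - l]. Only the mixed term is left, and it has a limit as [j] grows, with [k] following. *)
  have step k : (maxn N N1 <= k)%N ->
      (lam - l) * dot u u + (lam - l) * dot (phi k) (phi k) - e <= 2 * dot v (phi k).
    move=> Nk.
    have c1 : (lam - l) * dot (phi j) (phi j) + (lam - l) * dot (phi k) (phi k) - e
        @[j --> \oo] --> (lam - l) * dot u u + (lam - l) * dot (phi k) (phi k) - e.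
      apply: cvgB; last exact: cvg_cst.
      by apply: cvgD; [exact: cvgMl_tmp|exact: cvg_cst].
    have c2 : 2 * q l (phi j) (phi k) @[j --> \oo] --> 2 * dot v (phi k).
      by rewrite -uv//; apply: cvgMl_tmp; exact: cvg_qform.
    apply: (ler_cvg_to c1 c2); exists (maxn N N1) => // j /= Nj.
    have := qjk _ _ Nj Nk; rewrite qform_sub//.
    have := qlam _ (pD j); have := qlam _ (pD k).
    rewrite /q; lra.
  have c1 : (lam - l) * dot u u + (lam - l) * dot (phi k) (phi k) - e
      @[k --> \oo] --> (lam - l) * dot u u + (lam - l) * dot u u - e.
    apply: cvgB; last exact: cvg_cst.
    by apply: cvgD; [exact: cvg_cst|exact: cvgMl_tmp].
  have c2 : 2 * dot v (phi k) @[k --> \oo] --> 2 * dot v u.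
    by apply: cvgMl_tmp; exact: cvg_dot.
  have : (lam - l) * dot u u + (lam - l) * dot u u - e <= 2 * dot v u.
    by apply: (ler_cvg_to c1 c2); exists (maxn N N1) => // j; exact: step.
  lra.
have [u0|u0] := eqVneq (normL2 mu u) 0.
  by rewrite u0 mulr_ge0 ?normL2_ge0// invr_ge0 ltW.
have u1 : 0 < normL2 mu u by rewrite lt_neqAle eq_sym u0 normL2_ge0.
rewrite ler_pdivlMl// -(ler_pM2r u1) -mulrA -expr2 normL2_sqr.
by apply: le_trans key _; apply: le_trans (ler_norm _) _; exact: cauchy_schwarz.
Qed.

(* Minimising [q f f - 2 <v, f>]; the parallelogram identity makes minimising
   sequences Cauchy for the form norm. *)
Lemma friedrichs_solve lam l v : form_ge lam -> l < lam -> L2 v ->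
  exists2 u, friedrichs mu D S u (v \+ (l \*o u)) &
    forall f, D f -> dot v f ^+ 2 <= q l f f * (2 * dot v u).
Proof.
move=> qlam llam vL.
have dl : 0 < lam - l by rewrite subr_gt0.
set dlt := lam - l in dl.
have q_ge f : D f -> dlt * dot f f <= q l f f.
  by move=> Df; have := qlam _ Df; rewrite /q /dlt mulrBl; lra.
have q_ge0 f : D f -> 0 <= q l f f.
  by move=> Df; apply: le_trans (q_ge _ Df); rewrite mulr_ge0 ?dot_ge0// ltW.
pose J f := q l f f - 2 * dot v f.
(* Completing the square in [|v - dlt f|^2 >= 0]. *)
have Jlb f : D f -> - (dot v v / dlt) <= J f.
  move=> Df; have fL := DL Df; have := dot_ge0 mu (v \- (fun x => dlt * f x)).
  have tL := L2Z dlt fL.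
  rewrite dotBl ?L2B// !dotBr// !dotZr// !dotZl// (dotC _ f v).
  have := q_ge _ Df; rewrite /J => h1 h2.
  rewrite lerNl -subr_ge0.
  have -> : dot v v / dlt - - (q l f f - 2 * dot v f) =
     (dot v v - dlt * dot v f - (dlt * dot v f - dlt * (dlt * dot f f))) / dlt
       + (q l f f - dlt * dot f f) by field; rewrite gt_eqF.
  by rewrite addr_ge0 ?divr_ge0// ?(ltW dl)// subr_ge0.
pose E := J @` D.
have Einf : has_inf E.
  split; first by exists (J (cst 0)); exists (cst 0).
  by exists (- (dot v v / dlt)) => _ [f Df <-]; exact: Jlb.
set m := inf E.
have mJ f : D f -> m <= J f.
  by move=> Df; apply: ge_inf; [case: Einf|exists f].
(* A minimising sequence with the rate that [L2_complete] expects. *)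
have [phi pP] : {phi : nat -> T -> R & forall k, D (phi k) /\ J (phi k) < m + k.+1%:R^-1}.
  apply: (@choice _ _ (fun k f => D f /\ J f < m + k.+1%:R^-1)) => k.
  have k0 : 0 < k.+1%:R^-1 :> R by rewrite invr_gt0.
  by have [_ [f Df <-] h] := inf_adherent k0 Einf; exists f.
have pD k : D (phi k) by case: (pP k).
have pL k := DL (pD k).
have pJ k : J (phi k) <= m + k.+1%:R^-1 by case: (pP k) => _ /ltW.
have par j k : q l (phi j \- phi k) (phi j \- phi k) <= 2 * (j.+1%:R^-1 + k.+1%:R^-1).
  (* The factor 1 puts the sum in the shape of [qform_addZ]; the estimate comes from
     [m <= J mid]. *)
  pose sum := phi j \+ (fun x => 1 * phi k x); pose mid x := 2^-1 * sum x.
  have Dk := DZ 1 (pD k); have Ds : D sum by exact: DD.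
  have [Lk Ls] := conj (DL Dk) (DL Ds); have Dm : D mid by exact: DZ.
  have E1 : q l mid mid = 2^-1 * (2^-1 * (q l (phi j) (phi j) + 2 * q l (phi j) (phi k) + q l (phi k) (phi k))).
    by rewrite qformZl// qformZr// qform_addZ// mulr1 expr1n mul1r.
  have E2 : dot v mid = 2^-1 * (dot v (phi j) + dot v (phi k)).
    by rewrite dotZr// dotDr// dotZr// mul1r.
  have := mJ _ Dm; have := pJ j; have := pJ k; rewrite /J E1 E2 qform_sub//.
  set x := j.+1%:R^-1; set y := k.+1%:R^-1; lra.
have [u uL pu] : exists2 u, L2 u & normL2 mu (phi k \- u) @[k --> \oo] --> (0 : R).
  apply: (@L2_complete _ _ _ mu phi (2 / dlt) pL) => j k.
  rewrite -mulrA mulrCA ler_pdivlMl//.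
  by apply: le_trans (par j k); apply: q_ge; exact: DB.
have half e : 0 < e -> exists N, forall j, (N <= j)%N -> j.+1%:R^-1 <= e :> R.
  move=> e0; exists (Num.bound e^-1) => j Nj.
  rewrite -[leRHS]invrK lef_pV2 ?posrE ?invr_gt0//.
  have h : e^-1 < (Num.bound e^-1)%:R by apply: archi_boundP; rewrite invr_ge0 ltW.
  by rewrite (le_trans (ltW h))// ler_nat ltnW.
(* The Euler-Lagrange equation. As [phi k] is minimal up to [k.+1%:R^-1], the quadratic polynomial
   [J (phi k + t f) - J (phi k) + k.+1%:R^-1] is non-negative in [t]; its discriminant bounds the
   defect at [phi k] by [k.+1%:R^-1 * q l f f]. *)
have eulag f : D f -> dot u (S f) - l * dot u f = dot v f.
  move=> Df; apply/eqP; rewrite -subr_eq0; apply/eqP.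
  have c1 : (q l (phi k) f - dot v f) @[k --> \oo] --> dot u (S f) - l * dot u f - dot v f.
    by apply: cvgB; [exact: cvg_qform|exact: cvg_cst].
  apply: (cvg_unique _ c1); first exact: norm_hausdorff.
  apply/cvgrPdist_le => e e0.
  have qf0 := q_ge0 _ Df.
  have e1 : 0 < e ^+ 2 / (q l f f + 1) by rewrite divr_gt0 ?exprn_gt0// ltr_wpDl.
  have [N NP] := half _ e1; exists N => // k /= /NP Nk.
  rewrite sub0r normrN -(ler_pXn2r (_ : 0 < 2)%N) ?nnegrE ?(ltW e0)// real_normK ?num_real//.
  apply: (@le_trans _ _ (k.+1%:R^-1 * q l f f)).
    apply: discriminant_le => t.
    have Dt := DZ t Df.
    have := mJ _ (DD (pD k) Dt); have := pJ k; have [tL fL] := conj (DL Dt) (DL Df); rewrite /J qform_addZ// dotDr// (@dotZr _ _ _ mu t)//.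
    set a := _%:R^-1; nra.
  rewrite ler_pdivlMr ?ltr_wpDl// in Nk; apply: le_trans Nk.
  by rewrite ler_wpM2l ?invr_ge0// lerDl.
(* Dropping the non-negative term [q] from [J (phi k)] loses a factor of 2 at most, which is
   harmless in what follows. *)
have vu : - m <= 2 * dot v u.
  have c1 : 2 * dot v (phi k) @[k --> \oo] --> 2 * dot v u.
    by apply: cvgMl_tmp; exact: cvg_dot.
  apply/ler_addgt0Pr => e e0; have [N NP] := half _ e0.
  have c2 : 2 * dot v (phi k) + e @[k --> \oo] --> 2 * dot v u + e.
    by apply: cvgD => //; exact: cvg_cst.
  apply: (ler_cvg_to (cvg_cst (- m)) c2); exists N => // k /= /NP Nk.
  have := le_trans (pJ k) (_ : m + k.+1%:R^-1 <= m + e); rewrite lerD2l => /(_ Nk).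
  have := q_ge0 _ (pD k); rewrite /J; lra.
exists u.
  have luL : L2 (l \*o u) by exact: L2Z.
  have luf f : L2 f -> dot (l \*o u) f = l * dot u f by move=> fL; exact: dotZl.
  split=> [||f Df]; last first.
  - by have fL := DL Df; rewrite dotDl// luf// -(eulag _ Df) subrK.
  - exact: L2D vL luL.
  - split=> //; exists phi; split=> // e e0.
    have l1 : 0 < (1 + `|l| / dlt) * 4 by rewrite mulr_gt0// ltr_pwDl// divr_ge0// ltW.
    have e1 : 0 < e / 2 / ((1 + `|l| / dlt) * 4) by rewrite !divr_gt0.
    have [N NP] := half _ e1; exists N => j k /NP hj /NP hk.
    have Djk := DB (pD j) (pD k).
    have h1 := par j k; have h2 := q_ge _ Djk; have h3 := dot_ge0 mu (phi j \- phi k).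
    set X := dot (phi j \- phi k) (phi j \- phi k) in h2 h3.
    have -> : dot (S (phi j \- phi k)) (phi j \- phi k) = q l (phi j \- phi k) (phi j \- phi k) + l * X.
      by rewrite /q -/X; ring.
    set Q := q _ _ _ in h1 h2 *.
    apply: le_lt_trans (ler_normD _ _) _; rewrite normrM (ger0_norm h3).
    have Q0 : 0 <= Q by exact: q_ge0.
    rewrite (ger0_norm Q0).
    have XQ : X <= Q / dlt by rewrite ler_pdivlMr// mulrC.
    have : Q + `|l| * X <= (1 + `|l| / dlt) * Q.
      rewrite mulrDl mul1r lerD2l -mulrA [dlt^-1 * _]mulrC.
      by rewrite ler_wpM2l.
    move=> /le_lt_trans; apply.
    rewrite ler_pdivlMr// in hj; rewrite ler_pdivlMr// in hk.
    have h4 : (1 + `|l| / dlt) * Q <= (1 + `|l| / dlt) * (2 * (j.+1%:R^-1 + k.+1%:R^-1)).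
      by rewrite ler_wpM2l// addr_ge0// divr_ge0// ltW.
    apply: le_lt_trans h4 _; move: hj hk.
    set A := 1 + _; set x := j.+1%:R^-1; set y := k.+1%:R^-1 => hj hk.
    have -> : A * (2 * (x + y)) = (x * (A * 4) + y * (A * 4)) / 2 by field.
    by rewrite ltr_pdivrMr//; lra.
move=> f Df.
(* Since [J (t f) >= m >= - 2 <v, u>], the polynomial [2 <v, u> - 2 t <v, f> + t^2 q l f f] is
   non-negative for all [t]. *)
have := @discriminant_le R (2 * dot v u) (- dot v f) (q l f f).
rewrite sqrrN [X in _ <= X]mulrC; apply => t.
have := mJ _ (DZ t Df); rewrite /J qformZl ?qformZr//; last exact: DZ.
rewrite dotZr//; last exact: DL.
nra.
Qed.

Lemma form_ge_resolvent lam l : form_ge lam -> l < lam ->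
  resolvent_set mu (friedrichs mu D S) l.
Proof.
move=> qlam llam; split; first by exists (lam - l)^-1 => u w; exact: friedrichs_bound.
by move=> v vL; have [u uv _] := friedrichs_solve qlam llam vL; exists u.
Qed.

(** Suppose the inverse at [lam] is bounded by [C]. Solve [(S - (lam - e)) u = f] for a test
    function [f]; the bound gives [|u| <= 2 C |f|]. The second conclusion of [friedrichs_solve] with
    [v = f] then yields [q (lam - e) f f >= |f|^2 / (4 C) = 2 e |f|^2], that is, the form bound
    [lam + e]. *)
Lemma form_bottom_spectrum lam : form_ge lam -> (forall l, lam < l -> ~ form_ge l) ->
  spectrum mu (friedrichs mu D S) lam.
Proof.
move=> qlam nlam [[C0 CP] _].
pose C := Num.max C0 1.
have C1 : 1 <= C by rewrite le_max lexx orbT.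
have Cp : 0 < C by rewrite (lt_le_trans ltr01).
have {}CP u w : friedrichs mu D S u w -> normL2 mu u <= C * normL2 mu (w \- (lam \*o u)).
  move=> /CP h; apply: le_trans h _; rewrite ler_wpM2r ?normL2_ge0//.
  by rewrite le_max lexx.
(* Small enough to absorb [C e |u|], and such that [(4 * C)^-1 = 2 * e], which exceeds by [e] the
   amount lost in passing to [lam - e]. *)
pose e := (8 * C)^-1.
have e0 : 0 < e by rewrite invr_gt0 mulr_gt0.
have eC : e * C = 8^-1 by rewrite /e; field; rewrite gt_eqF.
have ltl : lam < lam + e by rewrite ltrDl.
apply: (nlam _ ltl) => f Df.
have llam : lam - e < lam by rewrite ltrBlDr.
have fL := DL Df.
have [u ufr uq] := friedrichs_solve qlam llam fL.
have uL : L2 u by case: ufr => [] [].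
have h1 := CP _ _ ufr.
have h2 : normL2 mu u <= 2 * C * normL2 mu f.
  have : normL2 mu ((f \+ ((lam - e) \*o u)) \- (lam \*o u)) <= normL2 mu f + e * normL2 mu u.
    rewrite (_ : _ \- _ = f \- (fun x => e * u x)); last by apply/funext => x /=; ring.
    by have := normL2B fL (L2Z e uL); rewrite normL2Z// ger0_norm// ltW.
  rewrite -(ler_pM2l Cp) => /(le_trans h1); rewrite mulrDr mulrA [C * e]mulrC eC.
  have := normL2_ge0 mu u; lra.
have h3 : dot f u <= 2 * C * dot f f.
  apply: le_trans (le_trans (ler_norm _) (cauchy_schwarz fL uL)) _.
  rewrite -normL2_sqr expr2 mulrCA ler_wpM2l ?normL2_ge0//.
have h4 := uq _ Df.
have ff := dot_ge0 mu f.
have [f0|f0] := eqVneq (dot f f) 0.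
  by have := qlam _ Df; rewrite f0 !mulr0.
have fp : 0 < dot f f by rewrite lt_neqAle eq_sym f0.
have q0 : 0 <= q (lam - e) f f.
  have := qlam _ Df; rewrite /q mulrBl.
  have : 0 <= e * dot f f by rewrite mulr_ge0// ltW.
  lra.
have h5 : dot f f <= q (lam - e) f f * (4 * C).
  rewrite -(ler_pM2r fp) -expr2; apply: le_trans h4 _.
  rewrite -[leRHS]mulrA ler_wpM2l//; lra.
have : dot f f * (2 * e) <= q (lam - e) f f.
  have -> : q (lam - e) f f = q (lam - e) f f * (4 * C) * (2 * e).
    have -> : q (lam - e) f f * (4 * C) * (2 * e) = q (lam - e) f f * (8 * (e * C)) by ring.
    by rewrite eC mulfV// mulr1.
  by rewrite ler_wpM2r// mulr_ge0// ltW.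
rewrite /q; lra.
Qed.

(** The supremum of the form bounds is itself a form bound, so it lies in the spectrum by
    [form_bottom_spectrum], and it is at most [l]. *)
Lemma ereal_inf_spectrum_le l : bounded_below mu D S -> (forall lam, l < lam -> ~ form_ge lam) ->
  (ereal_inf (EFin @` spectrum mu (friedrichs mu D S)) <= l%:E)%E.
Proof.
move=> [c cP] nl.
pose E := [set lam | form_ge lam].
have ub : ubound E l by move=> lam /= h; rewrite leNgt; apply/negP => /nl; exact.
have Esup : has_sup E by split; [exists c|exists l].
have supE : form_ge (sup E).
  move=> f Df; have [f0|f0] := eqVneq (dot f f) 0.
    by have := cP _ Df; rewrite f0 !mulr0.
  have fp : 0 < dot f f by rewrite lt_neqAle eq_sym f0 dot_ge0.
  rewrite -ler_pdivlMr//; apply: ge_sup; first by exists c.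
  by move=> lam /(_ _ Df); rewrite ler_pdivlMr.
apply: (@le_trans _ _ (sup E)%:E).
  apply: ereal_inf_lbound; exists (sup E) => //; apply: form_bottom_spectrum => //.
  move=> lam lt_lam h; have := ub_le_sup (_ : has_ubound E) h.
  by rewrite leNgt lt_lam => /(_ (ex_intro _ l ub)).
by rewrite lee_fin; apply: ge_sup => //; exists c.
Qed.

End friedrichs.

(** * Change of variables *)

Section density_pushforward.
Context {d d' : measure_display} {T : measurableType d} {U : measurableType d'} {R : realType}.
Variables (mu : {measure set T -> \bar R}) (w : T -> R) (phi : T -> U).
Hypotheses (mw : measurable_fun setT w) (w0 : forall x, 0 <= w x).
Hypothesis mphi : measurable_fun setT phi.

(** The image under [phi] of the measure with density [w]. The proofs are arguments so that the
    measure structure can be inferred from the term. *)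
Definition dpush (_ : measurable_fun setT w) (_ : forall x, 0 <= w x)
  (_ : measurable_fun setT phi) (A : set U) : \bar R :=
  (\int[mu]_(x in phi @^-1` A) (w x)%:E)%E.

Local Notation md := (dpush mw w0 mphi).

Let mpre A : measurable A -> measurable (phi @^-1` A).
Proof. by move=> mA; rewrite -[X in measurable X]setTI; exact: mphi. Qed.

Let dpush0 : md set0 = 0%E. Proof. by rewrite /dpush preimage_set0 integral_set0. Qed.

Let dpush_ge0 A : (0 <= md A)%E.
Proof. by apply: integral_ge0 => x _; rewrite lee_fin. Qed.

Let dpush_sigma_additive : semi_sigma_additive md.
Proof.
move=> F mF tF mUF; rewrite /dpush preimage_bigcup ge0_integral_bigcup//; last 4 first.
- by move=> k; exact: mpre.
- by apply/measurable_EFinP; exact: measurable_funTS.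
- by move=> x _; rewrite lee_fin.
- by move=> i j _ _ [x [Fi Fj]]; apply: tF => //; exists (phi x).
by apply: is_cvg_nneseries => i _ _; apply: integral_ge0 => x _; rewrite lee_fin.
Qed.

HB.instance Definition _ := isMeasure.Build _ _ _ md
  dpush0 dpush_ge0 dpush_sigma_additive.

Import HBNNSimple.

(** True for indicators by definition of [dpush], then for simple functions, then by monotone
    convergence on both sides. *)
Lemma ge0_integral_dpush (f : U -> \bar R) : measurable_fun setT f ->
  (forall x, 0 <= f x)%E ->
  (\int[md]_x f x = \int[mu]_x (f (phi x) * (w x)%:E))%E.
Proof.
move=> mf f0; pose f_ := nnsfun_approx measurableT mf.
have mfi n : measurable_fun setT (f_ n) by exact/measurable_funP.
have mfp n : measurable_fun setT (fun x => f_ n (phi x)) by exact: measurableT_comp.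
transitivity (limn (fun n => \int[md]_x (f_ n x)%:E))%E.
  rewrite -monotone_convergence//.
  - apply: eq_integral => y _; apply/esym/cvg_lim => //.
    by apply: cvg_nnsfun_approx.
  - by move=> n; exact/measurable_EFinP.
  - by move=> n y _; rewrite lee_fin.
  - by move=> y _ m n mn; rewrite lee_fin; exact/lefP/nd_nnsfun_approx.
rewrite (_ : (fun n => _) = (fun n => \int[mu]_x ((f_ n (phi x))%:E * (w x)%:E)))%E.
  rewrite -monotone_convergence//; last 3 first.
  - move=> n; apply: emeasurable_funM; first exact/measurable_EFinP.
    exact/measurable_EFinP.
  - by move=> n x _; rewrite mule_ge0// lee_fin.
  - move=> x _ m n mn; rewrite lee_wpmul2r ?lee_fin//.
    exact/lefP/nd_nnsfun_approx.
  apply: eq_integral => x _ /=; apply/cvg_lim => //.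
  apply: cvgeZr => //; exact: cvg_nnsfun_approx.
apply/funext => n.
have mi k : measurable_fun setT (fun x => \1_(f_ n @^-1` [set k]) (phi x) : R).
  rewrite (_ : (fun x => _) = (\1_(f_ n @^-1` [set k]) : U -> R) \o phi)//.
  by apply: measurableT_comp => //; exact: measurable_indic.
transitivity (\sum_(k \in range (f_ n)) \int[md]_x (k * \1_(f_ n @^-1` [set k]) x)%:E)%E.
  under eq_integral do rewrite fimfunE -fsumEFin//.
  rewrite ge0_integral_fsum//.
  - by move=> y; exact/measurable_EFinP/measurable_funM.
  - by move=> y x _; rewrite nnfun_muleindic_ge0.
transitivity (\sum_(k \in range (f_ n)) \int[mu]_x ((k * \1_(f_ n @^-1` [set k]) (phi x))%:E * (w x)%:E))%E.
  apply: eq_fsbigr => r; rewrite inE => -[x _ <-].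
  have r0 : 0 <= f_ n x by [].
  under [LHS]eq_integral do rewrite EFinM.
  rewrite ge0_integralZl_EFin//; last by apply/measurable_EFinP; exact: measurable_indic.
  under [RHS]eq_integral do rewrite EFinM -muleA.
  rewrite [RHS]ge0_integralZl_EFin//; last 2 first.
  - by move=> y _; rewrite mule_ge0 ?lee_fin.
  - by apply: emeasurable_funM; exact/measurable_EFinP.
  congr (_ * _)%E; rewrite integral_indic// setIT.
  change ((\int[mu]_(y in phi @^-1` (f_ n @^-1` [set f_ n x])) (w y)%:E) =
    \int[mu]_y ((\1_(f_ n @^-1` [set f_ n x]) (phi y))%:E * (w y)%:E))%E.
  rewrite [LHS]integral_mkcond; apply: eq_integral => y _.
  rewrite patchE indicE.
  rewrite (_ : (phi y \in _) = (y \in phi @^-1` (f_ n @^-1` [set f_ n x]))); last first.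
    by apply/idP/idP; rewrite !inE.
  case: ifP => _; first by rewrite mul1e.
  by rewrite mul0e.
rewrite -ge0_integral_fsum//.
- apply: eq_integral => x _; rewrite [in RHS]fimfunE -fsumEFin// ge0_mule_fsuml//.
  by move=> i; rewrite nnfun_muleindic_ge0.
- move=> r; apply: emeasurable_funM; last exact/measurable_EFinP.
  exact/measurable_EFinP/measurable_funM.
- by move=> r x _; rewrite mule_ge0 ?nnfun_muleindic_ge0 ?lee_fin.
Qed.

Lemma integral_dpush (f : U -> \bar R) : measurable_fun setT f ->
  (\int[md]_x f x = \int[mu]_x (f (phi x) * (w x)%:E))%E.
Proof.
move=> mf; rewrite [LHS]integralE [RHS]integralE.
rewrite !ge0_integral_dpush//; try exact: measurable_funepos; try exact: measurable_funeneg.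
congr (_ - _)%E; apply: eq_integral => x _; have wx : (0 <= (w x)%:E)%E by rewrite lee_fin.
  rewrite !funeposE; have [fx|fx] := leP 0%E (f (phi x)).
    by rewrite !max_l// mule_ge0.
  by rewrite !max_r ?mul0e ?(ltW fx)// mule_le0_ge0// ltW.
rewrite !funenegE; have [fx|fx] := leP 0%E (f (phi x)).
  by rewrite !max_r ?mul0e ?oppe_le0// mule_ge0.
by rewrite !max_l ?muleN ?oppe_ge0 ?mulNe// ?(ltW fx)// mule_le0_ge0// ltW.
Qed.

Lemma density_pushforward : exists nu : {measure set U -> \bar R},
  (forall A, nu A = \int[mu]_(x in phi @^-1` A) (w x)%:E)%E /\
  forall f : U -> \bar R, measurable_fun setT f ->
    (\int[nu]_x f x = \int[mu]_x (f (phi x) * (w x)%:E))%E.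
Proof. by exists md; split=> [//|f mf]; exact: integral_dpush. Qed.

End density_pushforward.

(** Also covers [+oo - +oo], which is [-oo] by convention, and [c = 0]; so integrals of functions
    that need not be integrable can be scaled. *)
Lemma ge0_muleBr (R : realDomainType) (c : R) (x y : \bar R) : 0 <= c -> (0 <= x)%E -> (0 <= y)%E ->
  (c%:E * x - c%:E * y = c%:E * (x - y))%E.
Proof.
rewrite le_eqVlt => /predU1P[<-|c0]; first by rewrite !mul0e sube0.
have c0' : (0 < c%:E)%E by rewrite lte_fin.
move: x y => [x| |] [y| |]//= _ _; rewrite -?EFinM -?EFinB ?gt0_muley//=.
- by rewrite mulrBr.
- by rewrite gt0_muleNy.
by rewrite (_ : (+oo - +oo)%E = -oo%E) ?gt0_muleNy.
Qed.

(** * Extension by zero and change of variables up to a constant *)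

Section extension.
Context {R : realType} {n : nat}.
Implicit Types (A B K : set 'rV[R]_n).

Lemma smooth_ext0 B K (G G0 : 'rV[R]_n -> R) : open B -> compact K -> K `<=` B ->
  smooth_on B G0 -> (forall z, B z -> G z = G0 z) -> (forall z, ~ K z -> G z = 0) ->
  smooth_on setT G /\ bounded_support G.
Proof.
move=> oB cK KB sG GG0 G0K; split.
  apply: smooth_on_local => z _; have [Bz|Bz] := pselect (B z).
    by exists B => //; apply: smooth_on_eq sG => // y /GG0.
  have Kz : ~ K z by move=> /KB.
  exists (~` K) => //; apply: (@smooth_on_eq _ _ _ (cst 0)).
  - by apply: closed_openC; apply: compact_closed => //; exact: norm_hausdorff.
  - by move=> y /G0K.
  - exact: smooth_on_cst.
have [M [_ MP]] := compact_bounded cK; exists (M + 1) => x Mx.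
apply: G0K => Kx; have := MP (M + 1) _ x Kx; rewrite ltrDl ltr01 => /(_ isT) /=.
by rewrite leNgt Mx.
Qed.

(** Applied to a Jacobian determinant: its absolute value is locally a constant sign times a smooth
    function, so it can be differentiated. *)
Lemma sg_near B (f : 'rV[R]_n -> R) z : open B -> smooth_on B f -> B z -> f z != 0 ->
  exists2 B', [/\ open B', B' z & B' `<=` B] & forall y, B' y -> Num.sg (f y) = Num.sg (f z).
Proof.
move=> oB sf Bz fz.
have cf : {for z, continuous f}.
  by apply: differentiable_continuous; exact: smooth_on_diff sf _ _.
have P : \forall y \near z, B y /\ Num.sg (f y) = Num.sg (f z).
  have [f0|f0|f0] := ltrgtP (f z) 0; last by rewrite f0 eqxx in fz.
    rewrite (ltr0_sg f0); near=> y; split; first by near: y; exact: open_nbhs_nbhs.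
    by apply: ltr0_sg; near: y; exact: cvgr_lt cf _ f0.
  rewrite (gtr0_sg f0); near=> y; split; first by near: y; exact: open_nbhs_nbhs.
  by apply: gtr0_sg; near: y; exact: cvgr_gt cf _ f0.
exists [set y | B y /\ Num.sg (f y) = Num.sg (f z)]^°; last by move=> y /interior_subset[].
by split=> //; [exact: open_interior|move=> y /interior_subset[]].
Unshelve. all: by end_near. Qed.

(* Jacobian change of variables is only needed up to a constant factor [c], hence
   this route: the transformation rule of the divergence shows that the image measure annihilates
   partial derivatives of test functions. *)
Lemma change_of_variables A B (psi phi : 'rV[R]_n -> 'rV[R]_n) a :
  open A -> open B -> smooth_map_on B psi ->
  (forall z, B z -> A (psi z)) -> (forall x, A x -> B (phi x)) ->
  (forall z, B z -> phi (psi z) = z) -> (forall x, A x -> psi (phi x) = x) ->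
  {in A, continuous phi} -> (forall z, B z -> \det (jac psi z) != 0) -> A a ->
  exists r c : R, [/\ 0 < r, 0 <= c, ball a r `<=` A &
    forall G : borel 'rV[R]_n -> \bar R, measurable_fun setT G ->
      (forall x, ~ (ball a r : set 'rV[R]_n) x -> G x = 0%E) ->
      (\int[lebn n]_(z in B) (G (psi z) * `|\det (jac psi z)|%:E) =
       c%:E * \int[lebn n]_x G x)%E].
Proof.
move=> oA oB spsi psiA phiB phiK psiK cphi detB Aa.
have [e /= e0 eA] : exists2 e : R, 0 < e & ball a e `<=` A.
  by have /nbhs_ballP[e] := open_nbhs_nbhs (conj oA Aa); exists e.
(* Leaves room for the closed ball of radius [r *+ 2] inside [A]; its compact image under [phi]
   makes the image measure finite on the ball of that radius. *)
pose r := e / 4; have r0 : 0 < r by rewrite divr_gt0.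
pose K2 := closed_ball a (r *+ 2).
have K2A : K2 `<=` A.
  apply: subset_trans eA; apply: closed_ball_subset; first by rewrite pmulrn_lgt0.
  by rewrite /r; lra.
have cK2 : compact K2.
  apply: bounded_closed_compact; last exact: closed_ball_closed.
  exists (`|a| + r *+ 2); split; first by rewrite num_real.
  move=> M aM x; rewrite /K2 closed_ballE ?pmulrn_lgt0// /closed_ball_ /= => xr.
  rewrite (le_trans _ (ltW aM))// -[x](subrK a) addrC (le_trans (ler_normD _ _))//.
  by rewrite lerD2l distrC.
have cpsi : {in B, continuous psi}.
  by move=> z /set_mem Bz; apply: differentiable_continuous; exact: smooth_map_diff spsi _.
pose w z : R := `|\det (jac psi z)|.
have sdet : smooth_on B (fun z => \det (jac psi z)).
  by apply: smooth_on_det => // i j; exact: smooth_jac.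
have cw : {in B, continuous w}.
  move=> z Bz; apply: (@continuous_comp _ _ _ (fun z => \det (jac psi z)) Num.norm).
    exact: smooth_on_continuous sdet _ Bz.
  exact: norm_continuous.
pose w' : borel 'rV[R]_n -> R := w \_ B.
have mB : measurable (B : set (borel 'rV[R]_n)) by exact: borel_open.
have mw' : measurable_fun setT w'.
  by apply: (measurable_restrictT _ mB).1; apply: borel_continuous_on => //.
have w'0 z : 0 <= w' z by rewrite /w' patchE; case: ifP => // _; exact: normr_ge0.
(* Made total by an arbitrary value outside [B], where the weight [w'] is 0. *)
pose psi' : borel 'rV[R]_n -> borel 'rV[R]_n := fun z => if z \in B then psi z else a.
have mpsi' : measurable_fun setT psi'.
  apply: measurable_to_borel => U oU; rewrite setTI.
  have oBU : open (B `&` psi @^-1` U).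
    rewrite openE => z [Bz Uz]; apply: filterI; first exact: open_nbhs_nbhs.
    by apply: cpsi; [exact/mem_set|exact: open_nbhs_nbhs].
  rewrite (_ : _ @^-1` _ = (B `&` psi @^-1` U) `|` (if a \in U then ~` B else set0)).
    apply: measurableU; first exact: borel_open.
    by case: ifP => // _; exact: measurableC.
  apply/seteqP; split => z; rewrite /psi' /=.
    case: ifPn => [/set_mem Bz Uz|/negP zB Ua]; [by left|right].
    by rewrite mem_set//= => Bz; apply: zB; exact/mem_set.
  move=> [[Bz Uz]|]; first by rewrite mem_set.
  by case: ifPn => // /set_mem Ua zB; rewrite memNset.
have [nu [nuE nuI]] := density_pushforward (lebn n) mw' w'0 mpsi'.
pose K' := phi @` K2.
have cK' : compact K'.
  apply: continuous_compact => //; apply: continuous_in_subspaceT => x /set_mem xK.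
  by apply: cphi; apply/mem_set; exact: K2A.
have K'B : K' `<=` B by move=> _ [x /K2A Ax <-]; exact: phiB.
have ballK z : B z -> closed_ball a (r *+ 2) (psi z) -> K' z.
  by move=> Bz h; exists (psi z) => //; exact: phiK.
have nuoo : (nu (ball a (r *+ 2)) < +oo)%E.
  have [Mw MwP] : exists M, forall z, K' z -> w z <= M.
    have : compact (w @` K').
      apply: continuous_compact => //; apply: continuous_in_subspaceT => z /set_mem zK.
      by apply: cw; apply/mem_set; exact: K'B.
    move=> /compact_bounded[M [_ MP]]; exists (M + 1) => z zK.
    rewrite (le_trans (ler_norm _))//; apply: MP; last by exists z.
    by rewrite ltrDl.
  have mK' : measurable (K' : set (borel 'rV[R]_n)).
    by apply: borel_closed; apply: compact_closed => //; exact: norm_hausdorff.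
  have K'oo : (lebn n K' < +oo)%E.
    have [M [_ MP]] := compact_bounded cK'.
    apply: (@le_lt_trans _ _ (lebn n (ball 0 (`|M| + 2)))); last exact: lebn_ball_lty.
    apply: le_measure; rewrite ?inE//; first by apply: borel_open; exact: ball_open.
    move=> z zK; rewrite -ball_normE /ball_ /= sub0r normrN.
    have /MP/(_ z zK) : M < `|M| + 1 by rewrite (le_lt_trans (ler_norm _))// ltrDl.
    by move=> /le_lt_trans; apply; rewrite ltrD2l ltr1n.
  have mpre : measurable (psi' @^-1` (ball a (r *+ 2))).
    rewrite -[X in measurable X]setTI; apply: mpsi' => //.
    by apply: borel_open; exact: ball_open.
  rewrite nuE; apply: (@le_lt_trans _ _ (\int[lebn n]_(z in K') (cst (`|Mw|)%:E z))%E).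
    rewrite integral_mkcond [leRHS]integral_mkcond.
    apply: ge0_le_integral => //.
    - by move=> z _; rewrite patchE; case: ifP => // _; rewrite lee_fin.
    - by apply/(measurable_restrictT _ mpre)/measurable_EFinP; exact: measurable_funTS.
    - by apply/(measurable_restrictT _ mK').
    move=> z _; rewrite !patchE; case: ifPn => [/set_mem zB|_]; last first.
      by case: ifP => //; rewrite lee_fin.
    have [Bz|Bz] := pselect (B z); last first.
      have -> : w' z = 0 by rewrite /w' patchE memNset.
      by case: ifP => _ //; rewrite lee_fin.
    have zK : K' z.
      apply: ballK => //; apply: subset_closed_ball.
      by move: zB; rewrite /psi' /= mem_set.
    by rewrite mem_set//= /w' patchE mem_set// lee_fin (le_trans (MwP _ zK))// ler_norm.
  by rewrite integral_cst// lte_mul_pinfty// lee_fin.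
have ndiv F k : test_on a r F -> \int[nu]_x partial k F x = 0.
  move=> [sF Fr]; rewrite /Rintegral nuI; last first.
    apply/measurable_EFinP; apply: borel_continuous; apply: smooth_continuous.
    exact: smooth_on_partial.
  (* The vector field, extended by zero, whose divergence is [|det|] times the derivative of [F] at
     [psi z], by [divergence_comp]. *)
  pose E b z : R := if z \in B then Num.sg (\det (jac psi z)) * ((\adj (jac psi z)) k b * F (psi z)) else 0.
  have FK z : B z -> ~ K' z -> F (psi z) = 0.
    move=> Bz zK; apply: Fr; rewrite ltNge; apply/negP => h; apply: zK; apply: ballK => //.
    rewrite closed_ballE ?pmulrn_lgt0// /closed_ball_ /= distrC (le_trans h)//.
    by rewrite mulr2n lerDl ltW.
  have sE0 b : smooth_on B (fun z => (\adj (jac psi z)) k b * F (psi z)).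
    apply: (@smooth_onM _ _ _ (fun z => (\adj (jac psi z)) k b) (F \o psi)) => //.
      by apply: smooth_on_adj => // i j; exact: smooth_jac.
    by apply: (@smooth_on_comp _ _ _ B setT).
  have sE b : smooth_on setT (E b) /\ bounded_support (E b).
    apply: (smooth_ext0 (G0 := E b) oB cK' K'B) => //.
      apply: smooth_on_local => z Bz.
      have [B' [oB' B'z B'B] sgB] := sg_near oB sdet Bz (detB _ Bz).
      exists B' => //; apply: (smooth_on_eq (f := fun y => Num.sg (\det (jac psi z)) * ((\adj (jac psi y)) k b * F (psi y)))) => //.
        by move=> y B'y; rewrite /E mem_set ?sgB//; exact: B'B.
      by apply: smooth_onZ => //; exact: smooth_on_subset (sE0 b).
    by move=> z zK; rewrite /E; case: ifPn => // /set_mem Bz; rewrite FK// !mulr0.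
  have pt z : ((partial k F (psi' z))%:E * (w' z)%:E)%E = (\sum_b partial b (E b) z)%:E.
    rewrite -EFinM; congr (_%:E).
    have [Bz|Bz] := pselect (B z); last first.
      rewrite /w' patchE memNset// mulr0 big1// => b _.
      have zK : (~` K') z by move=> /K'B.
      rewrite (@partial_eq_on _ _ (~` K') _ (cst 0) _ _ _ z zK) ?partial_cst//.
        by apply: closed_openC; apply: compact_closed => //; exact: norm_hausdorff.
      by move=> y yK; rewrite /E; case: ifPn => // /set_mem By; rewrite FK// !mulr0.
    have [B' [oB' B'z B'B] sgB] := sg_near oB sdet Bz (detB _ Bz).
    rewrite /w' patchE mem_set// /psi' mem_set// /w.
    transitivity (\sum_b Num.sg (\det (jac psi z)) * partial b (fun y => (\adj (jac psi y)) k b * F (psi y)) z).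
      rewrite -mulr_sumr (@divergence_comp _ _ B setT psi F z k)//; last exact: detB.
      by rewrite normrEsg mulrC mulrA.
    apply: eq_bigr => b _; rewrite -partialZ; last exact: smooth_on_diff (sE0 b) _ Bz.
    apply: (@partial_eq_on _ _ B') => // y B'y.
    by rewrite /E mem_set ?sgB//; exact: B'B.
  under eq_integral do rewrite pt.
  under eq_integral do rewrite -sumEFin.
  rewrite integral_sum//; last first.
    move=> b; apply: integrable_bounded_support_rV; last first.
      by apply: bounded_support_partial; have [] := sE b.
    by apply: smooth_continuous; apply: smooth_on_partial; have [] := sE b.
  by rewrite big1// => b _; have [sEb bEb] := sE b; rewrite integral_partial0.
have [c c0 cE] := divergence_free_lebesgue nuoo r0 ndiv.
exists r, c; split=> //.
  by apply: subset_trans eA; apply: le_ball; rewrite /r; lra.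
move=> G mG G0.
have mball : measurable (ball a r : set (borel 'rV[R]_n)) by apply: borel_open; exact: ball_open.
transitivity (\int[nu]_x G x)%E.
  rewrite nuI// [LHS]integral_mkcond; apply: eq_integral => z _.
  rewrite patchE /psi' /w' patchE; case: ifP => // _; by rewrite mule0.
have GE (m : {measure set (borel 'rV[R]_n) -> \bar R}) :
    (\int[m]_x G x = \int[m]_(x in ball a r) G x)%E.
  rewrite [RHS]integral_mkcond; apply: eq_integral => x _; rewrite patchE.
  by case: ifPn => // /negP h; apply: G0 => h'; apply: h; exact/mem_set.
rewrite GE (@eq_measure_integral _ _ _ _ (mscale (NngNum c0) (lebn n))); last first.
  by move=> C mC CB; rewrite /= cE.
rewrite (GE (lebn n)) integralE [X in (_ * X)%E]integralE.
have mGb : measurable_fun (ball a r : set (borel 'rV[R]_n)) G by exact: measurable_funTS.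
rewrite !ge0_integral_mscale//; try exact: measurable_funepos; try exact: measurable_funeneg.
rewrite /= ge0_muleBr//; apply: integral_ge0 => x _; first exact: funepos_ge0.
exact: funeneg_ge0.
Qed.

End extension.

(** * Test functions on manifolds *)

Section charts.
Context {R : realType} {n : nat} {M : manifold R n}.
Implicit Types (x : M) (f g h : M -> R) (O K : set M) (i j : chart_index M).

Lemma chart_inv_dom i y : chart_img i y -> chart_dom i (chart_inv i y).
Proof. by move=> [x xi <-]; rewrite chartK. Qed.

Lemma chart_invK i y : chart_img i y -> chart i (chart_inv i y) = y.
Proof. by move=> [x xi <-]; rewrite chartK. Qed.

Lemma chart_img_chart i x : chart_dom i x -> chart_img i (chart i x).
Proof. by move=> xi; exists x. Qed.

Lemma chart_at_continuous i : {in chart_dom i, continuous (chart i)}.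
Proof. by rewrite -continuous_open_subspace; [exact: chart_continuous|exact: chart_dom_open]. Qed.

Lemma chart_inv_at_continuous i : {in chart_img i, continuous (chart_inv i)}.
Proof. by rewrite -continuous_open_subspace; [exact: chart_inv_continuous|exact: chart_img_open]. Qed.

Lemma open_chart_img i : open (chart_img i). Proof. exact: chart_img_open. Qed.

Lemma open_preimage_on (X Y : topologicalType) (A : set X) (u : X -> Y) (O : set Y) :
  open A -> {in A, continuous u} -> open O -> open (A `&` u @^-1` O).
Proof.
move=> oA cu oO; rewrite openE => z [Az Oz]; apply: filterI; first exact: open_nbhs_nbhs.
by apply: cu; [exact/mem_set|exact: open_nbhs_nbhs].
Qed.

Lemma chart_imageE i O : chart i @` (chart_dom i `&` O) = chart_img i `&` chart_inv i @^-1` O.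
Proof.
apply/seteqP; split=> [_ [x [xi Ox] <-]|y [yi Oy]].
  by split; [exact: chart_img_chart|rewrite /= chartK].
by exists (chart_inv i y); [split=> //; exact: chart_inv_dom|exact: chart_invK].
Qed.

Lemma open_chart_image i O : open O -> open (chart i @` (chart_dom i `&` O)).
Proof.
move=> oO; rewrite chart_imageE; apply: open_preimage_on => //; first exact: chart_img_open.
exact: chart_inv_at_continuous.
Qed.

Lemma open_chart_preimage i (B : set 'rV[R]_n) : open B -> open (chart_dom i `&` chart i @^-1` B).
Proof.
move=> oB; apply: open_preimage_on => //; first exact: chart_dom_open.
exact: chart_at_continuous.
Qed.

Lemma compact_chart_image i K : compact K -> K `<=` chart_dom i -> compact (chart i @` K).
Proof.
move=> cK Ki; apply: continuous_compact => //.
by apply: continuous_in_subspaceT => x /set_mem/Ki xi; apply: chart_at_continuous; exact/mem_set.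
Qed.

Lemma compact_chart_inv_image i (K : set 'rV[R]_n) : compact K -> K `<=` chart_img i ->
  compact (chart_inv i @` K).
Proof.
move=> cK Ki; apply: continuous_compact => //.
by apply: continuous_in_subspaceT => x /set_mem/Ki xi; apply: chart_inv_at_continuous; exact/mem_set.
Qed.

Lemma manifold_compact_closed K : compact K -> closed K.
Proof. by apply: compact_closed; exact: manifold_hausdorff. Qed.

Lemma smooth_local f :
  (forall x, exists i O, [/\ open O, O x, O `<=` chart_dom i &
     smooth_on (chart i @` O) (f \o chart_inv i)]) -> smooth f.
Proof.
move=> fP j; apply: smooth_on_local => y yj; pose x := chart_inv j y.
have xj : chart_dom j x by exact: chart_inv_dom.
have [i [ O [oO Ox Oi sO]]] := fP x.
exists (chart j @` (chart_dom j `&` O)).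
  by exists x => //; exact: chart_invK.
have oA : open (chart j @` (chart_dom j `&` O)) by exact: open_chart_image.
apply: (@smooth_on_eq _ _ _ ((f \o chart_inv i) \o (chart i \o chart_inv j))) => //.
  by move=> _ [z [zj Oz] <-] /=; rewrite chartK// chartK//; exact: Oi.
apply: (@smooth_on_comp _ _ _ _ (chart i @` O)) => //.
  move=> k; apply: smooth_on_subset (@transition_smooth _ _ M j i k).
  by move=> _ [z [zj Oz] <-]; exists z => //; split=> //; exact: Oi.
by move=> _ [z [zj Oz] <-] /=; rewrite chartK//; exists z.
Qed.

Lemma smooth_fun_continuous f : smooth f -> continuous f.
Proof.
move=> sf x; pose i := chart_at x; have xi : chart_dom i x by exact: chart_at_dom.
have c1 : {for x, continuous ((f \o chart_inv i) \o chart i)}.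
  apply: continuous_comp; first by apply: chart_at_continuous; exact/mem_set.
  apply: (smooth_on_continuous (sf i)); exact/mem_set/chart_img_chart.
have e : \near x, ((f \o chart_inv i) \o chart i) x = f x.
  have := open_nbhs_nbhs (conj (chart_dom_open i) xi); apply: filterS => z zi.
  by rewrite /= chartK.
have fx : f x = ((f \o chart_inv i) \o chart i) x by rewrite /= chartK.
rewrite /continuous_at fx; apply: cvg_trans c1.
exact: near_eq_cvg.
Qed.

Lemma smooth_cst (c : R) : smooth (cst c : M -> R).
Proof. by move=> i; exact: smooth_on_cst. Qed.

Lemma smoothD f g : smooth f -> smooth g -> smooth (f \+ g).
Proof. by move=> sf sg i; apply: (@smooth_onD _ _ _ (f \o chart_inv i) (g \o chart_inv i)) => //; exact: open_chart_img. Qed.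

Lemma smoothM f g : smooth f -> smooth g -> smooth (f \* g).
Proof. by move=> sf sg i; apply: (@smooth_onM _ _ _ (f \o chart_inv i) (g \o chart_inv i)) => //; exact: open_chart_img. Qed.

Lemma smoothZ (c : R) f : smooth f -> smooth (fun x => c * f x).
Proof. by move=> sf i; apply: (@smooth_onZ _ _ _ (f \o chart_inv i)) => //; exact: open_chart_img. Qed.

(** In a Hausdorff space a compact set off which [f] vanishes contains the closed support; this form
    passes easily to sums and products. *)
Lemma test_functionsP f : test_functions M f <->
  smooth f /\ exists2 K, compact K & forall x, ~ K x -> f x = 0.
Proof.
split=> [[sf cf]|[sf [K cK fK]]]; split=> //.
  exists (closure [set x | f x != 0]) => // x h; apply/eqP/negPn/negP => fx0.
  by apply: h; apply: subset_closure.
have cK' := cK; apply: subclosed_compact cK' _; first exact: closed_closure.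
rewrite [X in _ `<=` X](closure_id K).1; last exact: manifold_compact_closed.
by apply: closure_subset => x /= /eqP fx0; apply: contrapT => /fK.
Qed.

Lemma test_smooth f : test_functions M f -> smooth f. Proof. by case. Qed.

Lemma test0 : test_functions M (cst 0).
Proof.
apply/test_functionsP; split; first exact: smooth_cst.
by exists set0 => //; exact: compact0.
Qed.

Lemma testD f g : test_functions M f -> test_functions M g -> test_functions M (f \+ g).
Proof.
move=> /test_functionsP[sf [K cK fK]] /test_functionsP[sg [L cL gL]].
apply/test_functionsP; split; first exact: smoothD.
exists (K `|` L); first exact: compactU.
by move=> x KLx /=; rewrite fK ?gL ?addr0// => h; apply: KLx; [right|left].
Qed.

Lemma testM f g : test_functions M f -> smooth g -> test_functions M (f \* g).
Proof.
move=> /test_functionsP[sf [K cK fK]] sg.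
apply/test_functionsP; split; first exact: smoothM.
by exists K => // x Kx /=; rewrite fK// mul0r.
Qed.

Lemma testZ (c : R) f : test_functions M f -> test_functions M (fun x => c * f x).
Proof.
move=> /test_functionsP[sf [K cK fK]]; apply/test_functionsP; split; first exact: smoothZ.
by exists K => // x Kx /=; rewrite fK// mulr0.
Qed.

Lemma test_sum (I : eqType) (r : seq I) (F : I -> M -> R) :
  (forall k, k \in r -> test_functions M (F k)) -> test_functions M (fun x => \sum_(k <- r) F k x).
Proof.
elim: r => [|k r IH] rF.
  by rewrite (_ : (fun x => _) = cst 0); [exact: test0|apply/funext => x; rewrite big_nil].
rewrite (_ : (fun x => _) = F k \+ (fun x => \sum_(k <- r) F k x)); last first.
  by apply/funext => x; rewrite big_cons.
apply: testD; first by apply: rF; rewrite mem_head.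
by apply: IH => l lr; apply: rF; rewrite in_cons lr orbT.
Qed.

Lemma test_supp f : test_functions M f ->
  exists K, [/\ compact K, closed K & forall x, ~ K x -> f x = 0].
Proof.
by move=> /test_functionsP[_ [K cK fK]]; exists K; split=> //; exact: manifold_compact_closed.
Qed.

Lemma smooth_chart_ext i (h : 'rV[R]_n -> R) f K : smooth_on (chart_img i) h ->
  closed K -> K `<=` chart_dom i -> (forall x, chart_dom i x -> f x = h (chart i x)) ->
  (forall x, ~ K x -> f x = 0) -> smooth f.
Proof.
move=> sh cK Ki fh f0; apply: smooth_local => x.
have [xi|xi] := pselect (chart_dom i x).
  exists i, (chart_dom i); split=> //; first exact: chart_dom_open.
  apply: (@smooth_on_eq _ _ _ h) => //; first exact: open_chart_img.
  move=> y yi /=.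
  by rewrite fh ?chart_invK//; exact: chart_inv_dom.
exists (chart_at x), (chart_dom (chart_at x) `&` ~` K); split.
- by apply: openI; [exact: chart_dom_open|exact: closed_openC].
- by split; [exact: chart_at_dom|move=> /Ki].
- exact: subIsetl.
apply: (@smooth_on_eq _ _ _ (cst 0)).
- by apply: open_chart_image; exact: closed_openC.
- by move=> _ [z [zj Oz] <-] /=; rewrite chartK// f0.
- exact: smooth_on_cst.
Qed.

Lemma compact_closed_ball (a : 'rV[R]_n) (r : R) : 0 < r -> compact (closed_ball a r).
Proof.
move=> r0; apply: bounded_closed_compact; last exact: closed_ball_closed.
exists (`|a| + r); split; first by rewrite num_real.
move=> b ab x; rewrite closed_ballE// /closed_ball_ /= => xr.
rewrite (le_trans _ (ltW ab))// -[x](subrK a) addrC (le_trans (ler_normD _ _))//.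
by rewrite lerD2l distrC.
Qed.

Lemma bump x O : open O -> O x -> exists f K, [/\ test_functions M f /\ forall y, 0 <= f y <= 1,
  compact K, K `<=` O `&` chart_dom (chart_at x), forall y, ~ K y -> f y = 0 &
  exists2 U, open U /\ U x & forall y, U y -> f y = 1].
Proof.
move=> oO Ox; set i := chart_at x; have xi : chart_dom i x by exact: chart_at_dom.
pose a := chart i x; have oA := open_chart_image (i := i) oO.
have Aa : (chart i @` (chart_dom i `&` O)) a by exists x.
have [e /= e0 eA] : exists2 e : R, 0 < e & ball a e `<=` chart i @` (chart_dom i `&` O).
  by have /nbhs_ballP[e] := open_nbhs_nbhs (conj oA Aa); exists e.
pose r := e / 2; have r0 : 0 < r by rewrite divr_gt0.
have rA : closed_ball a r `<=` chart i @` (chart_dom i `&` O).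
  apply: subset_trans eA; apply: closed_ball_subset => //; rewrite /r; lra.
have rI : closed_ball a r `<=` chart_img i.
  by apply: subset_trans rA _; rewrite chart_imageE; exact: subIsetl.
pose s (y : 'rV[R]_n) := \sum_k (y 0 k - a 0 k) ^+ 2.
(* It is 1 where [s <= r^2 / 2] and 0 where [s >= r^2]. The Euclidean square [s] is used because the
   maximum norm is not smooth; it dominates the square of that norm. *)
pose h y := smooth_step (2 + - (2 / r ^+ 2) * s y).
have oT : open [set: 'rV[R]_n] by exact: openT.
have ss : smooth_on setT s.
  apply: smooth_on_sum => // k _.
  have sk : smooth_on setT (fun y : 'rV[R]_n => y 0 k - a 0 k).
    by apply: smooth_onB => //; [exact: smooth_on_coord|exact: smooth_on_cst].
  rewrite (_ : (fun y => _) = (fun y : 'rV[R]_n => y 0 k - a 0 k) \* (fun y => y 0 k - a 0 k)).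
    exact: smooth_onM.
  by apply/funext => y; rewrite /= expr2.
have sh : smooth_on setT h.
  apply: smooth_on_step => //; apply: smooth_onD => //; first exact: smooth_on_cst.
  exact: smooth_onZ.
have r2 : 0 < r ^+ 2 by rewrite exprn_gt0.
have h0 y : r < `|y - a| -> h y = 0.
  move=> ry; have [k ky] : exists k, r < `|y 0 k - a 0 k|.
    apply/existsP; apply: contraTT ry => /existsPn H; rewrite -leNgt.
    by apply: norm_le_coord => [|k]; [exact: ltW|rewrite !mxE leNgt H].
  apply: smooth_step0.
  have : r ^+ 2 <= s y.
    rewrite /s (bigD1 k)//=; apply: (@le_trans _ _ ((y 0 k - a 0 k) ^+ 2)).
      by rewrite -[leRHS]real_normK ?num_real// ler_pXn2r// ?nnegrE ?(ltW r0)// ltW.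
    by rewrite lerDl sumr_ge0// => l _; exact: sqr_ge0.
  by move=> rs; rewrite mulNr subr_le0 -[X in X <= _]mulr1 -mulrA ler_pM2l// ler_pdivlMl// mulr1.
pose f y := if y \in chart_dom i then h (chart i y) else 0.
pose K := chart_inv i @` closed_ball a r.
have cK : compact K by apply: compact_chart_inv_image => //; exact: compact_closed_ball.
have KO : K `<=` O `&` chart_dom i.
  by move=> _ [y /rA[z [zi Oz] <-] <-]; rewrite chartK.
have fK y : ~ K y -> f y = 0.
  move=> yK; rewrite /f; case: ifPn => // /set_mem yi; apply: h0.
  rewrite ltNge; apply/negP => hr; apply: yK; exists (chart i y); last exact: chartK.
  by rewrite closed_ballE// /closed_ball_ /= distrC.
exists f, K; split=> //.
- split.
    apply/test_functionsP; split; last by exists K.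
    apply: (@smooth_chart_ext i h f K) => //.
    + exact: smooth_on_subset sh.
    + exact: manifold_compact_closed.
    + by move=> y /KO[].
    + by move=> y yi; rewrite /f mem_set.
  by move=> y; rewrite /f; case: ifP => _; rewrite ?smooth_step_ge0 ?smooth_step_le1 ?lexx ?ler01.
exists (chart_dom i `&` chart i @^-1` [set y | s y < r ^+ 2 / 2]).
  split.
    apply: open_chart_preimage.
    rewrite (_ : [set y | _] = s @^-1` [set t | t < r ^+ 2 / 2])//.
    apply: open_comp; last exact: open_lt.
    by move=> y _; exact: smooth_continuous ss y.
  split=> //=; rewrite /s big1 ?divr_gt0// => k _.
  by rewrite subrr expr0n.
move=> y [yi /= sy]; rewrite /f mem_set//; apply: smooth_step1.
rewrite mulNr lerBrDr -lerBrDl (_ : 2 - 1 = 1); last by ring.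
by rewrite mulrC mulrA ler_pdivrMr// mul1r -ler_pdivlMr// ltW.
Qed.

(** A sum of bumps over a finite subcover, whence [1 <= f] on [K] in place of an equality. *)
Lemma cutoff K : compact K -> exists2 f, test_functions M f &
  (forall x, 0 <= f x) /\ forall x, K x -> 1 <= f x.
Proof.
move=> cK.
have /choice[b bP] (x : M) : exists fU : (M -> R) * set M, [/\ test_functions M fU.1,
    forall y, 0 <= fU.1 y, open fU.2, fU.2 x & forall y, fU.2 y -> fU.1 y = 1].
  have [f [L [[tf f01] _ _ _ [U [oU Ux] fU]]]] := bump (@openT M) (I : setT x).
  by exists (f, U); split=> // y; have /andP[] := f01 y.
have := cK; rewrite compact_cover => /(_ M setT (fun x => (b x).2)) [||D _ KD].
- by move=> x _; case: (bP x).
- by move=> x Kx; exists x => //; case: (bP x).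
exists (fun y => \sum_(x <- finmap.enum_fset D) (b x).1 y).
  by apply: test_sum => x _; case: (bP x).
split=> y; first by apply: sumr_ge0 => x _; case: (bP x).
move=> /KD[x xD Uy]; rewrite (big_rem x)//=.
have [_ b0 _ _ b1] := bP x; rewrite b1// lerDl.
by apply: sumr_ge0 => z _; case: (bP z).
Qed.

(* By a partition of unity subordinate to the sets [O]. *)
Lemma test_ind (P : (M -> R) -> Prop) :
  (forall x, exists2 O, open O /\ O x & forall f K, test_functions M f ->
     compact K -> K `<=` O -> (forall y, ~ K y -> f y = 0) -> P f) ->
  (forall f g, test_functions M f -> test_functions M g -> P f -> P g -> P (f \+ g)) ->
  forall f, test_functions M f -> P f.
Proof.
move=> Ploc PD f tf; have [K [cK _ fK]] := test_supp tf.
have /choice[b bP] (x : M) : exists fU : (M -> R) * set M, [/\ test_functions M fU.1,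
    open fU.2, fU.2 x, forall y, fU.2 y -> fU.1 y = 1 &
    forall g, test_functions M g -> P (g \* fU.1)].
  have [ O [oO Ox] OP] := Ploc x.
  have [e [L [[te _] cL LO eL [U [oU Ux] eU]]]] := bump oO Ox.
  exists (e, U); split=> // g tg.
  apply: (OP _ L) => //.
  - by apply: testM => //; exact: test_smooth.
  - by move=> y /LO[].
  - by move=> y Ly /=; rewrite eL// mulr0.
have := cK; rewrite compact_cover => /(_ M setT (fun x => (b x).2)) [||D _ KD].
- by move=> x _; case: (bP x).
- by move=> x Kx; exists x => //; case: (bP x).
have {KD fK} : forall y, f y != 0 -> exists2 x, x \in finmap.enum_fset D & (b x).2 y.
  by move=> y /eqP fy; have /KD[x xD Uy] : K y by [apply: contrapT => /fK]; exists x.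
(* Induction on the finite subcover: [f (1 - b)] vanishes where the bump [b] at [x] equals 1, so the
   set where it is non-zero is covered by the remaining neighbourhoods. *)
elim: (finmap.enum_fset D) f tf {cK K} => [|x s IH] f tf fs.
  have [ O _ OP] := Ploc point; apply: (OP _ set0) => //; first exact: compact0.
  by move=> y _; apply/eqP; apply: contraT => /fs[].
have [tb _ _ b1 bM] := bP x.
have tg : test_functions M (f \* (fun y => 1 + -1 * (b x).1 y)).
  apply: testM => //; apply: smoothD; first exact: smooth_cst.
  by apply: smoothZ; exact: test_smooth.
rewrite (_ : f = (f \* (b x).1) \+ (f \* (fun y => 1 + -1 * (b x).1 y))); last first.
  by apply/funext => y /=; ring.
apply: PD => //.
- by apply: testM => //; exact: test_smooth.
- exact: bM.
apply: IH => // y; rewrite /= mulf_eq0 negb_or => /andP[fy by0].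
have [z] := fs _ fy; rewrite in_cons => /orP[/eqP -> /b1 h|zs Uy]; last by exists z.
by move: by0; rewrite h mulr1 subrr eqxx.
Qed.

End charts.

Arguments open_chart_img {R n M} i.

(** * The Laplacian and Green's formula *)

Section posdef.
Context {R : realType} {n : nat}.
Implicit Types (g h : 'M[R]_n) (v : 'rV[R]_n).

Definition posdef g := g^T = g /\ forall v, v != 0 -> 0 < (v *m g *m v^T) 0 0.

Lemma posdef_det_neq0 g : posdef g -> \det g != 0.
Proof.
move=> [_ gp]; apply/negP => /eqP/eqP/det0P[v v0 vg].
by have := gp v v0; rewrite vg mul0mx mxE ltxx.
Qed.

Lemma posdef1 : posdef (1%:M : 'M[R]_n).
Proof.
split=> [|v v0]; first by rewrite trmx1.
rewrite mulmx1 !mxE.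
have [k vk] : exists k, v 0 k != 0.
  apply/existsP; apply: contra_neqT v0 => /existsPn H; apply/rowP => k; rewrite mxE.
  by apply/eqP/negPn/H.
rewrite (bigD1 k)//= ltr_pwDl//.
  by rewrite mxE lt_neqAle eq_sym mulf_eq0 orbb vk -expr2 sqr_ge0.
by apply: sumr_ge0 => i _; rewrite mxE -expr2 sqr_ge0.
Qed.

Lemma posdef_seg g (t : R) : posdef g -> 0 <= t <= 1 -> posdef ((1 - t) *: 1%:M + t *: g).
Proof.
move=> [gs gp] /andP[t0 t1]; have [_ p1] := posdef1; split.
  by rewrite linearD !linearZ/= gs trmx1.
move=> v v0; have -> : (v *m ((1 - t) *: 1%:M + t *: g) *m v^T) 0 0 =
    (1 - t) * (v *m 1%:M *m v^T) 0 0 + t * (v *m g *m v^T) 0 0.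
  by rewrite mulmxDr mulmxDl -!scalemxAr -!scalemxAl [LHS]mxE; congr (_ + _); rewrite [LHS]mxE.
have := gp _ v0; have := p1 _ v0; set a := (_ *m _) 0 0; set b := (_ *m _) 0 0 => a0 b0.
have [->|tn] := eqVneq t 0; first by rewrite subr0 mul1r mul0r addr0.
have tp : 0 < t by rewrite lt_neqAle eq_sym tn.
by rewrite ltr_wpDl ?mulr_gt0// mulr_ge0 ?subr_ge0// ltW.
Qed.

(** The determinant is a polynomial along the segment from the identity to [g]. The segment consists
    of positive definite, hence invertible, matrices, so the sign stays that of [\det 1]. *)
Lemma posdef_det_gt0 g : posdef g -> 0 < \det g.
Proof.
move=> gp; rewrite lt_neqAle eq_sym posdef_det_neq0//= leNgt; apply/negP => g0.
pose P : 'M[{poly R}]_n := \matrix_(i, j) ((1 - 'X) * ((i == j)%:R)%:P + 'X * (g i j)%:P).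
have PE t : (\det P).[t] = \det ((1 - t) *: 1%:M + t *: g).
  rewrite -horner_evalE -det_map_mx; congr (\det _).
  apply/matrixP => i j; rewrite !mxE /= /horner_eval.
  by rewrite !(hornerE, hornerM, hornerD).
have [t t01] : exists2 t, 0 <= t <= 1 & root (\det P) t.
  have := @poly_ivt _ (- \det P) 0 1 (@ler01 R); rewrite !hornerN !PE.
  rewrite !subr0 !scale0r addr0 scale1r subrr scale0r add0r scale1r det1.
  rewrite oppr_le0 ler01 oppr_ge0 (ltW g0) => /(_ isT)[t t01].
  by rewrite rootN; exists t.
by rewrite /root PE; apply/negP; apply: posdef_det_neq0; exact: posdef_seg.
Qed.

Lemma posdef_inv_ge0 g (v : 'cV[R]_n) : posdef g -> 0 <= (v^T *m invmx g *m v) 0 0.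
Proof.
move=> gp; have [gs gv] := gp.
have gu : g \in unitmx by rewrite unitmxE unitfE posdef_det_neq0.
have [->|v0] := eqVneq v 0; first by rewrite mulmx0 mxE.
have u0 : v^T *m invmx g != 0.
  apply: contra v0 => /eqP h; rewrite -[v]trmxK -[v^T](mulmxKV gu) h mul0mx trmx0.
  by [].
have := gv _ u0; rewrite mulmxKV// trmx_mul trmxK trmx_inv gs mulmxA => h; exact: ltW.
Qed.

End posdef.

(** * The Laplacian in coordinates and its invariance under isometries *)

Section chart_calculus.
Context {R : realType} {n : nat}.
Implicit Types (A B : set 'rV[R]_n) (g h : 'rV[R]_n -> 'M[R]_n) (F G : 'rV[R]_n -> R).

Definition pgrad F y : 'cV[R]_n := \col_a partial a F y.

(** The inner product of the gradients of [F] and [G] for the metric [m]; the inverse matrix appears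
    because [pgrad] collects the components of the differential. *)
Definition gam (m : 'M[R]_n) F G y : R := ((pgrad F y)^T *m invmx m *m pgrad G y) 0 0.

Definition dens g y := Num.sqrt (\det (g y)).

Definition flux g F a y := dens g y * \sum_(b < n) invmx (g y) a b * partial b F y.

Definition divflux g F y := \sum_(a < n) partial a (flux g F a) y.

(** Convertible with the body of [laplacian] in a chart, so [change] passes from one to the
    other. *)
Definition lapc g F y := - ((dens g y)^-1 * divflux g F y).

Definition smooth_metric A g := (forall a b, smooth_on A (fun y => g y a b)) /\
  forall y, A y -> posdef (g y).

Lemma gamE m F G y : gam m F G y = \sum_a partial a F y * \sum_b invmx m a b * partial b G y.
Proof.
rewrite /gam -mulmxA mxE; apply: eq_bigr => a _; rewrite !mxE; congr (_ * _).
by apply: eq_bigr => b _; rewrite mxE.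
Qed.

Lemma gamC m F G y : posdef m -> gam m F G y = gam m G F y.
Proof.
move=> [ms _]; rewrite /gam -[in LHS](trmxK (_ *m _ *m _)) mxE.
by rewrite !trmx_mul trmxK trmx_inv ms mulmxA.
Qed.

Lemma smooth_dens A g : open A -> smooth_metric A g -> smooth_on A (dens g).
Proof.
move=> oA [sg gp]; apply: smooth_on_sqrt => //; first exact: smooth_on_det.
by move=> y /gp; exact: posdef_det_gt0.
Qed.

Lemma dens_gt0 A g y : smooth_metric A g -> A y -> 0 < dens g y.
Proof. by move=> [_ gp] /gp/posdef_det_gt0; rewrite sqrtr_gt0. Qed.

Lemma smooth_flux A g F a : open A -> smooth_metric A g -> smooth_on A F ->
  smooth_on A (flux g F a).
Proof.
move=> oA sg sF; apply: (@smooth_onM _ _ _ (dens g)) => //; first exact: smooth_dens.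
apply: (@smooth_on_sum _ _ _ _ _ _ (fun b y => invmx (g y) a b * partial b F y)) => // b _.
apply: (@smooth_onM _ _ _ (fun y => invmx (g y) a b)) => //; last exact: smooth_on_partial.
have [sg' gp] := sg; apply: smooth_on_invmx => // y /gp; exact: posdef_det_neq0.
Qed.

Lemma smooth_lapc A g F : open A -> smooth_metric A g -> smooth_on A F ->
  smooth_on A (lapc g F).
Proof.
move=> oA sg sF; apply: smooth_onN => //.
apply: (@smooth_onM _ _ _ (fun y => (dens g y)^-1)) => //.
  apply: smooth_onV => //; first exact: smooth_dens.
  by move=> y Ay; rewrite gt_eqF// (dens_gt0 sg).
apply: (@smooth_on_sum _ _ _ _ _ _ (fun a => partial a (flux g F a))) => // a _.
by apply: smooth_on_partial; exact: smooth_flux.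
Qed.

Lemma smooth_gam A g F G : open A -> smooth_metric A g -> smooth_on A F -> smooth_on A G ->
  smooth_on A (fun y => gam (g y) F G y).
Proof.
move=> oA sg sF sG; rewrite (_ : (fun y => _) = (fun y => \sum_a partial a F y *
   \sum_b invmx (g y) a b * partial b G y)); last by apply/funext => y; exact: gamE.
apply: (@smooth_on_sum _ _ _ _ _ _ (fun a y => partial a F y * \sum_b invmx (g y) a b * partial b G y)) => // a _.
apply: (@smooth_onM _ _ _ (partial a F)) => //; first exact: smooth_on_partial.
apply: (@smooth_on_sum _ _ _ _ _ _ (fun b y => invmx (g y) a b * partial b G y)) => // b _.
apply: (@smooth_onM _ _ _ (fun y => invmx (g y) a b)) => //; last exact: smooth_on_partial.
have [sg' gp] := sg; apply: smooth_on_invmx => // y /gp; exact: posdef_det_neq0.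
Qed.

Lemma pgrad_eq_on A F G y : open A -> (forall z, A z -> F z = G z) -> A y -> pgrad F y = pgrad G y.
Proof. by move=> oA FG Ay; apply/colP => a; rewrite !mxE; exact: (partial_eq_on _ oA FG). Qed.

Lemma lapc_eq_on A g F G y : open A -> (forall z, A z -> F z = G z) -> A y ->
  lapc g F y = lapc g G y.
Proof.
move=> oA FG Ay; have E a : partial a (flux g F a) y = partial a (flux g G a) y.
  apply: (partial_eq_on _ oA) => // z Az; rewrite /flux.
  by under eq_bigr do rewrite (partial_eq_on _ oA FG Az).
have E' : divflux g F y = divflux g G y by apply: eq_bigr.
by rewrite /lapc E'.
Qed.

Lemma pgradD F G y : differentiable F y -> differentiable G y ->
  pgrad (F \+ G) y = pgrad F y + pgrad G y.
Proof. by move=> dF dG; apply/colP => a; rewrite !mxE partialD. Qed.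

Lemma lapcD A g F G y : open A -> smooth_metric A g -> smooth_on A F -> smooth_on A G -> A y ->
  lapc g (F \+ G) y = lapc g F y + lapc g G y.
Proof.
move=> oA sg sF sG Ay.
have E a : partial a (flux g (F \+ G) a) y = partial a (flux g F a) y + partial a (flux g G a) y.
  rewrite -partialD; [|exact: smooth_on_diff (smooth_flux a oA sg sF) _ Ay|
    exact: smooth_on_diff (smooth_flux a oA sg sG) _ Ay].
  apply: (partial_eq_on _ oA) => // z Az; rewrite /flux/= -mulrDr -big_split/=; congr (_ * _).
  apply: eq_bigr => b _; rewrite partialD ?mulrDr//.
    exact: smooth_on_diff sF _ Az.
  exact: smooth_on_diff sG _ Az.
have E' : divflux g (F \+ G) y = divflux g F y + divflux g G y.
  by rewrite /divflux -big_split; apply: eq_bigr.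
by rewrite /lapc E' mulrDr opprD.
Qed.

Lemma lapcZ A g F c y : open A -> smooth_metric A g -> smooth_on A F -> A y ->
  lapc g (fun x => c * F x) y = c * lapc g F y.
Proof.
move=> oA sg sF Ay; have E a : partial a (flux g (fun x => c * F x) a) y = c * partial a (flux g F a) y.
  rewrite -partialZ; last exact: smooth_on_diff (smooth_flux a oA sg sF) _ Ay.
  apply: (partial_eq_on _ oA) => // z Az; rewrite /flux/= [RHS]mulrCA; congr (_ * _); rewrite mulr_sumr.
  by apply: eq_bigr => b _; rewrite partialZ 1?mulrCA//; exact: smooth_on_diff sF _ Az.
have E' : divflux g (fun x => c * F x) y = c * divflux g F y.
  by rewrite /divflux mulr_sumr; apply: eq_bigr.
by rewrite /lapc E' mulrCA mulrN.
Qed.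

Section isometry.
Variables (A B : set 'rV[R]_n) (g h : 'rV[R]_n -> 'M[R]_n) (phi : 'rV[R]_n -> 'rV[R]_n).
Hypotheses (oA : open A) (sphi : smooth_map_on A phi) (phiB : forall y, A y -> B (phi y)).
Hypotheses (iso : isometric_on A g h phi) (sg : smooth_metric A g) (sh : smooth_metric B h).

Lemma iso_jac y : A y -> g y = jac phi y *m h (phi y) *m (jac phi y)^T.
Proof. by move=> Ay; rewrite iso// jacobian_jac//; exact: smooth_map_diff sphi Ay. Qed.

Lemma iso_det_neq0 y : A y -> \det (jac phi y) != 0.
Proof.
move=> Ay; have := posdef_det_neq0 (sg.2 _ Ay).
by rewrite iso_jac// !det_mulmx !mulf_eq0 !negb_or => /andP[/andP[]].
Qed.

Lemma iso_jac_unit y : A y -> jac phi y \in unitmx.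
Proof. by move=> /iso_det_neq0; rewrite unitmxE unitfE. Qed.

Lemma iso_invmx y : A y ->
  invmx (g y) = (invmx (jac phi y))^T *m invmx (h (phi y)) *m invmx (jac phi y).
Proof.
move=> Ay; have Ju := iso_jac_unit Ay.
have hu : h (phi y) \in unitmx by rewrite unitmxE unitfE posdef_det_neq0//; exact: sh.2 (phiB Ay).
have JTu : (jac phi y)^T \in unitmx by rewrite unitmx_tr.
set X := _ *m _ *m _.
have gu : g y \in unitmx by rewrite iso_jac// !unitmx_mul Ju hu JTu.
rewrite -[RHS](mulmxK gu) -[LHS]mul1mx; congr (_ *m _).
rewrite /X {1}iso_jac// !mulmxA mulmxKV// mulmxKV// -trmx_mul mulmxV// trmx1.
by [].
Qed.

Lemma pgrad_comp F y : smooth_on B F -> A y -> pgrad (F \o phi) y = jac phi y *m pgrad F (phi y).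
Proof.
move=> sF Ay; apply/colP => a; rewrite !mxE partial_comp.
- by apply: eq_bigr => k _; rewrite !mxE.
- exact: smooth_map_diff sphi Ay.
- exact: smooth_on_diff sF _ (phiB Ay).
Qed.

Lemma gam_iso F G y : smooth_on B F -> smooth_on B G -> A y ->
  gam (g y) (F \o phi) (G \o phi) y = gam (h (phi y)) F G (phi y).
Proof.
move=> sF sG Ay; rewrite /gam !pgrad_comp// iso_invmx// trmx_mul.
have Ju := iso_jac_unit Ay.
rewrite !mulmxA mulmxKV//.
by rewrite -(mulmxA _ (jac phi y)^T) -trmx_mul mulVmx// trmx1 mulmx1.
Qed.

Lemma dens_iso y : A y -> dens g y = `|\det (jac phi y)| * dens h (phi y).
Proof.
move=> Ay; rewrite /dens iso_jac// !det_mulmx det_tr.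
rewrite mulrAC -expr2 sqrtrM ?sqr_ge0// sqrtr_sqr//.
Qed.

(** The density contributes [|det J|] and the gradient the inverse transpose of [J]; together they
    form the sign of the determinant times the adjugate. *)
Lemma flux_iso F a y : smooth_on B F -> A y ->
  flux g (F \o phi) a y = Num.sg (\det (jac phi y)) *
    \sum_k (\adj (jac phi y)) k a * flux h F k (phi y).
Proof.
move=> sF Ay; have Ju := iso_jac_unit Ay.
have E (m : 'M[R]_n) (v : 'cV[R]_n) (w : 'I_n -> R) : (forall b, v b 0 = w b) ->
    \sum_b m a b * w b = (m *m v) a 0.
  by move=> vw; rewrite mxE; apply: eq_bigr => b _; rewrite vw.
rewrite /flux (E _ (pgrad (F \o phi) y)); last by move=> b; rewrite mxE.
rewrite pgrad_comp// iso_invmx// !mulmxA mulmxKV// -mulmxA.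
set Y := invmx (h (phi y)) *m pgrad F (phi y).
rewrite dens_iso// normrEsg -!mulrA; congr (_ * _).
transitivity (dens h (phi y) * (\det (jac phi y) * ((invmx (jac phi y))^T *m Y) a 0)).
  by rewrite mulrCA.
have -> : \det (jac phi y) * ((invmx (jac phi y))^T *m Y) a 0 = ((\adj (jac phi y))^T *m Y) a 0.
  rewrite /invmx Ju linearZ/= -scalemxAl mxE mulrA mulfV ?mul1r//; exact: iso_det_neq0.
rewrite mxE mulr_sumr; apply: eq_bigr => k _.
rewrite mxE mulrCA; congr (_ * (_ * _)).
by rewrite /Y mxE; apply: eq_bigr => b _; rewrite mxE.
Qed.

(* The Piola identity: the flux transforms by the cofactor matrix, so that its
   divergence is multiplied by the Jacobian. *)
Lemma lapc_iso F y : open B -> smooth_on B F -> A y -> lapc g (F \o phi) y = lapc h F (phi y).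
Proof.
move=> oB sF Ay; have dJ := iso_det_neq0 Ay.
have sdet : smooth_on A (fun z => \det (jac phi z)).
  by apply: smooth_on_det => // i j; exact: smooth_jac.
have [A' [oA' A'y A'A] sgA] := sg_near oA sdet Ay dJ.
have sflux k : smooth_on B (flux h F k) by exact: smooth_flux.
have sk a k : smooth_on A (fun z => (\adj (jac phi z)) k a * flux h F k (phi z)).
  apply: (@smooth_onM _ _ _ (fun z => (\adj (jac phi z)) k a) (flux h F k \o phi)) => //.
    by apply: smooth_on_adj => // i j; exact: smooth_jac.
  by apply: (@smooth_on_comp _ _ _ A B) => // j; exact: sphi.
have D a : partial a (flux g (F \o phi) a) y = Num.sg (\det (jac phi y)) *
    \sum_k partial a (fun z => (\adj (jac phi z)) k a * flux h F k (phi z)) y.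
  rewrite (@partial_eq_on _ _ A' _ (fun z => Num.sg (\det (jac phi y)) *
    \sum_k (\adj (jac phi z)) k a * flux h F k (phi z)))//; last first.
    by move=> z A'z; rewrite flux_iso ?sgA//; exact: A'A.
  rewrite partialZ; last first.
    by apply: differentiable_bigsum => k; exact: smooth_on_diff (sk a k) _ Ay.
  by rewrite partial_sum// => k; exact: smooth_on_diff (sk a k) _ Ay.
have E : \sum_k \sum_a partial a (fun z => (\adj (jac phi z)) k a * flux h F k (phi z)) y =
    \det (jac phi y) * \sum_k partial k (flux h F k) (phi y).
  by rewrite mulr_sumr; apply: eq_bigr => k _; rewrite (divergence_comp _ oA sphi (sflux k) phiB Ay dJ).
have E' : divflux g (F \o phi) y = Num.sg (\det (jac phi y)) * (\det (jac phi y) * divflux h F (phi y)).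
  by rewrite -E exchange_big mulr_sumr; apply: eq_bigr.
rewrite /lapc E'.
rewrite [Num.sg _ * _]mulrA -normrEsg dens_iso// invfM -mulrA.
by rewrite [X in - (_ * X)]mulrCA mulKf// normr_eq0.
Qed.

End isometry.

End chart_calculus.

(** * Chart independence, the Riemannian measure and integration by parts *)

Section riemannian.
Context {R : realType} {n : nat} {M : riemannianManifold R n}.
Implicit Types (x : M) (f g h u v : M -> R) (K : set M) (i j : chart_index M).

Local Notation ch f i := (f \o chart_inv i).

Lemma metric_smooth_metric i : smooth_metric (chart_img i) (metric i).
Proof.
split=> [a b|y yi]; first exact: metric_smooth.
by split; [exact: Defs.metric_sym|move=> v; exact: metric_pos].
Qed.

Lemma smooth_metric_subset (A B : set 'rV[R]_n) (g : 'rV[R]_n -> 'M[R]_n) : A `<=` B -> smooth_metric B g -> smooth_metric A g.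
Proof. by move=> AB [sg gp]; split=> [a b|y /AB]; [exact: smooth_on_subset (sg a b)|exact: gp]. Qed.

Definition overlap i j := chart i @` (chart_dom i `&` chart_dom j).

Lemma open_overlap i j : open (overlap i j).
Proof. by apply: open_chart_image; exact: chart_dom_open. Qed.

Arguments open_overlap : clear implicits.

Lemma overlap_img i j : overlap i j `<=` chart_img i.
Proof. by move=> _ [x [xi _] <-]; exists x. Qed.

Lemma overlap_trans i j y : overlap i j y -> chart_img j ((chart j \o chart_inv i) y).
Proof. by move=> [x [xi xj] <-] /=; rewrite chartK//; exists x. Qed.

Lemma overlap_metric i j : smooth_metric (overlap i j) (metric i).
Proof. exact: smooth_metric_subset (@overlap_img i j) (metric_smooth_metric i). Qed.

Lemma overlap_ch f i j y : overlap i j y -> (ch f j \o (chart j \o chart_inv i)) y = ch f i y.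
Proof. by move=> [x [xi xj] <-] /=; rewrite !chartK. Qed.

(** By [metric_compat] the transition maps are isometries, so [lapc_iso] moves from the preferred
    chart at [x] to any other. *)
Lemma laplacian_chart f i x : smooth f -> chart_dom i x ->
  laplacian f x = lapc (metric i) (ch f i) (chart i x).
Proof.
move=> sf xi; set j := chart_at x; have xj : chart_dom j x by exact: chart_at_dom.
have xA : overlap j i (chart j x) by exists x.
change (lapc (metric j) (ch f j) (chart j x) = lapc (metric i) (ch f i) (chart i x)).
rewrite -(lapc_eq_on _ (open_overlap j i) (@overlap_ch f j i) xA).
rewrite (lapc_iso (open_overlap j i) (@transition_smooth _ _ M j i) (@overlap_trans j i)
  (@metric_compat _ _ M j i) (overlap_metric j i) (metric_smooth_metric i) (open_chart_img i) (sf i) xA).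
by rewrite /= chartK.
Qed.

(** The function [<grad f, grad g>], read in the preferred chart. *)
Definition Gamma f g x : R :=
  gam (metric (chart_at x) (chart (chart_at x) x)) (ch f (chart_at x)) (ch g (chart_at x))
    (chart (chart_at x) x).

Lemma Gamma_chart f g i x : smooth f -> smooth g -> chart_dom i x ->
  Gamma f g x = gam (metric i (chart i x)) (ch f i) (ch g i) (chart i x).
Proof.
move=> sf sg xi; set j := chart_at x; have xj : chart_dom j x by exact: chart_at_dom.
have xA : overlap j i (chart j x) by exists x.
rewrite /Gamma -/j.
have := gam_iso (@transition_smooth _ _ M j i) (@overlap_trans j i)
  (@metric_compat _ _ M j i) (overlap_metric j i) (metric_smooth_metric i) (sf i) (sg i) xA.
rewrite /gam (pgrad_eq_on (open_overlap j i) (@overlap_ch f j i) xA).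
rewrite (pgrad_eq_on (open_overlap j i) (@overlap_ch g j i) xA) => ->.
by rewrite /= chartK.
Qed.

Lemma GammaC f g x : Gamma f g x = Gamma g f x.
Proof.
apply: gamC; apply: (metric_smooth_metric _).2; apply: chart_img_chart.
exact: chart_at_dom.
Qed.

Lemma smooth_laplacian f : smooth f -> smooth (laplacian f).
Proof.
move=> sf i; apply: (@smooth_on_eq _ _ _ (lapc (metric i) (ch f i))).
- exact: open_chart_img.
- move=> y yi; have := laplacian_chart sf (chart_inv_dom yi).
  by rewrite (chart_invK yi) => E; exact: (esym E).
by apply: smooth_lapc => //; [exact: open_chart_img|exact: metric_smooth_metric].
Qed.

Lemma smooth_Gamma f g : smooth f -> smooth g -> smooth (Gamma f g).
Proof.
move=> sf sg i; apply: (@smooth_on_eq _ _ _ (fun y => gam (metric i y) (ch f i) (ch g i) y)).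
- exact: open_chart_img.
- move=> y yi; have := Gamma_chart sf sg (chart_inv_dom yi).
  by rewrite (chart_invK yi) => E; exact: (esym E).
by apply: smooth_gam => //; [exact: open_chart_img|exact: metric_smooth_metric].
Qed.

Lemma pgrad_chart0 f K x i : closed K -> (forall x, ~ K x -> f x = 0) -> ~ K x -> chart_dom i x ->
  pgrad (ch f i) (chart i x) = 0.
Proof.
move=> cK fK xK xi.
rewrite (@pgrad_eq_on _ _ (chart i @` (chart_dom i `&` ~` K)) _ (cst 0)).
- by apply/colP => a; rewrite !mxE partial_cst.
- by apply: open_chart_image; exact: closed_openC.
- by move=> _ [z [zi zK] <-] /=; rewrite chartK// fK.
- by exists x.
Qed.

Lemma Gamma_supp f g K x : closed K -> (forall x, ~ K x -> g x = 0) -> ~ K x -> Gamma f g x = 0.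
Proof.
move=> cK gK xK; rewrite /Gamma /gam (pgrad_chart0 cK gK xK); last exact: chart_at_dom.
by rewrite mulmx0 mxE.
Qed.

Lemma laplacian_supp f K x : closed K -> (forall x, ~ K x -> f x = 0) -> ~ K x -> laplacian f x = 0.
Proof.
move=> cK fK xK; set i := chart_at x; have xi : chart_dom i x by exact: chart_at_dom.
change (lapc (metric i) (ch f i) (chart i x) = 0).
have oA : open (chart i @` (chart_dom i `&` ~` K)).
  by apply: open_chart_image; exact: closed_openC.
have smA : smooth_metric (chart i @` (chart_dom i `&` ~` K)) (metric i).
  apply: smooth_metric_subset (metric_smooth_metric i).
  by move=> _ [z [zi _] <-]; exists z.
have Ax : (chart i @` (chart_dom i `&` ~` K)) (chart i x) by exists x.
rewrite (lapc_eq_on _ oA (G := fun y => 0 * cst 0 y) _ Ax).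
  by rewrite (lapcZ _ oA smA) ?mul0r//; exact: smooth_on_cst.
by move=> _ [z [zi zK] <-] /=; rewrite chartK// fK// mul0r.
Qed.

Lemma laplacianD f g : smooth f -> smooth g -> laplacian (f \+ g) = laplacian f \+ laplacian g.
Proof.
move=> sf sg; apply/funext => x /=; set i := chart_at x.
have xi : chart_dom i x by exact: chart_at_dom.
change (lapc (metric i) (ch f i \+ ch g i) (chart i x) =
  lapc (metric i) (ch f i) (chart i x) + lapc (metric i) (ch g i) (chart i x)).
exact: (lapcD (open_chart_img i) (metric_smooth_metric i) (sf i) (sg i) (chart_img_chart xi)).
Qed.

Lemma laplacianZ (c : R) f : smooth f -> laplacian (fun x => c * f x) = (fun x => c * laplacian f x).
Proof.
move=> sf; apply/funext => x /=; set i := chart_at x.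
have xi : chart_dom i x by exact: chart_at_dom.
change (lapc (metric i) (fun y => c * ch f i y) (chart i x) = c * lapc (metric i) (ch f i) (chart i x)).
exact: (lapcZ c (open_chart_img i) (metric_smooth_metric i) (sf i) (chart_img_chart xi)).
Qed.

Lemma smooth_chart_diff f i x : smooth f -> chart_dom i x -> differentiable (ch f i) (chart i x).
Proof. by move=> sf xi; apply: smooth_on_diff (sf i) _ _; exact: chart_img_chart. Qed.

Lemma GammaDr f g h : smooth g -> smooth h -> Gamma f (g \+ h) = Gamma f g \+ Gamma f h.
Proof.
move=> sg sh; apply/funext => x; set i := chart_at x.
have xi : chart_dom i x by exact: chart_at_dom.
rewrite /Gamma /gam (pgradD (smooth_chart_diff sg xi) (smooth_chart_diff sh xi)).
by rewrite mulmxDr mxE.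
Qed.

Lemma test_Gamma f g : smooth f -> test_functions M g -> test_functions M (Gamma f g).
Proof.
move=> sf tg; have [K [cK clK gK]] := test_supp tg; apply/test_functionsP; split.
  by apply: smooth_Gamma => //; exact: test_smooth.
by exists K => // x; exact: Gamma_supp.
Qed.

Lemma test_laplacian f : test_functions M f -> test_functions M (laplacian f).
Proof.
move=> tf; have [K [cK clK fK]] := test_supp tf; apply/test_functionsP; split.
  by apply: smooth_laplacian; exact: test_smooth.
by exists K => // x; exact: laplacian_supp.
Qed.

Lemma testMl f g : smooth f -> test_functions M g -> test_functions M (f \* g).
Proof.
move=> sf tg; rewrite (_ : f \* g = g \* f); first exact: testM.
by apply/funext => x /=; rewrite mulrC.
Qed.

Lemma test_schrodinger V f : smooth V -> test_functions M f -> test_functions M (schrodinger V f).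
Proof.
move=> sV tf; apply: testD; first exact: test_laplacian.
exact: testMl.
Qed.

Lemma smooth_measurable f : smooth f -> measurable_fun [set: borel M] (f : borel M -> R).
Proof. by move=> sf; apply: borel_continuous; exact: smooth_fun_continuous. Qed.

Lemma lebn_compact_lty (K : set 'rV[R]_n) : compact K -> (lebn n K < +oo)%E.
Proof.
move=> cK; have [b [_ bP]] := compact_bounded cK.
apply: (@le_lt_trans _ _ (lebn n (ball 0 (`|b| + 2)))); last exact: lebn_ball_lty.
apply: le_measure; rewrite ?inE//.
- by apply: borel_closed; apply: compact_closed => //; exact: norm_hausdorff.
- by apply: borel_open; exact: ball_open.
move=> z zK; rewrite -ball_normE /ball_ /= sub0r normrN.
have /bP/(_ z zK) : b < `|b| + 1 by rewrite (le_lt_trans (ler_norm _))// ltrDl.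
by move=> /le_lt_trans; apply; rewrite ltrD2l ltr1n.
Qed.

(** [volE] speaks of sets only. It identifies [vol] on the chart domain with the image under
    [chart_inv] of the measure of density [dens], for which the integral formula is
    [density_pushforward]. *)
Lemma integral_vol_chart i (h : borel M -> \bar R) : measurable_fun setT h ->
  (forall x, ~ chart_dom i x -> h x = 0%E) ->
  (\int[vol M]_x h x =
   \int[lebn n]_(y in chart_img i) (h (chart_inv i y) * (dens (metric i) y)%:E))%E.
Proof.
move=> mh h0; have oI := open_chart_img i.
have mI : measurable (chart_img i : set (borel 'rV[R]_n)) by exact: borel_open.
pose w : borel 'rV[R]_n -> R := (dens (metric i)) \_ (chart_img i).
have mw : measurable_fun setT w.
  apply: (measurable_restrictT _ mI).1; apply: borel_continuous_on => //.
  by apply: smooth_on_continuous; apply: smooth_dens => //; exact: metric_smooth_metric.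
have w0 y : 0 <= w y by rewrite /w patchE; case: ifP => // _; exact: sqrtr_ge0.
pose phi : borel 'rV[R]_n -> borel M := fun y => if y \in chart_img i then chart_inv i y else point.
have mphi : measurable_fun setT phi.
  apply: measurable_to_borel => U oU; rewrite setTI.
  have oBU := open_preimage_on oI (@chart_inv_at_continuous _ _ _ i) oU.
  rewrite (_ : _ @^-1` _ = (chart_img i `&` chart_inv i @^-1` U) `|` (if (point : M) \in U then ~` chart_img i else set0)).
    apply: measurableU; first exact: borel_open.
    by case: ifP => // _; exact: measurableC.
  apply/seteqP; split => z; rewrite /phi /=.
    case: ifPn => [/set_mem Bz Uz|/negP zB Ua]; [by left|right].
    by rewrite mem_set//= => Bz; apply: zB; exact/mem_set.
  move=> [[Bz Uz]|]; first by rewrite mem_set.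
  by case: ifPn => // /set_mem Ua zB; rewrite memNset.
have [nu [nuE nuI]] := density_pushforward (lebn n) mw w0 mphi.
have volnu (A : set (borel M)) : measurable A -> A `<=` chart_dom i -> vol M A = nu A.
  move=> mA Ai; rewrite (volE mA Ai) nuE.
  have E y : (\1_(chart i @` A) y * Num.sqrt (\det (metric i y)))%:E =
      (((EFin \o w) \_ (phi @^-1` A)) y : \bar R).
    rewrite patchE indicE /phi /w/= patchE.
    have [yi|yi] := pselect (chart_img i y); last first.
      rewrite (memNset yi) memNset ?mul0r; first by case: ifP.
      by move=> [z /Ai zi zy]; apply: yi; exists z.
    rewrite (mem_set yi).
    have -> : (y \in chart i @` A) = (chart_inv i y \in A).
      apply/idP/idP; rewrite !inE; first by move=> [z Az <-]; rewrite chartK//; exact: Ai.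
      by move=> Az; exists (chart_inv i y) => //; exact: chart_invK.
    case: (boolP (chart_inv i y \in A)) => yA /=.
      by rewrite mul1r mem_set//=; rewrite mem_set//; exact/set_mem.
    rewrite mul0r memNset//= => H; move/negP: yA; apply; apply/mem_set.
    by move: H; rewrite (mem_set yi).
  rewrite (_ : (fun y => _) = ((EFin \o w) \_ (phi @^-1` A))); last exact/funext.
  have mpA : measurable (phi @^-1` A) by rewrite -[X in measurable X]setTI; exact: mphi.
  rewrite integral_rVE; first by rewrite [RHS]integral_mkcond.
    by apply: (measurable_restrictT _ mpA).1; apply/measurable_EFinP; exact: measurable_funTS.
  by move=> y; rewrite patchE; case: ifP => // _; rewrite lee_fin.
have hE (m : {measure set (borel M) -> \bar R}) :
    (\int[m]_x h x = \int[m]_(x in (chart_dom i : set (borel M))) h x)%E.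
  rewrite [RHS]integral_mkcond; apply: eq_integral => x _; rewrite patchE.
  by case: ifPn => // /negP H; apply: h0 => h'; apply: H; exact/mem_set.
rewrite hE (@eq_measure_integral _ _ _ _ nu); last by move=> A mA Ai; exact: volnu.
rewrite -hE nuI// [RHS]integral_mkcond; apply: eq_integral => y _.
by rewrite patchE /phi /w patchE; case: ifP => // _; rewrite mule0.
Qed.

Lemma vol_compact_chart_lty i K : compact K -> K `<=` chart_dom i ->
  (vol M K < +oo)%E.
Proof.
move=> cK Ki; have clK := manifold_compact_closed cK.
have mK : measurable (K : set (borel M)) by exact: borel_closed.
have -> : vol M K = (\int[vol M]_x (\1_(K : set (borel M)) x)%:E)%E.
  by rewrite integral_indic// setIT.
rewrite (@integral_vol_chart i); last 2 first.
- by apply/measurable_EFinP; exact: measurable_indic.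
- by move=> x xi; rewrite indicE memNset// => /Ki.
pose K' := chart i @` K; have cK' : compact K' by exact: compact_chart_image.
have K'i : K' `<=` chart_img i by move=> _ [x /Ki xi <-]; exists x.
have mK' : measurable (K' : set (borel 'rV[R]_n)).
  by apply: borel_closed; apply: compact_closed => //; exact: norm_hausdorff.
have sd := smooth_dens (open_chart_img i) (metric_smooth_metric i).
have [b bP] : exists b, forall z, K' z -> dens (metric i) z <= b.
  have : compact (dens (metric i) @` K').
    apply: continuous_compact => //; apply: continuous_in_subspaceT => z /set_mem zK.
    by apply: (smooth_on_continuous sd); apply/mem_set; exact: K'i.
  move=> /compact_bounded[b [_ bP]]; exists (b + 1) => z zK.
  rewrite (le_trans (ler_norm _))//; apply: bP; last by exists z.
  by rewrite ltrDl.
rewrite (_ : (\int[_]_(y in _) _ = \int[lebn n]_(y in K') (dens (metric i) y)%:E)%E); last first.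
  rewrite [LHS]integral_mkcond [RHS]integral_mkcond; apply: eq_integral => y _.
  rewrite !patchE; have [yK|yK] := pselect (K' y).
    rewrite (mem_set yK) (mem_set (K'i _ yK)) indicE mem_set ?mul1e//.
    by have [z Kz <-] := yK; rewrite chartK//; exact: Ki.
  rewrite (memNset yK); case: ifPn => // /set_mem yi; rewrite indicE memNset ?mul0e//.
  by move=> Ky; apply: yK; exists (chart_inv i y) => //; exact: chart_invK.
apply: (@le_lt_trans _ _ (\int[lebn n]_(y in K') (cst (`|b|)%:E y))%E).
  apply: ge0_le_integral => //.
  - by move=> y _; rewrite lee_fin sqrtr_ge0.
  - apply/measurable_EFinP.
    apply: (@measurable_funS _ _ (borel 'rV[R]_n) R (chart_img i : set (borel 'rV[R]_n))) K'i _; first by apply: borel_open; exact: open_chart_img.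
    apply: borel_continuous_on; first exact: open_chart_img.
    exact: smooth_on_continuous.
  by move=> y yK; rewrite lee_fin (le_trans (bP _ yK))// ler_norm.
by rewrite integral_cst// lte_mul_pinfty// ?lee_fin// lebn_compact_lty.
Qed.

Lemma test_integrable_vol f : test_functions M f -> (vol M).-integrable setT (EFin \o f).
Proof.
move: f; apply: test_ind => [x|f g _ _ fi gi].
  exists (chart_dom (chart_at x)).
    by split; [exact: chart_dom_open|exact: chart_at_dom].
  move=> f K tf cK Ki fK; have sf := test_smooth tf.
  have [b fb] := bounded_compact_support cK (smooth_fun_continuous sf) fK.
  apply: (@integrable_bounded_support _ (borel M) R (vol M) f K b) => //.
  - by apply: borel_closed; exact: manifold_compact_closed.
  - exact: vol_compact_chart_lty Ki.
  - exact: smooth_measurable.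
by rewrite (_ : EFin \o (f \+ g) = ((EFin \o f) \+ (EFin \o g))%E)//; exact: integrableD.
Qed.

Lemma test_L2 f : test_functions M f -> f \in Lfun (vol M) 2%:E.
Proof.
move=> tf; apply/L2P; split; first by apply: smooth_measurable; exact: test_smooth.
rewrite (_ : (fun x => _) = f \* f); last by apply/funext => x; rewrite expr2.
by apply: test_integrable_vol; apply: testM => //; exact: test_smooth.
Qed.

Lemma test_Rintegral_chart i f K : test_functions M f -> K `<=` chart_dom i ->
  (forall x, ~ K x -> f x = 0) ->
  \int[vol M]_x f x = \int[lebn n]_(y in chart_img i) (f (chart_inv i y) * dens (metric i) y).
Proof.
move=> tf Ki fK; rewrite /Rintegral; congr fine.
rewrite (@integral_vol_chart i) //.
- by apply/measurable_EFinP; apply: smooth_measurable; exact: test_smooth.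
- by move=> x xi; rewrite /= fK// => /Ki.
Qed.

Lemma test_RintegralD f g : test_functions M f -> test_functions M g ->
  \int[vol M]_x (f \+ g) x = \int[vol M]_x f x + \int[vol M]_x g x.
Proof. by move=> tf tg; rewrite RintegralD//; exact: test_integrable_vol. Qed.

(* Integration by parts; reduced by a partition of unity to the divergence of
   a compactly supported vector field in a single chart. *)
Lemma green u v : smooth u -> test_functions M v ->
  \int[vol M]_x (laplacian u x * v x) = \int[vol M]_x Gamma u v x.
Proof.
move=> su; move: v; apply: test_ind => [x|f g tf tg Hf Hg]; last first.
  have sl := smooth_laplacian su.
  rewrite (_ : (fun x => _) = (laplacian u \* f) \+ (laplacian u \* g)); last first.
    by apply/funext => x /=; rewrite mulrDr.
  rewrite test_RintegralD; [|exact: testMl|exact: testMl].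
  rewrite Hf Hg -test_RintegralD; [|exact: test_Gamma|exact: test_Gamma].
  have E := GammaDr u (test_smooth tf) (test_smooth tg).
  by apply: eq_Rintegral => y _; rewrite E.
set i := chart_at x; exists (chart_dom i).
  by split; [exact: chart_dom_open|exact: chart_at_dom].
move=> v K tv cK Ki vK; have sv := test_smooth tv; have clK := manifold_compact_closed cK.
have sl := smooth_laplacian su; have oI := open_chart_img i; have sm := metric_smooth_metric i.
rewrite (@test_Rintegral_chart i _ K (testMl sl tv))//; last by move=> y /vK /= ->; rewrite mulr0.
rewrite (@test_Rintegral_chart i _ K (test_Gamma su tv))//; last first.
  by move=> y yK; exact: Gamma_supp clK vK yK.
pose K' := chart i @` K; have cK' : compact K' by exact: compact_chart_image.
have K'i : K' `<=` chart_img i by move=> _ [z /Ki zi <-]; exists z.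
have V0 y : chart_img i y -> ~ K' y -> ch v i y = 0.
  by move=> yi yK; apply: vK => h; apply: yK; exists (chart_inv i y) => //; exact: chart_invK.
pose fl := flux (metric i) (ch u i).
have sfl a : smooth_on (chart_img i) (fl a) by exact: smooth_flux.
pose E a : 'rV[R]_n -> R := (fun y => ch v i y * fl a y) \_ (chart_img i).
have sE a : smooth_on setT (E a) /\ bounded_support (E a).
  apply: (smooth_ext0 (G0 := fun y => ch v i y * fl a y) oI cK' K'i).
  - exact: (@smooth_onM _ _ _ (ch v i) (fl a)).
  - by move=> y yi; rewrite /E patchE mem_set.
  - by move=> y yK; rewrite /E patchE; case: ifPn => // /set_mem yi; rewrite V0// mul0r.
(* After multiplication by the density, [laplacian u * v] becomes [P1], and by the product rule
   [Gamma u v] becomes [P1] plus the divergence of [E], whose integral is 0. *)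
pose P1 : 'rV[R]_n -> R := (fun y => - (divflux (metric i) (ch u i) y * ch v i y)) \_ (chart_img i).
have sP1 : smooth_on setT P1 /\ bounded_support P1.
  apply: (smooth_ext0 (G0 := fun y => - (divflux (metric i) (ch u i) y * ch v i y)) oI cK' K'i).
  - apply: smooth_onN => //; apply: (@smooth_onM _ _ _ (divflux (metric i) (ch u i))) => //.
    by apply: (@smooth_on_sum _ _ _ _ _ _ (fun a => partial a (fl a))) => // a _; exact: smooth_on_partial.
  - by move=> y yi; rewrite /P1 patchE mem_set.
  - by move=> y yK; rewrite /P1 patchE; case: ifPn => // /set_mem yi; rewrite V0// mulr0 oppr0.
have iP1 := integrable_bounded_support_rV (smooth_continuous sP1.1) sP1.2.
have iE a : (lebn n).-integrable setT (EFin \o partial a (E a)).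
  apply: integrable_bounded_support_rV; last by apply: bounded_support_partial; have [] := sE a.
  by apply: smooth_continuous; apply: smooth_on_partial; have [] := sE a.
have H1 y : ((fun y => laplacian u (chart_inv i y) * v (chart_inv i y) * dens (metric i) y) \_ (chart_img i)) y = P1 y.
  rewrite /P1 !patchE; case: ifPn => // /set_mem yi.
  rewrite (laplacian_chart su (chart_inv_dom yi)) (chart_invK yi) /lapc mulNr mulNr; congr (- _).
  have d0 : dens (metric i) y != 0 by rewrite gt_eqF// (dens_gt0 sm).
  rewrite -[RHS]/(divflux (metric i) (ch u i) y * v (chart_inv i y)); move: d0.
  by set dd := dens _ _; set DD := divflux _ _ _ => d0; field.
have H2 y : ((fun y => Gamma u v (chart_inv i y) * dens (metric i) y) \_ (chart_img i)) y =
    P1 y + \sum_a partial a (E a) y.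
  rewrite /P1 !patchE; case: ifPn => [/set_mem yi|/negP yi]; last first.
    have yK : (~` K') y by move=> /K'i /mem_set.
    rewrite big1 ?addr0// => a _.
    rewrite (@partial_eq_on _ _ (~` K') _ (cst 0) _ _ _ y yK) ?partial_cst//.
      by apply: closed_openC; apply: compact_closed => //; exact: norm_hausdorff.
    by move=> z zK; rewrite /E patchE; case: ifPn => // /set_mem zi; rewrite V0// mul0r.
  rewrite GammaC (Gamma_chart sv su (chart_inv_dom yi)) (chart_invK yi) gamE.
  have D a : partial a (E a) y = partial a (ch v i) y * fl a y + partial a (fl a) y * ch v i y.
    rewrite (@partial_eq_on _ _ (chart_img i) _ (ch v i \* fl a))//; last first.
      by move=> z zi; rewrite /E patchE mem_set.
    rewrite partialM; last 2 first.
    - exact: smooth_on_diff (sv i) _ yi.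
    - exact: smooth_on_diff (sfl a) _ yi.
    by rewrite addrC mulrC [X in _ + X]mulrC addrC mulrC; ring.
  rewrite (eq_bigr _ (fun a _ => D a)) big_split/= -mulr_suml.
  rewrite -/(divflux (metric i) (ch u i) y) addrCA addNr addr0 mulr_suml.
  by apply: eq_bigr => a _; rewrite /fl /flux -mulrA [_ * dens _ _]mulrC.
rewrite /Rintegral; congr fine.
rewrite [LHS]integral_mkcond [RHS]integral_mkcond.
transitivity (\int[lebn n]_y (P1 y)%:E)%E.
  by apply: eq_integral => y _; rewrite -H1 !patchE; case: ifP.
transitivity (\int[lebn n]_y ((P1 y)%:E + \sum_(a < n) (partial a (E a) y)%:E))%E; last first.
  apply: eq_integral => y _; rewrite sumEFin -EFinD -H2 !patchE; case: ifP => //.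
rewrite integralD//; last first.
  by apply: integrable_sum => // a _; exact: iE.
rewrite integral_sum//; rewrite big1 ?adde0// => a _.
by have [sEa bEa] := sE a; rewrite integral_partial0.
Qed.

(** In a chart, [f] times a bump and the density exceeds a positive constant on a ball. This
    positivity identifies the constants relating the integrals on [M0] and [M1]. *)
Lemma test_integral_gt0 f x : test_functions M f -> (forall y, 0 <= f y) -> 0 < f x ->
  0 < \int[vol M]_y f y.
Proof.
move=> tf f0 fx; have [e [K [[te e01] cK KO eK [U [oU Ux] eU]]]] := bump (@openT M) (I : setT x).
set i := chart_at x in KO; have xi : chart_dom i x by exact: chart_at_dom.
have sf := test_smooth tf; have se := test_smooth te.
have tfe : test_functions M (f \* e) by exact: testM.
have Ki : K `<=` chart_dom i by move=> y /KO[].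
have fe : \int[vol M]_y (f \* e) y <= \int[vol M]_y f y.
  apply: le_Rintegral => //; [exact: test_integrable_vol|exact: test_integrable_vol|].
  by move=> y _ /=; rewrite ler_piMr//; have /andP[] := e01 y.
apply: lt_le_trans fe.
have feK y : ~ K y -> (f \* e) y = 0 by move=> /eK /= ->; rewrite mulr0.
pose G y := ch (f \* e) i y * dens (metric i) y.
have oI := open_chart_img i; have sm := metric_smooth_metric i.
have sG : smooth_on (chart_img i) G.
  apply: (@smooth_onM _ _ _ (ch (f \* e) i)) => //; first exact: (test_smooth tfe).
  exact: smooth_dens.
pose a := chart i x; have ai : chart_img i a by exact: chart_img_chart.
have Ga : 0 < G a.
  by rewrite /G /= chartK// eU// mulr1 mulr_gt0// (dens_gt0 sm).
have cG : {for a, continuous G} by apply: (smooth_on_continuous sG); exact/mem_set.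
have [r /= r0 rP] : exists2 r : R, 0 < r & ball a r `<=` [set y | chart_img i y /\ G a / 2 < G y].
  have : \forall y \near a, chart_img i y /\ G a / 2 < G y.
    near=> y; split; first by near: y; exact: open_nbhs_nbhs.
    by near: y; apply: cvgr_gt cG _ _; rewrite ltr_pdivrMr// ltr_pMr// ltr1n.
  by move=> /nbhs_ballP[r]; exists r.
have ife := test_integrable_vol tfe.
rewrite -lte_fin /Rintegral fineK; last exact: integrable_fin_num.
rewrite (@integral_vol_chart i); last 2 first.
- by apply/measurable_EFinP; apply: smooth_measurable; exact: test_smooth.
- by move=> y yi; have /= -> := feK _ (contra_not (Ki y) yi).
apply: (@lt_le_trans _ _ (\int[lebn n]_(y in ball a r) (cst (G a / 2)%:E y))%E).
  rewrite integral_cst; last by apply: borel_open; exact: ball_open.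
  by rewrite [X in (_ * X)%E](lebn_ball a r0) -EFinM lte_fin mulr_gt0 ?divr_gt0// exprn_gt0// pmulrn_lgt0.
have mB : measurable (ball a r : set (borel 'rV[R]_n)) by apply: borel_open; exact: ball_open.
have mI : measurable (chart_img i : set (borel 'rV[R]_n)) by exact: borel_open.
have G0 y : 0 <= G y.
  by rewrite /G mulr_ge0 ?sqrtr_ge0//= mulr_ge0//; have /andP[] := e01 (chart_inv i y).
rewrite [leLHS]integral_mkcond [leRHS]integral_mkcond; apply: ge0_le_integral => //.
- by move=> y _; rewrite patchE; case: ifP => // _; rewrite lee_fin divr_ge0// ltW.
- by apply: (measurable_restrictT _ mB).1.
- apply: (measurable_restrictT _ mI).1; apply/measurable_EFinP.
  apply: borel_continuous_on => //; exact: smooth_on_continuous sG.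
move=> y _; rewrite !patchE; case: ifPn => [/set_mem/rP[yi Gy]|_].
  by rewrite mem_set// lee_fin ltW.
by case: ifP => // _; rewrite lee_fin; exact: G0.
Unshelve. all: by end_near. Qed.

End riemannian.

(** * Coverings and fibre sums *)

Section covering.
Context {R : realType} {n : nat} {M1 M0 : riemannianManifold R n} {p : M1 -> M0}.
Hypothesis Hp : riemannian_covering p.
Implicit Types (x : M1) (y : M0) (f g h : M1 -> R).

Local Notation ch f i := (f \o chart_inv i).

Let pc : continuous p. Proof. by have [[]] := Hp. Qed.

Definition section_on (U : set M0) (s : M0 -> M1) : Prop :=
  {in U, continuous s} /\ forall y, U y -> p (s y) = y.

(** Replaces the sheets by sections of [p]; their continuity is the openness of [p] on each
    sheet. *)
Lemma evenly_covered y0 : exists U : set M0, open U /\ U y0 /\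
  exists (I : Type) (W : I -> set M1) (s : I -> M0 -> M1),
    [/\ forall k, open (W k), trivIset setT W, p @^-1` U = \bigcup_k W k,
        forall k x, W k x -> s k (p x) = x &
        forall k, section_on U (s k) /\ forall y, U y -> W k (s k y)].
Proof.
have [[_ _ cov] _] := Hp.
have [U [oU Uy] [I [W [oW tW pU bW oimg]]]] := cov y0.
exists U; split=> //; split=> //.
have WU k x : W k x -> U (p x).
  by move=> Wx; have : (p @^-1` U) x by rewrite pU; exists k.
have /choice[s sP] (k : I) : exists s : M0 -> M1, forall y, U y -> W k (s y) /\ p (s y) = y.
  have /choice[s0 s0P] (y : M0) : exists x : M1, U y -> W k x /\ p x = y.
    have [Uy'|Uy'] := pselect (U y); last by exists point.
    by have [_ _ /(_ y Uy')[x Wx <-]] := bW k; exists x.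
  by exists s0.
have spK k x : W k x -> s k (p x) = x.
  move=> Wx; have [_ inj _] := bW k; have [Ws ps] := sP k _ (WU _ _ Wx).
  by apply: inj => //; exact/mem_set.
exists I, W, s; split=> // k; split; last by move=> y /(sP k)[].
split; last by move=> y /(sP k)[].
move=> y /set_mem Uy' Q; rewrite nbhsE => -[Q' [oQ' Q'y] Q'Q].
have oQW : open (p @` (Q' `&` W k)) by apply: (oimg k); [exact: openI|exact: subIsetr].
have [Ws ps] := sP k _ Uy'.
have : nbhs y (p @` (Q' `&` W k)).
  by apply: open_nbhs_nbhs; split=> //; exists (s k y).
by apply: filterS => _ [x [Q'x Wx] <-] /=; rewrite spK//; exact: Q'Q.
Qed.

Definition cover_dom (i : chart_index M1) (j : chart_index M0) :=
  chart i @` (chart_dom i `&` p @^-1` chart_dom j).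

Lemma open_cover_dom i j : open (cover_dom i j).
Proof.
apply: open_chart_image; apply: open_comp; last exact: chart_dom_open.
by move=> x _; exact: pc.
Qed.

Lemma smooth_lift (V : M0 -> R) : smooth V -> smooth (V \o p).
Proof.
move=> sV; apply: smooth_local => x; set i := chart_at x; set j := chart_at (p x).
exists i, (chart_dom i `&` p @^-1` chart_dom j); split.
- apply: open_preimage_on; [exact: chart_dom_open|by move=> z _; exact: pc|exact: chart_dom_open].
- by split; exact: chart_at_dom.
- exact: subIsetl.
have [_ /(_ i j)[sphi _]] := Hp.
apply: (@smooth_on_eq _ _ _ (ch V j \o (chart j \o p \o chart_inv i))).
- exact: open_cover_dom.
- by move=> _ [z [zi zj] <-] /=; rewrite chartK// chartK.
apply: (@smooth_on_comp _ _ _ _ (chart_img j)) => //; first exact: open_cover_dom.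
by move=> _ [z [zi zj] <-] /=; rewrite chartK//; exists (p z).
Qed.

Section local_section.
Variables (U : set M0) (s : M0 -> M1).
Hypotheses (oU : open U) (sU : section_on U s).
Variables (i : chart_index M1) (j : chart_index M0).

Definition sec_dom := chart j @` (chart_dom j `&` (U `&` s @^-1` chart_dom i)).
Definition sec_map := chart i \o s \o chart_inv j.

Local Notation B := sec_dom.
Local Notation psi := sec_map.
Local Notation phi := (chart j \o p \o chart_inv i).

Lemma open_sec_dom : open B.
Proof.
apply: open_chart_image; apply: open_preimage_on => //; first by case: sU.
exact: chart_dom_open.
Qed.

Lemma sec_dom_img z : B z -> chart_img j z.
Proof. by move=> [y [yj _] <-]; exists y. Qed.

Lemma sec_map_dom z : B z -> cover_dom i j (psi z).
Proof.
move=> [y [yj [Uy yi]] <-]; rewrite /psi /= chartK//; exists (s y) => //; split=> //=.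
by rewrite sU.2.
Qed.

Lemma sec_map_img z : B z -> chart_img i (psi z).
Proof. by move=> /sec_map_dom[x [xi _] <-]; exists x. Qed.

Lemma sec_mapK z : B z -> phi (psi z) = z.
Proof. by move=> [y [yj [Uy yi]] <-]; rewrite /psi /= !chartK// sU.2. Qed.

Lemma sec_map_continuous : {in B, continuous psi}.
Proof.
move=> z /set_mem Bz; have zj := sec_dom_img Bz.
have [y [yj [Uy yi]] yz] := Bz.
have e1 : chart_inv j z = y by rewrite -yz chartK.
apply: (@continuous_comp _ _ _ (s \o chart_inv j) (chart i)); last first.
  by apply: chart_at_continuous; apply/mem_set; rewrite /= e1.
apply: continuous_comp; first by apply: chart_inv_at_continuous; exact/mem_set.
by apply: sU.1; apply/mem_set; rewrite e1.
Qed.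

Lemma cover_metric : smooth_metric (cover_dom i j) (metric i).
Proof.
by apply: smooth_metric_subset (metric_smooth_metric i) => _ [x [xi _] <-]; exists x.
Qed.

(** A map that pulls one non-degenerate metric back to another has invertible differential. *)
Lemma cover_det z : cover_dom i j z -> \det (jac phi z) != 0.
Proof.
have [_ /(_ i j)[sphi iso]] := Hp.
exact: (iso_det_neq0 sphi iso cover_metric).
Qed.

Lemma smooth_sec_map : smooth_map_on B psi.
Proof.
have [_ /(_ i j)[sphi iso]] := Hp.
apply: (@smooth_inverse R n (cover_dom i j) B phi psi) => //.
- exact: open_cover_dom.
- exact: open_sec_dom.
- exact: sec_map_dom.
- exact: sec_mapK.
- exact: sec_map_continuous.
- exact: cover_det.
Qed.

Lemma isometric_sec_map : isometric_on B (metric j) (metric i) psi.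
Proof.
have [_ /(_ i j)[sphi iso]] := Hp.
move=> z Bz; have Az := sec_map_dom Bz; have dJ := cover_det Az.
have cz : {for z, continuous psi} by apply: sec_map_continuous; exact/mem_set.
have [dpsi Jpsi] := jac_inverse open_sec_dom sphi sec_map_dom sec_mapK Bz cz dJ.
rewrite jacobian_jac// Jpsi.
have := iso _ Az; rewrite jacobian_jac; last exact: smooth_map_diff sphi Az.
rewrite sec_mapK// => ->.
have Ju : jac phi (psi z) \in unitmx by rewrite unitmxE unitfE.
rewrite !mulmxA mulVmx// mul1mx -mulmxA -trmx_mul mulVmx// trmx1 mulmx1.
by [].
Qed.

Lemma sec_metric : smooth_metric B (metric j).
Proof. by apply: smooth_metric_subset (metric_smooth_metric j) => z; exact: sec_dom_img. Qed.

Lemma smooth_sec_chart h : smooth h -> smooth_on B (ch (h \o s) j).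
Proof.
move=> sh; apply: (@smooth_on_eq _ _ _ (ch h i \o psi)); first exact: open_sec_dom.
  by move=> _ [y [yj [Uy yi]] <-]; rewrite /psi /= chartK// chartK.
apply: (@smooth_on_comp _ _ _ B (chart_img i)) => //; first exact: open_sec_dom.
  exact: smooth_sec_map.
exact: sec_map_img.
Qed.

Lemma gam_sec h y : smooth h -> U y -> chart_dom j y -> chart_dom i (s y) ->
  gam (metric j (chart j y)) (ch (h \o s) j) (ch (h \o s) j) (chart j y) = Gamma h h (s y).
Proof.
move=> sh Uy yj yi; have Bz : B (chart j y) by exists y.
rewrite (Gamma_chart sh sh yi).
have := gam_iso smooth_sec_map sec_map_img isometric_sec_map sec_metric
  (metric_smooth_metric i) (sh i) (sh i) Bz.
have E : forall z, B z -> (ch h i \o psi) z = ch (h \o s) j z.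
  by move=> _ [w [wj [Uw wi]] <-]; rewrite /psi /= chartK// chartK.
rewrite /gam (pgrad_eq_on open_sec_dom E Bz) => ->.
by rewrite /psi /= chartK.
Qed.

End local_section.

Lemma smooth_section U s h j : open U -> section_on U s -> smooth h ->
  smooth_on (chart j @` (chart_dom j `&` U)) (ch (h \o s) j).
Proof.
move=> oU sU sh; apply: smooth_on_local => _ [y [yj Uy] <-].
exists (sec_dom U s (chart_at (s y)) j); last exact: smooth_sec_chart.
by exists y => //; split=> //; split=> //; exact: chart_at_dom.
Qed.

(** A sum over the points of the fibre where [h] is non-zero, with value 0 if these are infinitely
    many; for compactly supported [h] they are finite in number. *)
Definition fibre_sum h y : R := \sum_(x \in p @^-1` [set y]) h x.

(** Cover [K] by the sheets through points over [y0] and by the complement of that fibre. A finite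
    subcover selects finitely many sheets; the part of [K] outside them is compact with image
    missing [y0], and that image is removed from [U]. *)
Lemma fibre_sum_local (K : set M1) y0 : compact K ->
  exists (U : set M0) (m : nat) (s : 'I_m -> M0 -> M1), [/\ open U, U y0,
    forall k, section_on U (s k) &
    forall h, (forall x, ~ K x -> h x = 0) -> forall y, U y ->
      fibre_sum h y = \sum_(k < m) h (s k y)].
Proof.
move=> cK; have [U [oU [Uy0 [I [W [s [oW tW pU sK sP]]]]]]] := evenly_covered y0.
have /choice[b bP] (a : M1) : exists Qs : set M1 * (M0 -> M1), p a = y0 ->
    exists k, [/\ Qs.1 = W k, Qs.2 = s k & W k a].
  have [pa|pa] := pselect (p a = y0); last by exists (set0, fun=> point).
  have : (p @^-1` U) a by rewrite /= pa.
  by rewrite pU => -[k _ Wka]; exists (W k, s k) => _; exists k.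
pose f x := if `[< p x = y0 >] then (b x).1 else p @^-1` (~` [set y0]).
have := cK; rewrite compact_cover => /(_ M1 setT f) [||D _ KD].
- move=> x _; rewrite /f; case: asboolP => [px|_].
    by have [k [-> _ _]] := bP _ px; exact: oW.
  apply: open_comp; first by move=> z _; exact: pc.
  apply: closed_openC; apply: manifold_compact_closed; exact: compact_set1.
- move=> x Kx; exists x => //; rewrite /f; case: asboolP => [px|px] //.
  by have [k [-> _ Wx]] := bP _ px.
pose D0 := [seq x <- finmap.enum_fset D | `[< p x = y0 >]].
have D0P a : a \in D0 -> p a = y0 by rewrite mem_filter => /andP[/asboolP].
have D0u : uniq D0 by rewrite filter_uniq//; exact: finmap.fset_uniq.
pose K' := K `&` ~` (\bigcup_(a in [set` D0]) (b a).1).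
have cK' : compact K'.
  apply: compact_closedI => //; apply: open_closedC; apply: bigcup_open => a /D0P/bP[k [-> _ _]].
  exact: oW.
have cpK' : compact (p @` K').
  by apply: continuous_compact => //; exact: continuous_subspaceT.
have y0K' : ~ (p @` K') y0.
  move=> [x [Kx xW] px]; have [a aD fa] := KD _ Kx; move: fa; rewrite /f.
  case: asboolP => [pa Wx|pa] /=; last by rewrite px; exact.
  apply: xW; exists a => //=.
  by rewrite mem_filter; apply/andP; split=> //; exact/asboolP.
pose U' := U `&` ~` (p @` K').
exists U', (size D0), (fun k => (b (tnth (in_tuple D0) k)).2); split.
- by apply: openI => //; apply: closed_openC; exact: manifold_compact_closed.
- by [].
- move=> k; have /D0P/bP[l [_ -> _]] : tnth (in_tuple D0) k \in D0 by exact: mem_tnth.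
  have [[cs ps] _] := sP l; split.
    by move=> y /set_mem[Uy _]; apply: cs; exact/mem_set.
  by move=> y [Uy _]; exact: ps.
move=> h hK y [Uy yK'].
rewrite -(big_tnth _ _ D0 xpredT (fun a => h ((b a).2 y))).
rewrite -(big_map (fun a => (b a).2 y) xpredT h).
set L := map _ _.
(* Distinct points over [y0] lie in distinct, hence disjoint, sheets, so no point of the fibre is
   counted twice. *)
have uL : uniq L.
  rewrite map_inj_in_uniq// => a c /D0P pa /D0P pc'.
  have [k [_ -> Wa]] := bP _ pa; have [l [_ -> Wc]] := bP _ pc' => sab.
  have [_ Wk] := sP k; have [_ Wl] := sP l.
  have kl : k = l.
    apply: tW => //; exists (s k y); split; first exact: Wk.
    by rewrite sab; exact: Wl.
  by rewrite -(sK _ _ Wa) -(sK _ _ Wc) pa pc' kl.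
rewrite /fibre_sum (fsbig_seq _ _ uL).
apply/esym; apply: fsbig_widen.
  by move=> x /= /mapP[a /D0P pa ->]; have [k [_ -> _]] := bP _ pa; have [[_ ps] _] := sP k; exact: ps.
move=> x [/= px xL]; apply: contrapT => hx.
have Kx : K x by apply: contrapT => /hK.
have [[a aD Wx]|xW] := pselect ((\bigcup_(a in [set` D0]) (b a).1) x); last first.
  by apply: yK'; exists x.
apply: xL; apply/mapP; exists a => //.
have [k [Wk -> _]] := bP _ (D0P _ aD); rewrite Wk in Wx.
by rewrite -px sK.
Qed.

End covering.

Section psd.
Context {R : realType} {n : nat}.

(* Sum [0 <= Q (N v_k - c_k S)] over [k], where [Q] is the quadratic form of [G]. *)
Lemma psd_sum_le (G : 'M[R]_n) (m : nat) (c : 'I_m -> R) (v : 'I_m -> 'cV[R]_n) (e : R) :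
  G^T = G -> (forall u : 'cV[R]_n, 0 <= (u^T *m G *m u) 0 0) ->
  let S := \sum_k c k *: v k in let N := e ^+ 2 + \sum_k c k ^+ 2 in 0 < N ->
  (S^T *m G *m S) 0 0 <= N * \sum_k ((v k)^T *m G *m v k) 0 0.
Proof.
move=> Gs G0 S N N0.
pose b (u w : 'cV[R]_n) : R := (u^T *m G *m w) 0 0.
have bC u w : b u w = b w u.
  by rewrite /b -[in LHS](trmxK (_ *m _ *m _)) mxE !trmx_mul trmxK Gs mulmxA.
have bDr u w w' : b u (w + w') = b u w + b u w' by rewrite /b mulmxDr mxE.
have bZr u a w : b u (a *: w) = a * b u w by rewrite /b -scalemxAr mxE.
have bsum u : b u S = \sum_k c k * b u (v k).
  rewrite /S; elim/big_ind2: _ => [|x1 x2 y1 y2 <- <-|k _]; last exact: bZr.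
    by rewrite /b mulmx0 mxE.
  exact: bDr.
have key k : 0 <= N ^+ 2 * b (v k) (v k) - 2 * N * (c k * b S (v k)) + c k ^+ 2 * b S S.
  have := G0 (N *: v k + (- c k) *: S); rewrite -/(b _ _).
  rewrite bDr !bZr !(bC (_ + _)) !bDr !bZr (bC (v k) S); congr (_ <= _); ring.
have : 0 <= \sum_k (N ^+ 2 * b (v k) (v k) - 2 * N * (c k * b S (v k)) + c k ^+ 2 * b S S).
  by apply: sumr_ge0 => k _.
rewrite big_split/= -mulr_suml sumrB -!mulr_sumr -bsum.
rewrite -/(b S S); set T := \sum_k b (v k) (v k); set C := \sum_k c k ^+ 2 => h.
have CN : C <= N by rewrite /N lerDr sqr_ge0.
have SS : 0 <= b S S := G0 S.
rewrite -(ler_pM2l N0).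
have : C * b S S <= N * b S S by rewrite ler_wpM2r.
move: h; rewrite -/T; set q := b S S => h1 h2; lra.
Qed.

Lemma quadZ (G : 'M[R]_n) (c : R) (v : 'cV[R]_n) :
  ((c *: v)^T *m G *m (c *: v)) 0 0 = c ^+ 2 * (v^T *m G *m v) 0 0.
Proof.
have -> : (c *: v)^T = c *: v^T by rewrite linearZ.
by rewrite -!scalemxAl -scalemxAr scalerA mxE expr2.
Qed.

End psd.

(** * Fibre sums of test functions and their integrals *)

Section fibre_sums.
Context {R : realType} {n : nat} {M1 M0 : riemannianManifold R n} {p : M1 -> M0}.
Hypothesis Hp : riemannian_covering p.
Implicit Types (x : M1) (y : M0) (f g h : M1 -> R).

Local Notation ch f i := (f \o chart_inv i).
Local Notation fib := (@fibre_sum R n M1 M0 p).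

Let pc : continuous p. Proof. by have [[]] := Hp. Qed.

Lemma fibre_sum_supp (K : set M1) h y : (forall x, ~ K x -> h x = 0) -> ~ (p @` K) y -> fib h y = 0.
Proof.
move=> hK yK; rewrite /fibre_sum fsbig1// => x /= px; apply: hK => Kx; apply: yK.
by exists x.
Qed.

Lemma compact_image_p (K : set M1) : compact K -> compact (p @` K).
Proof. by move=> cK; apply: continuous_compact => //; exact: continuous_subspaceT. Qed.

Lemma test_fibre_sum h : test_functions M1 h -> test_functions M0 (fib h).
Proof.
move=> th; have [K [cK _ hK]] := test_supp th; have sh := test_smooth th.
apply/test_functionsP; split; last first.
  by exists (p @` K); [exact: compact_image_p|move=> y; exact: fibre_sum_supp].
apply: smooth_local => y0; have [U [m [s [oU Uy0 sU fibE]]]] := fibre_sum_local Hp y0 cK.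
set j := chart_at y0; exists j, (chart_dom j `&` U); split.
- by apply: openI => //; exact: chart_dom_open.
- by split=> //; exact: chart_at_dom.
- exact: subIsetl.
apply: (@smooth_on_eq _ _ _ (fun z => \sum_(k < m) ch (h \o s k) j z)).
- exact: open_chart_image.
- by move=> _ [y [yj Uy] <-] /=; rewrite chartK// fibE//; apply: eq_bigr => k _; rewrite chartK.
apply: (@smooth_on_sum _ _ _ _ _ _ (fun k => ch (h \o s k) j)); first exact: open_chart_image.
by move=> k _; exact: (smooth_section Hp).
Qed.

Lemma fibre_sumD f g : test_functions M1 f -> test_functions M1 g -> fib (f \+ g) = fib f \+ fib g.
Proof.
move=> tf tg; apply/funext => y /=.
have [K [cK _ fK]] := test_supp tf; have [L [cL _ gL]] := test_supp tg.
have [U [m [s [oU Uy sU fibE]]]] := fibre_sum_local Hp y (compactU cK cL).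
rewrite !fibE//.
- by rewrite big_split.
- by move=> x xKL; apply: gL => Lx; apply: xKL; right.
- by move=> x xKL; apply: fK => Kx; apply: xKL; left.
by move=> x xKL /=; rewrite fK ?gL ?addr0// => h; apply: xKL; [right|left].
Qed.

Lemma fibre_sumM (V : M0 -> R) h y : test_functions M1 h -> fib ((V \o p) \* h) y = V y * fib h y.
Proof.
move=> th; have [K [cK _ hK]] := test_supp th.
have [U [m [s [oU Uy sU fibE]]]] := fibre_sum_local Hp y cK.
rewrite !fibE//; last by move=> x /hK /= ->; rewrite mulr0.
by rewrite mulr_sumr; apply: eq_bigr => k _ /=; rewrite (sU k).2.
Qed.

Lemma fibre_sum_ge0 h y : test_functions M1 h -> (forall x, 0 <= h x) -> 0 <= fib h y.
Proof.
move=> th h0; have [K [cK _ hK]] := test_supp th.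
have [U [m [s [oU Uy sU fibE]]]] := fibre_sum_local Hp y cK.
by rewrite fibE//; apply: sumr_ge0 => k _.
Qed.

Lemma fibre_sum_gt0 h x : test_functions M1 h -> (forall x, 0 <= h x) -> 0 < h x -> 0 < fib h (p x).
Proof.
move=> th h0 hx; have [K [cK _ hK]] := test_supp th.
have [U [m [s [oU Uy sU fibE]]]] := fibre_sum_local Hp (p x) cK.
rewrite lt_neqAle fibre_sum_ge0// andbT eq_sym; apply/negP => /eqP fib0.
have h0' k : h (s k (p x)) = 0.
  move: fib0; rewrite fibE// => /eqP; rewrite psumr_eq0// => /allP H.
  by have /implyP/(_ isT)/eqP := H k (mem_index_enum k).
(* [fibre_sum_local] does not say that its sections pass through [x]; applying it to [h]
   concentrated at [x] shows that one of them does whenever [h x] is non-zero. *)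
pose h' z := if z == x then h z else 0.
have : fib h' (p x) = h x.
  rewrite /fibre_sum -(@fsbig_widen _ _ _ _ [set x])//.
  - by rewrite fsbig_set1 /h' eqxx.
  - by move=> _ ->.
  by move=> z [_ /= zx]; rewrite /h' ifF//; apply/eqP.
rewrite fibE//; last by move=> z /hK hz; rewrite /h' hz if_same.
rewrite big1 => [h0x|k _]; first by rewrite -h0x ltxx in hx.
by rewrite /h' h0' if_same.
Qed.

(* [sqrt (e^2 + F) - e] is smooth with compact support, unlike [sqrt F]. *)
Definition soft_sqrt (e : R) (F : M0 -> R) y : R := Num.sqrt (e ^+ 2 + F y) - e.

Arguments soft_sqrt : simpl never.

Section soft.
Variables (f : M1 -> R) (e : R).
Hypotheses (tf : test_functions M1 f) (e0 : 0 < e).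

Local Notation F := (fib (f \* f)).
Local Notation g := (soft_sqrt e F).

Let tff : test_functions M1 (f \* f).
Proof. by apply: testM => //; exact: test_smooth. Qed.

Let F0 y : 0 <= F y.
Proof. by apply: fibre_sum_ge0 => // x; rewrite /= -expr2 sqr_ge0. Qed.

Lemma soft_sqrt_sqr y : (g y + e) ^+ 2 = e ^+ 2 + F y.
Proof. by rewrite /soft_sqrt subrK sqr_sqrtr// addr_ge0 ?sqr_ge0. Qed.

Lemma soft_sqrt_ge0 y : 0 <= g y.
Proof.
rewrite subr_ge0; apply: (@le_trans _ _ (Num.sqrt (e ^+ 2))).
  by rewrite sqrtr_sqr ler_norm.
by rewrite ler_wsqrtr// lerDl.
Qed.

(** From [g^2 + 2 e g = F]: if [g] exceeded [F + 1] then [g^2 >= g > F]. The bound is independent of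
    [e]. *)
Lemma soft_sqrt_le y : g y <= F y + 1.
Proof.
have g0 := soft_sqrt_ge0 y; have := soft_sqrt_sqr y; have Fy := F0 y.
rewrite leNgt => gE; apply/negP => h.
move: g0 gE Fy h; set G := g y; set H := F y => G0 GE H0 h.
have h1 : 0 <= G * e by rewrite mulr_ge0// ltW.
have h2 : G <= G * G by rewrite ler_peMl//; lra.
move: GE; rewrite sqrrD expr2 => GE; lra.
Qed.

Lemma test_soft_sqrt : test_functions M0 g.
Proof.
have [sF [K cK FK]] := (test_functionsP _).1 (test_fibre_sum tff).
apply/test_functionsP; split; last first.
  by exists K => // y /FK Fy; rewrite /soft_sqrt Fy addr0 sqrtr_sqr ger0_norm ?subrr// ltW.
move=> j; have oI := open_chart_img j.
have s1 : smooth_on (chart_img j) (fun z => e ^+ 2 + ch F j z).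
  by apply: (@smooth_onD _ _ _ (cst (e ^+ 2)) (ch F j)) => //; exact: smooth_on_cst.
have s2 := smooth_on_sqrt oI s1 (fun z _ => ltr_wpDr (F0 (chart_inv j z)) (exprn_gt0 2 e0)).
by apply: (@smooth_onB _ _ _ (fun z => Num.sqrt (e ^+ 2 + ch F j z)) (cst e)) => //; exact: smooth_on_cst.
Qed.

(** Differentiating [(g + e)^2 = e^2 + \sum_k f_k^2], with [f_k] the compositions of [f] with the
    local sections, gives [(g + e) grad g = \sum_k f_k grad f_k]. Apply [psd_sum_le] with
    [N = (g + e)^2] and cancel [N]; sections are isometries, so the gradients on [M0] are those on
    [M1]. *)
Lemma Gamma_soft_sqrt_le y : Gamma g g y <= fib (Gamma f f) y.
Proof.
have [K [cK clK fK]] := test_supp tf; have sf := test_smooth tf.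
have [U [m [s [oU Uy sU fibE]]]] := fibre_sum_local Hp y cK.
have sg := test_smooth test_soft_sqrt.
set j := chart_at y; have yj : chart_dom j y by exact: chart_at_dom.
pose B := chart j @` (chart_dom j `&` U); have oB : open B by exact: open_chart_image.
have By : B (chart j y) by exists y.
pose fk k := ch (f \o s k) j; pose z := chart j y.
have sfk k : smooth_on B (fk k) by exact: (smooth_section Hp).
rewrite (Gamma_chart sg sg yj) fibE; [|by move=> x; exact: Gamma_supp clK fK|by []].
have FE w : U w -> F w = \sum_k (f (s k w)) ^+ 2.
  by move=> Uw; rewrite fibE// => x xK; rewrite /= fK// mulr0.
have gE w : B w -> ((fun w => ch g j w + e) \* (fun w => ch g j w + e)) w =
    (cst (e ^+ 2) \+ (fun w => \sum_k (fk k \* fk k) w)) w.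
  move=> [u [uj Uu] <-]; rewrite /= -expr2 chartK// soft_sqrt_sqr FE//; congr (_ + _).
  by apply: eq_bigr => k _; rewrite /fk /= chartK// expr2.
have dg : differentiable (ch g j) z by exact: smooth_on_diff (sg j) _ (chart_img_chart yj).
have dge : differentiable (fun w => ch g j w + e) z.
  by apply: (@differentiableD _ _ _ (ch g j) (cst e)).
have dfk k : differentiable (fk k) z by exact: smooth_on_diff (sfk k) _ By.
pose S := \sum_k fk k z *: pgrad (fk k) z.
have SE : (g y + e) *: pgrad (ch g j) z = S.
  apply/colP => a; rewrite !mxE /S summxE.
  have E0 := @partial_eq_on _ _ B _ _ a oB gE z By.
  have E1 : partial a ((fun w => ch g j w + e) \* (fun w => ch g j w + e)) z =
      2 * ((g y + e) * partial a (ch g j) z).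
    rewrite (partialM a dge dge) -mulr2n [RHS]mulr_natl.
    have -> : ch g j z = g y by rewrite /z /= chartK.
    have -> : partial a (fun w => ch g j w + e) z = partial a (ch g j) z.
      have := @partialD _ _ a (ch g j) (cst e) z dg (differentiable_cst _ _).
      by rewrite partial_cst addr0.
    by [].
  have dff k : differentiable (fk k \* fk k) z by exact: differentiableM.
  have E2 : partial a (cst (e ^+ 2) \+ (fun w => \sum_k (fk k \* fk k) w)) z =
      2 * \sum_k fk k z * partial a (fk k) z.
    rewrite partialD//; last exact: differentiable_bigsum.
    rewrite partial_cst add0r (@partial_sum _ _ _ _ (fun k => fk k \* fk k))//.
    rewrite mulr_sumr; apply: eq_bigr => k _.
    by rewrite partialM// -mulr2n mulr_natl.
  move: E0; rewrite E1 E2 => /(mulfI (_ : 2 != 0)) ->//.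
  by apply: eq_bigr => k _; rewrite !mxE.
pose G := invmx (metric j z).
have pm := (metric_smooth_metric j).2 _ (chart_img_chart yj).
have Gs : G^T = G by rewrite /G trmx_inv; have [-> _] := pm.
have G0 (u : 'cV[R]_n) : 0 <= (u^T *m G *m u) 0 0 by exact: posdef_inv_ge0.
have CE : e ^+ 2 + \sum_k fk k z ^+ 2 = (g y + e) ^+ 2.
  by rewrite soft_sqrt_sqr FE//; congr (_ + _); apply: eq_bigr => k _; rewrite /fk /= chartK.
have N0 : 0 < (g y + e) ^+ 2 by rewrite exprn_gt0// ltr_wpDl// soft_sqrt_ge0.
have := @psd_sum_le _ _ G m (fun k => fk k z) (fun k => pgrad (fk k) z) e Gs G0.
rewrite /= CE -/S => /(_ N0); rewrite -SE.
rewrite quadZ ler_pM2l// => h.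
apply: le_trans h _; rewrite le_eqVlt; apply/orP; left; apply/eqP; apply: eq_bigr => k _.
by have := gam_sec Hp oU (sU k) sf Uy yj (chart_at_dom (s k y)); rewrite /gam => <-.
Qed.

End soft.

(** The factor between the two integrals for supports near [x]; it may a priori vary with [x],
    because [change_of_variables] does not determine its constant. *)
Definition fibre_const (x : M1) (c : R) := exists O : set M1, [/\ open O, O x &
  forall h K, test_functions M1 h -> compact K -> K `<=` O -> (forall z, ~ K z -> h z = 0) ->
    \int[vol M0]_y fib h y = c * \int[vol M1]_z h z].

(** A support near [x1] lies in one sheet, so the fibre sum over [U] is composition with one
    section. In charts the section is an isometry, its Jacobian is the quotient of the two
    densities, and [change_of_variables] applies. *)
Lemma fibre_const_ex x1 : exists c, fibre_const x1 c.
Proof.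
have [U [oU [Uy [I [W [s [oW tW pU sK sP]]]]]]] := evenly_covered Hp (p x1).
have [k _ Wx] : (\bigcup_k W k) x1 by rewrite -pU.
have [sU sW] := sP k; pose sg := s k; pose Q := W k.
have QU x : Q x -> U (p x) by move=> Qx; have : (p @^-1` U) x by rewrite pU; exists k.
set i := chart_at x1; set j := chart_at (p x1).
have xi : chart_dom i x1 by exact: chart_at_dom.
have yj : chart_dom j (p x1) by exact: chart_at_dom.
pose B := sec_dom U sg i j; pose psi := sec_map sg i j.
pose phi := chart j \o p \o chart_inv i.
pose A := chart i @` (chart_dom i `&` (Q `&` p @^-1` chart_dom j)).
have oB : open B := open_sec_dom oU sU (i := i) (j := j).
have oQp : open (Q `&` p @^-1` chart_dom j).
  apply: open_preimage_on; [exact: oW|by move=> z _; exact: pc|exact: chart_dom_open].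
have oA : open A by exact: open_chart_image.
have psiA z : B z -> A (psi z).
  move=> [y [yj' [Uy' yi]] <-]; rewrite /psi /sec_map /= chartK//.
  exists (sg y) => //; split=> //; split; first exact: sW.
  by rewrite /= sU.2.
have phiB (x : 'rV[R]_n) : A x -> B (phi x).
  move=> [w [wi [Qw wj]] <-]; rewrite /phi /= chartK//; exists (p w) => //; split=> //.
  by split; [exact: QU|rewrite /= /sg sK].
have phiK z : B z -> phi (psi z) = z by exact: sec_mapK.
have psiK (x : 'rV[R]_n) : A x -> psi (phi x) = x.
  by move=> [w [wi [Qw wj]] <-]; rewrite /psi /sec_map /phi /= !chartK// /sg sK.
have cphi : {in A, continuous phi}.
  move=> _ /set_mem[w [wi [Qw wj]] <-].
  apply: (@continuous_comp _ _ _ (p \o chart_inv i) (chart j)); last first.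
    by apply: chart_at_continuous; apply/mem_set; rewrite /= chartK.
  apply: continuous_comp; last exact: pc.
  by apply: chart_inv_at_continuous; apply/mem_set; exact: chart_img_chart.
have spsi : smooth_map_on B psi by exact: (smooth_sec_map Hp).
have iso := isometric_sec_map Hp oU sU (i := i) (j := j).
have smB := @sec_metric _ _ M1 M0 U sg i j.
have detB z : B z -> \det (jac psi z) != 0 by exact: (iso_det_neq0 spsi iso smB).
have Aa : A (chart i x1) by exists x1.
have [r [c [r0 c0 rA cE]]] := change_of_variables oA oB spsi psiA phiB phiK psiK cphi detB Aa.
exists c, (chart_dom i `&` chart i @^-1` ball (chart i x1) r); split.
- exact: open_chart_preimage (ball_open _ _).
- by split=> //; exact: ballxx.
move=> h K th cK KO hK; have sh := test_smooth th.
have Ki : K `<=` chart_dom i by move=> x /KO[].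
have KA x : K x -> Q x /\ chart_dom j (p x).
  move=> /KO[xi' /rA[w [wi [Qw wj]]] wx].
  by have <- : w = x by rewrite -(chartK wi) -(chartK xi') wx.
have pKj : p @` K `<=` chart_dom j by move=> _ [x /KA[_ xj] <-].
have fibU y : U y -> fib h y = h (sg y).
  move=> Uy'; rewrite /fibre_sum.
  rewrite -(@fsbig_widen _ _ _ _ [set sg y])//.
  - by rewrite fsbig_set1.
  - by move=> _ -> /=; rewrite /sg sU.2.
  move=> x [/= px xs]; apply: hK => /KA[Qx _]; apply: xs; rewrite -px.
  by rewrite /sg sK.
have tfib := test_fibre_sum th.
rewrite (@test_Rintegral_chart _ _ M0 j _ (p @` K))//; last by move=> y; exact: fibre_sum_supp.
rewrite (@test_Rintegral_chart _ _ M1 i _ K)//.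
pose G : borel 'rV[R]_n -> \bar R := (fun x : 'rV[R]_n => (h (chart_inv i x) * dens (metric i) x)%:E) \_ (chart_img i).
have mI : measurable (chart_img i : set (borel 'rV[R]_n)) by apply: borel_open; exact: open_chart_img.
have mG : measurable_fun setT G.
  apply: (measurable_restrictT _ mI).1; apply/measurable_EFinP.
  apply: borel_continuous_on; first exact: open_chart_img.
  apply: smooth_on_continuous; apply: (@smooth_onM _ _ _ (ch h i)); [exact: open_chart_img|exact: sh|].
  by apply: smooth_dens; [exact: open_chart_img|exact: metric_smooth_metric].
have G0 (x : 'rV[R]_n) : ~ (ball (chart i x1) r : set 'rV[R]_n) x -> G x = 0%E.
  move=> xb; rewrite /G patchE; case: ifPn => // /set_mem xi'.
  rewrite hK ?mul0r// => /KO[_ /=]; rewrite chart_invK//.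
have := cE G mG G0.
rewrite (_ : (\int[lebn n]_x G x = \int[lebn n]_(x in chart_img i) (h (chart_inv i x) * dens (metric i) x)%:E)%E); last first.
  by rewrite [RHS]integral_mkcond.
rewrite (_ : (\int[lebn n]_(z in B) _ = \int[lebn n]_(z in chart_img j) (fib h (chart_inv j z) * dens (metric j) z)%:E)%E).
  move=> E; rewrite /Rintegral E fineM//.
  have it := test_integrable_vol th.
  have := integrable_fin_num measurableT it.
  rewrite (@integral_vol_chart _ _ M1 i)//.
  - by apply/measurable_EFinP; exact: smooth_measurable.
  - by move=> x xi'; rewrite /= hK// => /Ki.
rewrite [LHS]integral_mkcond [RHS]integral_mkcond; apply: eq_integral => z _; rewrite !patchE.
have [Bz|Bz] := pselect (B z).
  have zj := sec_dom_img Bz; rewrite (mem_set Bz) (mem_set zj).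
  have psz : chart_img i (psi z) by have [w [wi _] <-] := psiA _ Bz; exists w.
  rewrite /G patchE (mem_set psz) -EFinM; congr (_%:E).
  rewrite (dens_iso spsi iso Bz) mulrAC -mulrA; congr (_ * _).
  have [y [yj' [Uy' yi]] <-] := Bz.
  by rewrite /psi /sec_map /= !chartK// fibU.
rewrite (memNset Bz); case: ifPn => // /set_mem zj.
rewrite (_ : fib h (chart_inv j z) = 0) ?mul0r//.
apply: (fibre_sum_supp hK) => -[x Kx px]; apply: Bz.
have [Qx _] := KA _ Kx; exists (p x); last by rewrite px chart_invK.
split; first by rewrite px; exact: chart_inv_dom.
by split; [exact: QU|rewrite /= /sg sK//; exact: Ki].
Qed.

Lemma fibre_const_uniq x c c' : fibre_const x c -> fibre_const x c' -> c = c'.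
Proof.
move=> [ O1 [oO1 O1x H1]] [ O2 [oO2 O2x H2]].
have [e [K [[te e01] cK KO eK [U [oU Ux] eU]]]] := bump (openI oO1 oO2) (conj O1x O2x).
have e1 : 0 < e x by rewrite eU.
have e0 z : 0 <= e z by have /andP[] := e01 z.
have L1 := test_integral_gt0 te e0 e1.
have K1 : K `<=` O1 by move=> z /KO[[]].
have K2 : K `<=` O2 by move=> z /KO[[]].
have := H1 e K te cK K1 eK; rewrite (H2 e K te cK K2 eK).
by move=> /(mulIf (_ : _ != 0)) ->//; rewrite gt_eqF.
Qed.

(** The local factor is unique at each point, so the points sharing a given value form an open and
    closed set. Its sign follows from a bump function, both of whose integrals are positive. *)
Lemma integral_fibre_sum : connected [set: M1] -> exists2 c : R, 0 < c &
  forall h, test_functions M1 h -> \int[vol M0]_y fib h y = c * \int[vol M1]_x h x.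
Proof.
move=> con; have [c cP] := fibre_const_ex point.
have near x a : fibre_const x a -> exists O : set M1, [/\ open O, O x & forall z, O z -> fibre_const z a].
  by move=> [ O [oO Ox H]]; exists O; split=> // z Oz; exists O.
have oC a : open [set x | fibre_const x a].
  rewrite openE => x /near[ O [oO Ox H]]; rewrite /interior/=.
  by apply: filterS H _; exact: open_nbhs_nbhs.
have oC' : open (~` [set x | fibre_const x c]).
  rewrite openE => x xc; have [a aP] := fibre_const_ex x; have [ O [oO Ox H]] := near _ _ aP.
  have : nbhs x O by exact: open_nbhs_nbhs.
  apply: filterS => z Oz /= zc; apply: xc => /=.
  by rewrite (fibre_const_uniq zc (H _ Oz)).
have all_c : [set x | fibre_const x c] = [set: M1].
  apply: con.
  - by exists point.
  - by exists [set x | fibre_const x c]; rewrite ?setTI.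
  - by exists [set x | fibre_const x c]; rewrite ?setTI//; rewrite -[X in closed X]setCK; exact: open_closedC.
have key h : test_functions M1 h -> \int[vol M0]_y fib h y = c * \int[vol M1]_x h x.
  move: h; apply: test_ind => [x|f g tf tg Hf Hg].
    have [ O [oO Ox H]] : fibre_const x c by have : [set: M1] x by []; rewrite -all_c.
    by exists O => // h K th cK KO hK; exact: H hK.
  rewrite fibre_sumD// test_RintegralD; [|exact: test_fibre_sum|exact: test_fibre_sum].
  by rewrite Hf Hg test_RintegralD// mulrDr.
exists c => //.
have [e [K [[te e01] cK KO eK [U [oU Ux] eU]]]] := bump (@openT M1) (I : setT point).
have e1 : 0 < e point by rewrite eU.
have e0 z : 0 <= e z by have /andP[] := e01 z.
have L1 := test_integral_gt0 te e0 e1.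
have L0 := test_integral_gt0 (test_fibre_sum te) (fun y => fibre_sum_ge0 y te e0) (fibre_sum_gt0 te e0 e1).
by move: L0; rewrite key// pmulr_lgt0.
Qed.

End fibre_sums.

(** * Comparison of the quadratic forms *)

Section schrodinger_form.
Context {R : realType} {n : nat} {M : riemannianManifold R n} {V : M -> R}.
Hypothesis sV : smooth V.
Implicit Types (f g : M -> R).

Local Notation D := (test_functions M).
Local Notation S := (schrodinger V).

Lemma schrodingerD f g : D f -> D g -> S (f \+ g) = S f \+ S g.
Proof.
move=> /test_smooth sf /test_smooth sg; apply/funext => x.
by rewrite /schrodinger laplacianD//= mulrDr addrACA.
Qed.

Lemma schrodingerZ c f : D f -> S (fun x => c * f x) = (fun x => c * S f x).
Proof.
move=> /test_smooth sf; apply/funext => x.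
by rewrite /schrodinger laplacianZ//= mulrDr mulrCA.
Qed.

Lemma schrodinger_form f g : D f -> D g ->
  dotL2 (vol M) (S f) g = \int[vol M]_x Gamma f g x + \int[vol M]_x ((V \* (f \* g)) x).
Proof.
move=> tf tg; have [sf sg] := conj (test_smooth tf) (test_smooth tg).
rewrite -green// -RintegralD//; last 2 first.
- by apply: test_integrable_vol; apply: testMl => //; exact: smooth_laplacian.
- by apply: test_integrable_vol; apply: testMl => //; exact: testM.
by apply: eq_Rintegral => x _; rewrite /schrodinger /= mulrDl mulrA.
Qed.

Lemma schrodinger_sym f g : D f -> D g -> dotL2 (vol M) (S f) g = dotL2 (vol M) f (S g).
Proof.
move=> tf tg.
have E1 : \int[vol M]_x Gamma f g x = \int[vol M]_x Gamma g f x.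
  by apply: eq_Rintegral => x _; exact: GammaC.
have E2 : \int[vol M]_x (V \* (f \* g)) x = \int[vol M]_x (V \* (g \* f)) x.
  by apply: eq_Rintegral => x _ /=; rewrite [f x * _]mulrC.
by rewrite [RHS]dotC (schrodinger_form tf tg) (schrodinger_form tg tf) E1 E2.
Qed.

Lemma form_geE lam : form_ge (vol M) D S lam <-> forall f, D f ->
  0 <= \int[vol M]_x Gamma f f x + \int[vol M]_x (((fun x => V x + - lam) \* (f \* f)) x).
Proof.
have E f : D f -> \int[vol M]_x Gamma f f x + \int[vol M]_x (((fun x => V x + - lam) \* (f \* f)) x) =
    dotL2 (vol M) (S f) f - lam * dotL2 (vol M) f f.
  move=> tf; have sf := test_smooth tf; have tff : D (f \* f) by exact: testM.
  rewrite schrodinger_form// -addrA; congr (_ + _).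
  rewrite /dotL2 -RintegralZl//; last exact: test_integrable_vol tff.
  rewrite -RintegralB//.
  - by apply: eq_Rintegral => x _ /=; rewrite mulrDl mulNr.
  - by apply: test_integrable_vol; exact: testMl.
  - exact: test_integrable_vol (testZ lam tff).
by split=> H f tf; have := H f tf; rewrite ?E ?subr_ge0.
Qed.

Let S_L2 f : D f -> S f \in Lfun (vol M) 2.
Proof. by move=> tf; apply: test_L2; exact: test_schrodinger. Qed.

Lemma schrodinger_resolvent lam l : form_ge (vol M) D S lam -> l < lam ->
  resolvent_set (vol M) (friedrichs (vol M) D S) l.
Proof.
move=> q llam; apply: form_ge_resolvent q llam.
- exact: test0.
- by move=> f g; exact: testD.
- by move=> c f; exact: testZ.
- by move=> f; exact: test_L2.
- exact: S_L2.
- exact: schrodingerD.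
- exact: schrodingerZ.
- exact: schrodinger_sym.
Qed.

Lemma bottom_spectrum_le l : bounded_below (vol M) D S ->
  (forall lam, l < lam -> ~ form_ge (vol M) D S lam) -> (bottom_spectrum S <= l%:E)%E.
Proof.
move=> bS q; apply: ereal_inf_spectrum_le bS q.
- exact: test0.
- by move=> f g; exact: testD.
- by move=> c f; exact: testZ.
- by move=> f; exact: test_L2.
- exact: S_L2.
- exact: schrodingerD.
- exact: schrodingerZ.
- exact: schrodinger_sym.
Qed.

End schrodinger_form.

Section covering_form.
Context {R : realType} {n : nat} {M1 M0 : riemannianManifold R n} {p : M1 -> M0}.
Hypotheses (Hp : riemannian_covering p) (con : connected [set: M1]).
Context {V : M0 -> R}.
Hypothesis sV : smooth V.

Lemma form_ge_lift lam :
  form_ge (vol M0) (test_functions M0) (schrodinger V) lam ->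
  form_ge (vol M1) (test_functions M1) (schrodinger (V \o p)) lam.
Proof.
move=> /(form_geE sV) q0; apply/(form_geE (smooth_lift Hp sV)) => f tf.
have sf := test_smooth tf.
pose W y := V y + - lam; have sW : smooth W by apply: smoothD => //; exact: smooth_cst.
pose F := @fibre_sum _ _ M1 M0 p (f \* f).
have tff : test_functions M1 (f \* f) by exact: testM.
have tF : test_functions M0 F by exact: (test_fibre_sum Hp).
have tG : test_functions M1 (Gamma f f) by exact: test_Gamma.
have [K [cK _ fK]] := test_supp tff.
have cpK := compact_image_p Hp cK.
have [eta teta [eta0 eta1]] := cutoff cpK.
have FK y : ~ (p @` K) y -> F y = 0 by exact: fibre_sum_supp.
have F0 y : 0 <= F y.
  by apply: (fibre_sum_ge0 Hp) => // x; rewrite /= -expr2 sqr_ge0.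
pose A := \int[vol M0]_y @fibre_sum _ _ M1 M0 p (Gamma f f) y + \int[vol M0]_y (W \* F) y.
(* The majorant of [- W g], the same for all [e]; [W * W + 1] stands for the absolute value of [W],
   which would not be smooth. *)
have tb : test_functions M0 ((F \+ eta) \* (fun y => W y * W y + 1)).
  apply: testM; first exact: testD.
  by apply: smoothD; [exact: smoothM|exact: smooth_cst].
pose C := \int[vol M0]_y ((F \+ eta) \* (fun y => W y * W y + 1)) y.
(* Replacing [g^2] by [F - 2 e g] in the form inequality leaves the error [- 2 e W g], at most [2 e]
   times the integrand of [C]. *)
have step e : 0 < e -> 0 <= A + 2 * e * C.
  move=> e0; pose g := soft_sqrt e F.
  have tg : test_functions M0 g by exact: (test_soft_sqrt Hp).
  have sg := test_smooth tg.
  apply: le_trans (q0 g tg) _; rewrite /A -addrA; apply: lerD.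
    apply: le_Rintegral => //.
    - by apply: test_integrable_vol; exact: test_Gamma.
    - by apply: test_integrable_vol; exact: (test_fibre_sum Hp).
    - by move=> y _; exact: (Gamma_soft_sqrt_le Hp).
  have tgg : test_functions M0 (g \* g) by exact: testM.
  rewrite /C -RintegralZl//; last exact: test_integrable_vol tb.
  rewrite -RintegralD//; last 2 first.
  - by apply: test_integrable_vol; exact: testMl.
  - exact: test_integrable_vol (testZ _ tb).
  apply: le_Rintegral => //.
  - by apply: test_integrable_vol; exact: testMl.
  - by apply: test_integrable_vol; apply: testD; [exact: testMl|exact: testZ].
  move=> y _ /=; rewrite -/(W y).
  have g2 : (g y + e) ^+ 2 = e ^+ 2 + F y by exact: (soft_sqrt_sqr Hp).
  have g0 : 0 <= g y by exact: (soft_sqrt_ge0 Hp).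
  have gF : g y <= F y + eta y.
    have [yK|yK] := pselect ((p @` K) y).
      by apply: le_trans (soft_sqrt_le Hp tf e0 y) _; rewrite lerD2l; exact: eta1.
    by rewrite /g /soft_sqrt FK// addr0 sqrtr_sqr gtr0_norm// subrr add0r.
  have gg : g y * g y = F y - 2 * e * g y.
    by move: g2; rewrite sqrrD expr2 => E; move: E; rewrite mulr2n; lra.
  rewrite gg mulrBr lerD2l.
  have Wb : - W y <= W y * W y + 1 by nra.
  have W1 : 0 <= W y * W y + 1 by rewrite addr_ge0// -expr2 sqr_ge0.
  move: (W y) (g y) (F y + eta y) g0 gF Wb W1 => w G H G0 GH wb w1.
  have h1 : - w * G <= (w * w + 1) * G by rewrite ler_wpM2r.
  have h2 : G * (w * w + 1) <= H * (w * w + 1) by rewrite ler_wpM2r.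
  have : e * (- w * G) <= e * (H * (w * w + 1)).
    apply: ler_wpM2l; first exact: ltW.
    by apply: le_trans h1 _; rewrite mulrC.
  by rewrite ?mulrN ?mulNr; lra.
have A0 : 0 <= A.
  rewrite leNgt; apply/negP => A0.
  have C1 : 0 < `|C| + 1 by rewrite ltr_wpDl.
  (* For this [e] the error [2 e C] is at most [- A / 2], so that [A + 2 e C] would be negative. *)
  have e0 : 0 < - A / (4 * (`|C| + 1)) by rewrite divr_gt0 ?oppr_gt0// mulr_gt0.
  have := step _ e0; apply/negP; rewrite -ltNge.
  have : - A / (4 * (`|C| + 1)) * C <= - A / 4.
    rewrite invfM mulrA -mulrA ger_pMr; last by rewrite divr_gt0// oppr_gt0.
    by rewrite ler_pdivrMl// mulr1 (le_trans (ler_norm _))// lerDl.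
  rewrite -[2 * _ * C]mulrA; move: (_ / _ * C) => X XA; lra.
(* Both integrals in [A] are [k] times integrals over [M1]; [W] enters the fibre sum because its
   lift is constant on fibres. *)
have [k k0 kE] := integral_fibre_sum Hp con.
have WE y : (W \* F) y = @fibre_sum _ _ M1 M0 p ((W \o p) \* (f \* f)) y.
  by rewrite (fibre_sumM Hp).
have tWf : test_functions M1 ((W \o p) \* (f \* f)) by apply: testMl => //; exact: (smooth_lift Hp).
move: A0; rewrite /A kE//; under [X in _ + X]eq_Rintegral do rewrite WE.
by rewrite kE// -mulrDr pmulr_rge0.
Qed.

End covering_form.

Theorem theorem1 (R : realType) (n : nat) (M1 M0 : riemannianManifold R n)
    (p : M1 -> M0) (V0 : M0 -> R)
    (M1_connected : connected [set: M1])
    (M0_connected : connected [set: M0])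
    (p_covering : riemannian_covering p)
    (V0_smooth : smooth V0)
    (S0_bounded_below :
      bounded_below (vol M0) (test_functions M0) (schrodinger V0))
    (S1_bounded_below :
      bounded_below (vol M1) (test_functions M1) (schrodinger (V0 \o p))) :
  (bottom_spectrum (schrodinger V0) <= bottom_spectrum (schrodinger (V0 \o p)))%E.
Proof.
have sV1 := smooth_lift p_covering V0_smooth.
(* For [l] in the spectrum of the lift, no [lam > l] can bound the form on [M0] from below: such a
   bound would lift and put [l] in the resolvent set. *)
apply: le_ereal_inf_tmp => _ [l l1 <-].
apply: (bottom_spectrum_le V0_smooth) => // lam llam.
move=> /(form_ge_lift p_covering M1_connected V0_smooth) q1.
exact: l1 (schrodinger_resolvent sV1 q1 llam).
Qed.
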